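(* Let $-1\leq b<a\leq 1$, let $\alpha\in(0,1]$, let $n\geq 1$ be an integer, and let $\Phi$ be a convex non-decreasing function on $(-\infty,\infty)$. Then for every $f\in T_n^\alpha[a,b]$ and every $r\in(0,1)$, $$\int_{-\pi}^\pi\Phi\left(\log|f'(re^{i\theta})|\right)d\theta\leq\int_{-\pi}^\pi\Phi\left(\log\left|\frac{L_{n-1}(a,b:re^{i\theta})\,k'(re^{i\theta})^{1-\alpha}}{L_0(re^{i\theta})^{1-\alpha}}\right|\right)d\theta,$$ where $k(z)=z/(1-z)^2$ is the Koebe function, $L_0(z)=(1+z)/(1-z)$, $L_0(a,b:z)=(1+az)/(1+bz)$, and $$L_m(a,b:z)=\frac{\alpha}{z^\alpha}\int_0^z t^{\alpha-1}L_{m-1}(a,b:t)\,dt,\qquad m\geq 1.$$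
   Context: Let $A$ be the class of analytic functions $f(z)=z+a_2z^2+\cdots$ in the unit disk $|z|<1$. For $-1\leq b<a\leq 1$, $P[a,b]$ is the family of Janowski functions: analytic functions $p(z)=1+c_1z+\cdots$ in $|z|<1$ that are subordinate to $L_0(a,b:z)=(1+az)/(1+bz)$, i.e. $p(z)=L_0(a,b:w(z))$ for some analytic $w$ in $|z|<1$ with $w(0)=0$ and $|w(z)|<1$. The Salagean derivative is $D^0g(z)=g(z)$, $D^ng(z)=z[D^{n-1}g(z)]'$ for $n\geq1$. For $\alpha>0$, the class $T_n^\alpha[a,b]$ consists of the functions $f\in A$ such that $$\frac{D^n\big(f(z)^\alpha\big)}{\alpha^n z^\alpha}\in P[a,b].$$ Here $D^n$ is applied to the function $f(z)^\alpha$, and powers are principal determinations: $f(z)\neq0$ for $0<|z|<1$, and $f(z)^\alpha=z^\alpha F(z)$, where $F(z)=(f(z)/z)^\alpha$ is the analytic branch with $F(0)=1$. Thus $D^n(f(z)^\alpha)/z^\alpha=\big(\alpha+z\frac{d}{dz}\big)^nF(z)$ is a single-valued analytic function. The integral defining $L_m$ is understood so that $L_m$ is analytic in $|z|<1$: $L_m(a,b:z)=\alpha\int_0^1 s^{\alpha-1}L_{m-1}(a,b:sz)\,ds$. The functions $L_m$ depend on $\alpha$. Only moduli of the powers with exponent $1-\alpha$ enter the claim. *)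

(* Defs.v *)
From Stdlib Require Import Reals.
From Coquelicot Require Import Coquelicot.

Open Scope R_scope.

Definition holomorphic_on_disk (g : C -> C) : Prop :=
  forall z : C, Cmod z < 1 -> ex_derive (V := C_NormedModule) g z.

Definition Cexp (z : C) : C := (exp (Re z) * cos (Im z), exp (Re z) * sin (Im z)).

(** Principal argument, with values in (-PI, PI]; meaningful for [z <> 0]. *)
Definition Carg (z : C) : R :=
  if Rlt_dec (Im z) 0 then - acos (Re z / Cmod z) else acos (Re z / Cmod z).

Definition Clog (z : C) : C := (ln (Cmod z), Carg z).

(** Principal determination of [z ^ s] for real [s]; meaningful for [z <> 0]. *)
Definition Cpower (z : C) (s : R) : C := Cexp (RtoC s * Clog z)%C.

Definition slit_disk (z : C) : Prop :=
  Cmod z < 1 /\ ~ (Im z = 0 /\ Re z <= 0).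

Definition class_A (f : C -> C) : Prop :=
  holomorphic_on_disk f /\ f (RtoC 0) = RtoC 0 /\ C_derive f (RtoC 0) = RtoC 1.

Definition L0 (a b : R) (z : C) : C := ((1 + a * z) / (1 + b * z))%C.

Definition janowski (a b : R) (p : C -> C) : Prop :=
  holomorphic_on_disk p /\ p (RtoC 0) = RtoC 1 /\
  exists w : C -> C,
    holomorphic_on_disk w /\ w (RtoC 0) = RtoC 0 /\
    (forall z : C, Cmod z < 1 -> Cmod (w z) < 1) /\
    (forall z : C, Cmod z < 1 -> p z = L0 a b (w z)).

Fixpoint salagean (n : nat) (g : C -> C) : C -> C :=
  match n with
  | O => g
  | S m => fun z => (z * C_derive (salagean m g) z)%C
  end.

(** [F] is the analytic branch of [(f z / z) ^ alpha] with [F 0 = 1]; here [h] is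
    the analytic branch of [log (f z / z)] that vanishes at the origin. *)
Definition quotient_power (alpha : R) (f F : C -> C) : Prop :=
  exists h : C -> C,
    holomorphic_on_disk h /\ h (RtoC 0) = RtoC 0 /\
    forall z : C, Cmod z < 1 ->
      f z = (z * Cexp (h z))%C /\ F z = Cexp (RtoC alpha * h z)%C.

(** With [z ^ alpha] principal, [f z ^ alpha = z ^ alpha * F z] is analytic only on
    the slit disk, but the quotient in the last line extends analytically to the
    whole disk; it is this extension [p] which has to be a Janowski function. *)
Definition class_T (n : nat) (alpha a b : R) (f : C -> C) : Prop :=
  class_A f /\
  (forall z : C, 0 < Cmod z < 1 -> f z <> RtoC 0) /\
  exists F : C -> C, quotient_power alpha f F /\
  exists p : C -> C, janowski a b p /\
    forall z : C, slit_disk z ->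
      (salagean n (fun u => Cpower u alpha * F u) z
         / (RtoC (alpha ^ n) * Cpower z alpha))%C = p z.

(** The substitution [t = s z] in [alpha / z ^ alpha * int_0^z t ^ (alpha - 1) ...]
    makes the formula single-valued; the real integral is improper at [0]. *)
Fixpoint Lfun (alpha a b : R) (m : nat) (z : C) : C :=
  match m with
  | O => L0 a b z
  | S k =>
      (RtoC alpha *
       RInt_gen (V := C_R_CompleteNormedModule)
         (fun s : R => (RtoC (Rpower s (alpha - 1)) * Lfun alpha a b k (RtoC s * z))%C)
         (at_right 0) (at_point 1))%C
  end.

Definition koebe (z : C) : C := (z / (1 - z) ^ 2)%C.

Definition half_plane_map (z : C) : C := ((1 + z) / (1 - z))%C.

Definition convex_fun (Phi : R -> R) : Prop :=
  forall x y t : R, 0 <= t <= 1 ->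
    Phi (t * x + (1 - t) * y) <= t * Phi x + (1 - t) * Phi y.

Definition nondecreasing (Phi : R -> R) : Prop :=
  forall x y : R, x <= y -> Phi x <= Phi y.

Definition circle_point (r theta : R) : C := (RtoC r * Cexp (RtoC theta * Ci))%C.

(* Main.v *)
Require Import Defs.
From Stdlib Require Import Reals Lra Lia Psatz Classical ClassicalEpsilon.
From Coquelicot Require Import Coquelicot.

Open Scope R_scope.

(** Write [f = z exp h] and [P = exp (alpha h) (1 + z h')], so that
    [f' = P exp ((1 - alpha) h)].  The hypothesis says that [P] arises from a Janowski function
    [L0 (w0)] by [n - 1] averagings [g -> alpha int_0^1 s^(alpha - 1) g (s z) ds], which also turn
    [L0] into [L_(n-1)].  The averaging preserves convexity and subordination, because a function [R]
    with [Re (R + z R' / Q) > 0], [Re Q > 0], has [Re R > 0] (look at a first zero of [Re R]); hence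
    [P = L_(n-1) (w1)] with [|w1 z| <= |z|].  Since [Re P > 0], Jack's lemma gives
    [f / z = 1 / (1 - w2)^2] with [|w2 z| <= |z|].  So [log |f'|] is the sum of two terms
    subordinate to [log |L_(n-1)|] and to [(1 - alpha) log |k / z|].  By Littlewood's theorem each
    term has smaller integrals of [max (. - c) 0] than its majorant; both majorants decrease with
    [|theta|], so thresholds can be split and the inequality holds for the sum, and then for every
    convex non-decreasing [Phi], a limit of sums of such hinges.  Finally
    [|k' / half_plane_map| = |k / z| = 1 / |1 - z|^2]. *)

(** * Complex differentiability *)

(** Littlewood's theorem cannot be applied to the two terms together, since they come with different
    functions [w1] and [w2]. Hence the detour through split thresholds, and the need for both
    majorants to be monotone in the angle in the same sense. For [L_(n-1)] this is not proved from
    moduli, which do not add, but for the products [Re (g (s e^(it)) conj (g (s' e^(it))))] with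
    independent radii, which are additive in each factor and so can be averaged. The splitting is
    [log |f'| = log |P| + (1 - alpha) Re h] with [exp (- h / 2) = 1 - w2]. The bound [alpha <= 1]
    makes the last coefficient nonnegative and the contact estimate for [w2] valid. The averaging
    appears because conjugation by [z^alpha] turns the Salagean operator into
    [alpha (1 + (z / alpha) d/dz)], whose inverse it is up to the factor [alpha]. Subordination
    passes through it in terms of derivatives: [Re (1 + z T' / T) > 0] for [T = L'] and
    [Re (E / T) >= 0] for [L - p = z E] are both stable under the averaging that [T] undergoes. The
    function theory, from Goursat's theorem to the Poisson formula and Schwarz's lemma, is derived
    on the way. *)

Definition cderiv (f : C -> C) (z l : C) : Prop :=
  is_derive (K := C_AbsRing) (V := C_NormedModule) f z l.
Notation ccont := (@continuous C_UniformSpace C_UniformSpace).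

Lemma C_ext (z w : C) : Re z = Re w -> Im z = Im w -> z = w.
Proof. destruct z, w; simpl; intros -> ->; reflexivity. Qed.

Lemma Cmod_sub_sym (z w : C) : Cmod (z - w) = Cmod (w - z).
Proof. rewrite <- Cmod_opp. f_equal. ring. Qed.

Lemma im_le_Cmod (z : C) : Rabs (Im z) <= Cmod z.
Proof.
  replace (Im z) with (Re (- Ci * z)%C) by (destruct z; simpl; ring).
  apply Rle_trans with (1 := re_le_Cmod _). rewrite Cmod_mult, Cmod_opp, Cmod_Ci. lra.
Qed.

Lemma Cmod_le_Re_Im (z : C) : Cmod z <= Rabs (Re z) + Rabs (Im z).
Proof.
  replace z with (RtoC (Re z) + Ci * RtoC (Im z))%C at 1
    by (destruct z; unfold RtoC, Ci; apply C_ext; simpl; ring).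
  apply Rle_trans with (1 := Cmod_triangle _ _).
  rewrite Cmod_mult, Cmod_Ci, !Cmod_R. lra.
Qed.

(** Two uniform structures meet on [C]: the balls of [C_UniformSpace], used for continuity, are
    squares, while [is_derive] takes the neighbourhoods of its argument from the absolute value. The
    three [locally] lemmas bring everything to epsilon-delta statements in [Cmod] and [Rabs]. *)
Lemma locally_Cmod (z : C) (P : C -> Prop) :
  @locally C_UniformSpace z P <->
  exists d : R, 0 < d /\ forall w, Cmod (w - z) < d -> P w.
Proof.
  split.
  - intros [d H]. exists d. split. apply cond_pos.
    intros w Hw. apply H. apply (C_NormedModule_mixin_compat1 z w d). exact Hw.
  - intros (d & Hd & H).
    assert (Hd2 : 0 < d / 2) by lra.
    exists (mkposreal _ Hd2). intros w [H1 H2].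
    apply H. apply Rle_lt_trans with (1 := Cmod_le_Re_Im _).
    unfold ball in H1, H2; simpl in H1, H2.
    unfold AbsRing_ball, abs, minus, plus, opp in H1, H2; simpl in H1, H2.
    destruct w, z; simpl in *.
    unfold Rminus. lra.
Qed.

Lemma locally_R (x : R) (P : R -> Prop) :
  @locally R_UniformSpace x P <->
  exists d : R, 0 < d /\ forall y, Rabs (y - x) < d -> P y.
Proof.
  split.
  - intros [d H]. exists d. split. apply cond_pos. intros y Hy. apply H. exact Hy.
  - intros (d & Hd & H). exists (mkposreal _ Hd). intros y Hy. apply H. exact Hy.
Qed.

Lemma locally_CA (z : C) (P : C -> Prop) :
  @locally (AbsRing_UniformSpace C_AbsRing) z P <->
  exists d : R, 0 < d /\ forall w, Cmod (w - z) < d -> P w.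
Proof.
  split.
  - intros [d H]. exists d. split. apply cond_pos. intros y Hy. apply H. exact Hy.
  - intros (d & Hd & H). exists (mkposreal _ Hd). intros y Hy. apply H. exact Hy.
Qed.

Lemma cderiv_eps (f : C -> C) (z l : C) :
  cderiv f z l <->
  (forall eps : R, 0 < eps -> exists d : R, 0 < d /\ forall w, Cmod (w - z) < d ->
     Cmod (f w - f z - (w - z) * l) <= eps * Cmod (w - z)).
Proof.
  split.
  - intros [_ H] eps Heps.
    specialize (H z (fun P HP => HP) (mkposreal _ Heps)).
    apply locally_CA in H. destruct H as (d & Hd & H). exists d. split; [exact Hd|].
    intros w Hw. exact (H w Hw).
  - intros H. split.
    + apply (is_linear_scal_l (K := C_AbsRing) (V := C_NormedModule)).
    + intros x Hx eps.
      assert (E : z = x).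
      { apply (is_filter_lim_locally_unique (K := C_AbsRing) (V := AbsRing_NormedModule C_AbsRing)). exact Hx. }
      subst x.
      destruct (H eps (cond_pos eps)) as (d & Hd & H').
      apply locally_CA. exists d. split; [exact Hd|]. exact H'.
Qed.

Lemma ccont_eps (f : C -> C) (z : C) :
  ccont f z <->
  (forall eps : R, 0 < eps -> exists d : R, 0 < d /\ forall w, Cmod (w - z) < d ->
     Cmod (f w - f z) < eps).
Proof.
  split.
  - intros H eps Heps.
    assert (H0 : @locally C_UniformSpace (f z) (fun v => Cmod (v - f z) < eps)).
    { apply locally_Cmod. exists eps. split; [exact Heps|]. tauto. }
    specialize (H _ H0). apply locally_Cmod in H. exact H.
  - intros H P HP. apply locally_Cmod in HP. destruct HP as (e & He & HP).
    destruct (H e He) as (d & Hd & H'). apply locally_Cmod. exists d. split; [exact Hd|].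
    intros w Hw. apply HP, H', Hw.
Qed.

Lemma cderiv_unique (f : C -> C) (z l : C) : cderiv f z l -> C_derive f z = l.
Proof. apply is_C_derive_unique. Qed.

Lemma cderiv_eq (f : C -> C) (z l m : C) : cderiv f z l -> l = m -> cderiv f z m.
Proof. intros H <-. exact H. Qed.

Lemma cderiv_const (c z : C) : cderiv (fun _ => c) z 0%C.
Proof. apply (is_derive_const (K := C_AbsRing) (V := C_NormedModule)). Qed.

Lemma cderiv_id (z : C) : cderiv (fun w => w) z 1%C.
Proof.
  apply cderiv_eps. intros eps He. exists 1. split; [lra|]. intros w _.
  replace (w - z - (w - z) * 1)%C with (RtoC 0) by ring. rewrite Cmod_0.
  apply Rmult_le_pos; [lra|apply Cmod_ge_0].
Qed.

Lemma cderiv_plus (f g : C -> C) (z l m : C) :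
  cderiv f z l -> cderiv g z m -> cderiv (fun w => f w + g w)%C z (l + m)%C.
Proof. apply (is_derive_plus (K := C_AbsRing) (V := C_NormedModule)). Qed.

Lemma cderiv_minus (f g : C -> C) (z l m : C) :
  cderiv f z l -> cderiv g z m -> cderiv (fun w => f w - g w)%C z (l - m)%C.
Proof. apply (is_derive_minus (K := C_AbsRing) (V := C_NormedModule)). Qed.

Lemma cderiv_opp (f : C -> C) (z l : C) : cderiv f z l -> cderiv (fun w => - f w)%C z (- l)%C.
Proof. apply (is_derive_opp (K := C_AbsRing) (V := C_NormedModule)). Qed.

Lemma cderiv_ext_loc (f g : C -> C) (z l : C) (d : R) : 0 < d ->
  (forall w, Cmod (w - z) < d -> f w = g w) -> cderiv f z l -> cderiv g z l.
Proof.
  intros Hd H. apply (is_derive_ext_loc (K := C_AbsRing) (V := C_NormedModule)).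
  apply locally_CA. exists d. split; assumption.
Qed.

Lemma cderiv_ext (f g : C -> C) (z l : C) : (forall w, f w = g w) -> cderiv f z l -> cderiv g z l.
Proof. intros H. apply (cderiv_ext_loc f g z l 1 Rlt_0_1). intros; apply H. Qed.

Lemma cderiv_lip (f : C -> C) (z l : C) : cderiv f z l ->
  exists d, 0 < d /\ forall w, Cmod (w - z) < d -> Cmod (f w - f z) <= (Cmod l + 1) * Cmod (w - z).
Proof.
  intros H. destruct (proj1 (cderiv_eps f z l) H 1 Rlt_0_1) as (d & Hd & H').
  exists d. split; [exact Hd|]. intros w Hw. specialize (H' w Hw).
  replace (f w - f z)%C with ((f w - f z - (w - z) * l) + (w - z) * l)%C by ring.
  apply Rle_trans with (1 := Cmod_triangle _ _). rewrite Cmod_mult. lra.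
Qed.

Lemma cderiv_cont (f : C -> C) (z l : C) : cderiv f z l -> ccont f z.
Proof.
  intros H. apply ccont_eps. intros eps Heps.
  destruct (cderiv_lip f z l H) as (d & Hd & H').
  pose proof (Cmod_ge_0 l).
  exists (Rmin d (eps / (Cmod l + 1))). split.
  { apply Rmin_pos; [lra|]. apply Rdiv_lt_0_compat; lra. }
  intros w Hw. apply Rle_lt_trans with (1 := H' w (Rlt_le_trans _ _ _ Hw (Rmin_l _ _))).
  pose proof (Rlt_le_trans _ _ _ Hw (Rmin_r _ _)) as Hw2.
  apply (Rmult_lt_compat_l (Cmod l + 1)) in Hw2; [|lra].
  replace ((Cmod l + 1) * (eps / (Cmod l + 1))) with eps in Hw2 by (field; lra). lra.
Qed.

Lemma cderiv_comp (f g : C -> C) (z l m : C) :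
  cderiv f (g z) l -> cderiv g z m -> cderiv (fun w => f (g w)) z (l * m)%C.
Proof.
  intros Hf Hg. apply cderiv_eps. intros eps He.
  destruct (cderiv_lip g z m Hg) as (d1 & Hd1 & H1).
  pose proof (Cmod_ge_0 m). pose proof (Cmod_ge_0 l).
  destruct (proj1 (cderiv_eps _ _ _) Hf (eps / 2 / (Cmod m + 1))) as (d2 & Hd2 & H2).
  { apply Rdiv_lt_0_compat; lra. }
  destruct (proj1 (cderiv_eps _ _ _) Hg (eps / 2 / (Cmod l + 1))) as (d3 & Hd3 & H3).
  { apply Rdiv_lt_0_compat; lra. }
  destruct (proj1 (ccont_eps _ _) (cderiv_cont _ _ _ Hg) d2 Hd2) as (d4 & Hd4 & H4).
  exists (Rmin (Rmin d1 d3) d4). split.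
  { repeat apply Rmin_pos; assumption. }
  intros w Hw.
  assert (Hw1 : Cmod (w - z) < d1) by (eapply Rlt_le_trans; [exact Hw|]; eapply Rle_trans; [apply Rmin_l|apply Rmin_l]).
  assert (Hw3 : Cmod (w - z) < d3) by (eapply Rlt_le_trans; [exact Hw|]; eapply Rle_trans; [apply Rmin_l|apply Rmin_r]).
  assert (Hw4 : Cmod (w - z) < d4) by (eapply Rlt_le_trans; [exact Hw|]; apply Rmin_r).
  specialize (H1 w Hw1). specialize (H3 w Hw3). specialize (H4 w Hw4). specialize (H2 _ H4).
  replace (f (g w) - f (g z) - (w - z) * (l * m))%C with
    ((f (g w) - f (g z) - (g w - g z) * l) + (g w - g z - (w - z) * m) * l)%C by ring.
  apply Rle_trans with (1 := Cmod_triangle _ _). rewrite Cmod_mult.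
  pose proof (Cmod_ge_0 (w - z)).
  assert (A1 : eps / 2 / (Cmod m + 1) * Cmod (g w - g z) <= eps / 2 * Cmod (w - z)).
  { apply Rle_trans with (eps / 2 / (Cmod m + 1) * ((Cmod m + 1) * Cmod (w - z))).
    - apply Rmult_le_compat_l; [|exact H1]. apply Rlt_le, Rdiv_lt_0_compat; lra.
    - right. field. lra. }
  assert (A2 : Cmod (g w - g z - (w - z) * m) * Cmod l <= eps / 2 * Cmod (w - z)).
  { apply Rle_trans with (eps / 2 / (Cmod l + 1) * Cmod (w - z) * (Cmod l + 1)).
    - apply Rmult_le_compat; try apply Cmod_ge_0; lra.
    - right. field. lra. }
  lra.
Qed.

Lemma cderiv_sqr (z : C) : cderiv (fun w => w * w)%C z (2 * z)%C.
Proof.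
  apply cderiv_eps. intros eps He. exists eps. split; [exact He|]. intros w Hw.
  replace (w * w - z * z - (w - z) * (2 * z))%C with ((w - z) * (w - z))%C by ring.
  rewrite Cmod_mult. pose proof (Cmod_ge_0 (w - z)). nra.
Qed.

Lemma cderiv_linear (c z : C) : cderiv (fun w => c * w)%C z c.
Proof.
  apply cderiv_eps. intros eps He. exists 1. split; [lra|]. intros w _.
  replace (c * w - c * z - (w - z) * c)%C with (RtoC 0) by ring. rewrite Cmod_0.
  apply Rmult_le_pos; [lra|apply Cmod_ge_0].
Qed.

(* Polarisation: 4 f g = (f + g)^2 - (f - g)^2. *)
Lemma cderiv_mult (f g : C -> C) (z l m : C) :
  cderiv f z l -> cderiv g z m -> cderiv (fun w => f w * g w)%C z (l * g z + f z * m)%C.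
Proof.
  intros Hf Hg.
  pose proof (cderiv_comp _ _ _ _ _ (cderiv_sqr _) (cderiv_plus _ _ _ _ _ Hf Hg)) as H1.
  pose proof (cderiv_comp _ _ _ _ _ (cderiv_sqr _) (cderiv_minus _ _ _ _ _ Hf Hg)) as H2.
  pose proof (cderiv_minus _ _ _ _ _ H1 H2) as H3. cbv beta in H3.
  pose proof (cderiv_comp _ _ _ _ _ (cderiv_linear (/ 4) _) H3) as H4.
  replace (l * g z + f z * m)%C with
    (/ 4 * (2 * (f z + g z) * (l + m) - 2 * (f z - g z) * (l - m)))%C by field.
  revert H4. apply cderiv_ext. intros w. field.
Qed.

Lemma cderiv_inv1 (z : C) : z <> 0%C -> cderiv (fun w => / w)%C z (- / (z * z))%C.
Proof.
  intros Hz. pose proof (proj1 (Cmod_gt_0 z) Hz) as Hm.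
  apply cderiv_eps. intros eps He. set (m := Cmod z) in *.
  exists (Rmin (m / 2) (eps * (m * m * m) / 2)). split.
  { apply Rmin_pos; [lra|]. apply Rdiv_lt_0_compat; [|lra]. repeat apply Rmult_lt_0_compat; assumption. }
  intros w Hw.
  assert (H1 : Cmod (w - z) < m / 2) by (eapply Rlt_le_trans; [exact Hw|apply Rmin_l]).
  assert (H2 : Cmod (w - z) < eps * (m * m * m) / 2) by (eapply Rlt_le_trans; [exact Hw|apply Rmin_r]).
  assert (Hw2 : m / 2 <= Cmod w).
  { assert (m <= Cmod w + Cmod (w - z)); [|lra].
    unfold m. replace z with (w + - (w - z))%C at 1 by ring.
    apply Rle_trans with (1 := Cmod_triangle _ _). rewrite Cmod_opp. lra. }
  assert (Hw0 : w <> 0%C). { apply Cmod_gt_0. lra. }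
  replace (/ w - / z - (w - z) * - / (z * z))%C with ((w - z) * ((w - z) * / (w * z * z)))%C by (field; auto).
  rewrite !Cmod_mult, Cmod_inv, !Cmod_mult; try (repeat apply Cmult_neq_0; auto).
  pose proof (Cmod_ge_0 (w - z)). fold m.
  rewrite (Rmult_comm eps). apply Rmult_le_compat_l; [assumption|].
  apply Rle_trans with (eps * (m * m * m) / 2 * / (m / 2 * m * m)).
  - apply Rmult_le_compat; try lra.
    + apply Rlt_le, Rinv_0_lt_compat. repeat apply Rmult_lt_0_compat; lra.
    + apply Rinv_le_contravar. repeat apply Rmult_lt_0_compat; lra.
      apply Rmult_le_compat_r; [lra|]. apply Rmult_le_compat_r; lra.
  - right. field. lra.
Qed.

Lemma cderiv_inv (f : C -> C) (z l : C) : cderiv f z l -> f z <> 0%C ->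
  cderiv (fun w => / f w)%C z (- l / (f z * f z))%C.
Proof.
  intros H Hz. replace (- l / (f z * f z))%C with (- / (f z * f z) * l)%C by (field; auto).
  apply (cderiv_comp Cinv f). apply cderiv_inv1, Hz. exact H.
Qed.

Lemma cderiv_div (f g : C -> C) (z l m : C) : cderiv f z l -> cderiv g z m -> g z <> 0%C ->
  cderiv (fun w => f w / g w)%C z ((l * g z - f z * m) / (g z * g z))%C.
Proof.
  intros Hf Hg Hz.
  replace ((l * g z - f z * m) / (g z * g z))%C with (l * / g z + f z * (- m / (g z * g z)))%C by (field; auto).
  apply (cderiv_mult f (fun w => / g w)%C); [exact Hf|]. apply cderiv_inv; assumption.
Qed.

Lemma is_derive_eps (f : R -> R) (x l : R) :
  is_derive f x l <->
  (forall eps : R, 0 < eps -> exists d : R, 0 < d /\ forall y, Rabs (y - x) < d ->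
     Rabs (f y - f x - (y - x) * l) <= eps * Rabs (y - x)).
Proof.
  split.
  - intros [_ H] eps Heps.
    specialize (H x (fun P HP => HP) (mkposreal _ Heps)).
    apply locally_R in H. destruct H as (d & Hd & H). exists d. split; [exact Hd|].
    intros w Hw. exact (H w Hw).
  - intros H. split.
    + apply (is_linear_scal_l (K := R_AbsRing)).
    + intros y Hy eps.
      assert (E : x = y) by (apply (is_filter_lim_locally_unique (K := R_AbsRing) (V := R_NormedModule)); exact Hy).
      subst y.
      destruct (H eps (cond_pos eps)) as (d & Hd & H').
      apply locally_R. exists d. split; [exact Hd|]. exact H'.
Qed.

(** * The complex exponential *)

Lemma Cexp_plus (z w : C) : Cexp (z + w) = (Cexp z * Cexp w)%C.
Proof.
  destruct z as [x y], w as [u v]. unfold Cexp. simpl. rewrite exp_plus, cos_plus, sin_plus.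
  apply C_ext; simpl; ring.
Qed.

Lemma Cexp_0 : Cexp 0 = 1%C.
Proof. unfold Cexp. simpl. rewrite exp_0, cos_0, sin_0. apply C_ext; simpl; ring. Qed.

Lemma Cmod_Cexp (z : C) : Cmod (Cexp z) = exp (Re z).
Proof.
  unfold Cmod, Cexp; simpl.
  replace (_ + _) with ((exp (fst z)) ^ 2 * ((sin (snd z)) ^ 2 + (cos (snd z)) ^ 2)) by (unfold Re, Im; ring).
  rewrite <- (Rsqr_pow2 (sin _)), <- (Rsqr_pow2 (cos _)), sin2_cos2, Rmult_1_r.
  rewrite sqrt_pow2; [reflexivity|]. apply Rlt_le, exp_pos.
Qed.

Lemma Cexp_neq_0 (z : C) : Cexp z <> 0%C.
Proof. apply Cmod_gt_0. rewrite Cmod_Cexp. apply exp_pos. Qed.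

Lemma Cexp_opp (z : C) : Cexp (- z) = (/ Cexp z)%C.
Proof.
  assert (H : (Cexp (- z) * Cexp z)%C = 1%C).
  { rewrite <- Cexp_plus. replace (- z + z)%C with (RtoC 0) by ring. apply Cexp_0. }
  replace (/ Cexp z)%C with (1 / Cexp z)%C by (field; apply Cexp_neq_0).
  rewrite <- H. field. apply Cexp_neq_0.
Qed.

Lemma cderiv_Cexp0 : cderiv Cexp 0 1.
Proof.
  apply cderiv_eps. intros eps He.
  (* The errors of the real and imaginary parts will be at most [3 * (e * m)] and [4 * (e * m)], so
     a tenth of [eps] suffices; [e <= 1] serves to absorb products of small terms. *)
  assert (He' : 0 < Rmin (eps / 10) 1) by (apply Rmin_pos; lra).
  set (e := Rmin (eps / 10) 1) in *.
  assert (e1 : e <= eps / 10) by apply Rmin_l. assert (e2 : e <= 1) by apply Rmin_r. clearbody e.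
  destruct (proj1 (is_derive_eps exp 0 1)) with (eps := e) as (d1 & Hd1 & H1); auto.
  { replace 1 with (exp 0) by apply exp_0. apply is_derive_exp. }
  destruct (proj1 (is_derive_eps cos 0 0)) with (eps := e) as (d2 & Hd2 & H2); auto.
  { replace 0 with (- sin 0) at 2 by (rewrite sin_0; ring). apply is_derive_cos. }
  destruct (proj1 (is_derive_eps sin 0 1)) with (eps := e) as (d3 & Hd3 & H3); auto.
  { replace 1 with (cos 0) by apply cos_0. apply is_derive_sin. }
  set (d := Rmin (Rmin d1 d2) (Rmin d3 e)).
  assert (dd1 : d <= d1) by (eapply Rle_trans; apply Rmin_l).
  assert (dd2 : d <= d2) by (eapply Rle_trans; [apply Rmin_l|apply Rmin_r]).
  assert (dd3 : d <= d3) by (eapply Rle_trans; [apply Rmin_r|apply Rmin_l]).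
  assert (dd4 : d <= e) by (eapply Rle_trans; apply Rmin_r).
  exists d. split. { repeat apply Rmin_pos; assumption. }
  intros w Hw. replace (w - 0)%C with w in * by ring. rewrite Cexp_0.
  pose proof (re_le_Cmod w) as Hx. pose proof (im_le_Cmod w) as Hy.
  destruct w as [x y]. unfold Cexp. simpl Re in *; simpl Im in *. set (m := Cmod (x, y)) in *.
  specialize (H1 x). specialize (H2 y). specialize (H3 y). rewrite ?exp_0, ?cos_0, ?sin_0 in *.
  rewrite Rminus_0_r in *. specialize (H1 ltac:(lra)). specialize (H2 ltac:(lra)). specialize (H3 ltac:(lra)).
  apply Rle_trans with (1 := Cmod_le_Re_Im _). simpl.
  assert (Hm : 0 <= m) by apply Cmod_ge_0.
  pose proof (Rabs_pos x). pose proof (Rabs_pos y).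
  assert (Ex : Rabs (exp x - 1 - x) <= e * m). { rewrite Rmult_1_r in H1. nra. }
  assert (Cy : Rabs (cos y - 1) <= e * m). { replace (cos y - 1) with (cos y - 1 - y * 0) by ring. nra. }
  assert (Sy : Rabs (sin y - y) <= e * m). { replace (sin y - y) with (sin y - 0 - y * 1) by ring. nra. }
  assert (me : m <= e) by lra.
  apply Rabs_le_between in Ex. apply Rabs_le_between in Cy. apply Rabs_le_between in Sy.
  apply Rabs_le_between in Hx. apply Rabs_le_between in Hy.
  pose proof (COS_bound y) as Cb. pose proof (SIN_bound y) as Sb.
  assert (K1 : Rabs (exp x * cos y + - (1) + - (x * 1 - y * 0)) <= 3 * (e * m)).
  { replace (exp x * cos y + - (1) + - (x * 1 - y * 0)) with ((exp x - 1 - x) * cos y + (1 + x) * (cos y - 1)) by ring.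
    apply Rabs_le. nra. }
  assert (K2 : Rabs (exp x * sin y + - 0 + - (x * 0 + y * 1)) <= 4 * (e * m)).
  { replace (exp x * sin y + - 0 + - (x * 0 + y * 1)) with ((exp x - 1 - x) * sin y + x * sin y + (sin y - y)) by ring.
    assert (Rabs (x * sin y) <= 2 * (e * m)).
    { rewrite Rabs_mult. apply Rle_trans with (m * (2 * e)); [|lra].
      apply Rmult_le_compat; try apply Rabs_pos; apply Rabs_le; nra. }
    apply Rabs_le_between in H4. apply Rabs_le. nra. }
  nra.
Qed.

Lemma cderiv_Cexp (z : C) : cderiv Cexp z (Cexp z).
Proof.
  apply cderiv_ext with (f := (fun w => Cexp z * Cexp (w - z))%C).
  { intros w. rewrite <- Cexp_plus. f_equal. ring. }
  assert (H : cderiv (fun w => Cexp (w - z)) z (1 * 1)).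
  { apply (cderiv_comp Cexp (fun w => w - z)%C).
    - replace (z - z)%C with (RtoC 0) by ring. apply cderiv_Cexp0.
    - replace (RtoC 1) with (1 - 0)%C by ring. apply cderiv_minus; [apply cderiv_id|apply cderiv_const]. }
  pose proof (cderiv_mult _ _ _ _ _ (cderiv_const (Cexp z) z) H) as H2.
  apply (cderiv_eq _ _ _ _ H2). ring_simplify (z - z)%C. rewrite Cexp_0. ring.
Qed.

(** * Continuity and integrals of complex-valued functions *)

Notation ctsC := (continuous (U := C_UniformSpace)).
Notation ctsR := (continuous (U := R_UniformSpace)).

Lemma cont_C {T : UniformSpace} (F : T -> C) (x : T) :
  ctsC F x <-> ctsR (fun t => Re (F t)) x /\ ctsR (fun t => Im (F t)) x.
Proof.
  split.
  - intros H. split.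
    + apply (continuous_comp (V := C_UniformSpace) F fst); [exact H|].
      apply (continuous_fst (U := R_UniformSpace) (V := R_UniformSpace)).
    + apply (continuous_comp (V := C_UniformSpace) F snd); [exact H|].
      apply (continuous_snd (U := R_UniformSpace) (V := R_UniformSpace)).
  - intros [H1 H2] P [e He].
    change (locally x (fun t => P (F t))).
    apply (filter_imp (F := locally x) (fun t => ball (Re (F x)) e (Re (F t)) /\ ball (Im (F x)) e (Im (F t)))).
    + intros t [K1 K2]. apply He. split; assumption.
    + apply (filter_and (F := locally x)); [apply H1|apply H2]; apply locally_ball.
Qed.

Lemma cont_Re {T : UniformSpace} (F : T -> C) (x : T) : ctsC F x -> ctsR (fun t => Re (F t)) x.
Proof. apply cont_C. Qed.

Lemma cont_Im {T : UniformSpace} (F : T -> C) (x : T) : ctsC F x -> ctsR (fun t => Im (F t)) x.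
Proof. apply cont_C. Qed.

Lemma cont_Rplus {T : UniformSpace} (f g : T -> R) x : ctsR f x -> ctsR g x -> ctsR (fun t => f t + g t) x.
Proof. apply (continuous_plus (K := R_AbsRing) (V := R_NormedModule)). Qed.

Lemma cont_Rminus {T : UniformSpace} (f g : T -> R) x : ctsR f x -> ctsR g x -> ctsR (fun t => f t - g t) x.
Proof. apply (continuous_minus (K := R_AbsRing) (V := R_NormedModule)). Qed.

Lemma cont_Ropp {T : UniformSpace} (f : T -> R) x : ctsR f x -> ctsR (fun t => - f t) x.
Proof. apply (continuous_opp (K := R_AbsRing) (V := R_NormedModule)). Qed.

Lemma cont_Rmult {T : UniformSpace} (f g : T -> R) x : ctsR f x -> ctsR g x -> ctsR (fun t => f t * g t) x.
Proof. apply (continuous_mult (K := R_AbsRing)). Qed.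

Lemma cont_comp_R {T : UniformSpace} (h : R -> R) (f : T -> R) x :
  ctsR f x -> continuity_pt h (f x) -> ctsR (fun t => h (f t)) x.
Proof.
  intros Hf Hh. apply (continuous_comp f h); [exact Hf|]. apply continuity_pt_filterlim. exact Hh.
Qed.

Lemma cont_Rinv {T : UniformSpace} (f : T -> R) x : ctsR f x -> f x <> 0 -> ctsR (fun t => / f t) x.
Proof.
  intros Hf H0. apply (cont_comp_R Rinv); [exact Hf|].
  apply continuity_pt_inv; [apply derivable_continuous_pt, derivable_pt_id|exact H0].
Qed.

Lemma cont_Rdiv {T : UniformSpace} (f g : T -> R) x :
  ctsR f x -> ctsR g x -> g x <> 0 -> ctsR (fun t => f t / g t) x.
Proof. intros. unfold Rdiv. apply cont_Rmult; [assumption|]. apply cont_Rinv; assumption. Qed.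

Lemma cont_exp {T : UniformSpace} (f : T -> R) x : ctsR f x -> ctsR (fun t => exp (f t)) x.
Proof. intros. apply cont_comp_R; [assumption|]. apply derivable_continuous_pt, derivable_pt_exp. Qed.

Lemma cont_cos {T : UniformSpace} (f : T -> R) x : ctsR f x -> ctsR (fun t => cos (f t)) x.
Proof. intros. apply cont_comp_R; [assumption|]. apply continuity_cos. Qed.

Lemma cont_sin {T : UniformSpace} (f : T -> R) x : ctsR f x -> ctsR (fun t => sin (f t)) x.
Proof. intros. apply cont_comp_R; [assumption|]. apply continuity_sin. Qed.

Lemma cont_ln {T : UniformSpace} (f : T -> R) x : ctsR f x -> 0 < f x -> ctsR (fun t => ln (f t)) x.
Proof.
  intros. apply cont_comp_R; [assumption|].
  apply derivable_continuous_pt. exists (/ f x). apply derivable_pt_lim_ln. assumption.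
Qed.

Lemma cont_sqrt {T : UniformSpace} (f : T -> R) x : ctsR f x -> 0 <= f x -> ctsR (fun t => sqrt (f t)) x.
Proof. intros. apply cont_comp_R; [assumption|]. apply continuity_pt_sqrt. assumption. Qed.

Lemma cont_Cplus {T : UniformSpace} (f g : T -> C) x : ctsC f x -> ctsC g x -> ctsC (fun t => f t + g t)%C x.
Proof.
  rewrite !cont_C. intros [H1 H2] [H3 H4]. split; simpl; apply cont_Rplus; assumption.
Qed.

Lemma cont_Copp {T : UniformSpace} (f : T -> C) x : ctsC f x -> ctsC (fun t => - f t)%C x.
Proof.
  rewrite !cont_C. intros [H1 H2]. split; simpl; apply cont_Ropp; assumption.
Qed.

Lemma cont_Cminus {T : UniformSpace} (f g : T -> C) x : ctsC f x -> ctsC g x -> ctsC (fun t => f t - g t)%C x.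
Proof. intros. apply cont_Cplus; [assumption|]. apply cont_Copp; assumption. Qed.

Lemma cont_Cmult {T : UniformSpace} (f g : T -> C) x : ctsC f x -> ctsC g x -> ctsC (fun t => f t * g t)%C x.
Proof.
  rewrite !cont_C. intros [H1 H2] [H3 H4]. split; simpl.
  - apply cont_Rminus; apply cont_Rmult; assumption.
  - apply cont_Rplus; apply cont_Rmult; assumption.
Qed.

Lemma cont_RtoC {T : UniformSpace} (f : T -> R) x : ctsR f x -> ctsC (fun t => RtoC (f t)) x.
Proof. rewrite cont_C. intros H. split; simpl; [exact H|apply continuous_const]. Qed.

Lemma cont_conj {T : UniformSpace} (f : T -> C) x : ctsC f x -> ctsC (fun t => Cconj (f t)) x.
Proof. rewrite !cont_C. intros [H1 H2]. split; simpl; [exact H1|apply cont_Ropp; exact H2]. Qed.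

Lemma cont_Cexp {T : UniformSpace} (f : T -> C) x : ctsC f x -> ctsC (fun t => Cexp (f t)) x.
Proof.
  rewrite !cont_C. intros [H1 H2]. split; simpl; apply cont_Rmult.
  - apply cont_exp, H1.
  - apply cont_cos, H2.
  - apply cont_exp, H1.
  - apply cont_sin, H2.
Qed.

Lemma cont_comp_cderiv {T : UniformSpace} (g : C -> C) (f : T -> C) x l :
  ctsC f x -> cderiv g (f x) l -> ctsC (fun t => g (f t)) x.
Proof.
  intros Hf Hg. apply (continuous_comp (V := C_UniformSpace) f g); [exact Hf|].
  apply cderiv_cont with (1 := Hg).
Qed.

Lemma cont_Cinv {T : UniformSpace} (f : T -> C) x : ctsC f x -> f x <> 0%C -> ctsC (fun t => / f t)%C x.
Proof. intros Hf H0. apply (cont_comp_cderiv Cinv f x _ Hf (cderiv_inv1 _ H0)). Qed.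

Lemma cont_Cdiv {T : UniformSpace} (f g : T -> C) x :
  ctsC f x -> ctsC g x -> g x <> 0%C -> ctsC (fun t => f t / g t)%C x.
Proof. intros. apply cont_Cmult; [assumption|]. apply cont_Cinv; assumption. Qed.

Lemma cont_Cmod {T : UniformSpace} (f : T -> C) x : ctsC f x -> ctsR (fun t => Cmod (f t)) x.
Proof.
  rewrite cont_C. intros [H1 H2]. unfold Cmod. apply cont_sqrt.
  - simpl. apply cont_Rplus; apply cont_Rmult; try assumption;
      (apply cont_Rmult; [assumption|apply continuous_const]).
  - nra.
Qed.

Ltac ct1 :=
  lazymatch goal with
  | |- continuous (fun _ => ?c) _ => apply continuous_const
  | |- continuous (fun x => x) _ => apply continuous_id
  | |- continuous (fun t => Cplus (@?f t) (@?g t)) _ => apply (cont_Cplus f g)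
  | |- continuous (fun t => Cminus (@?f t) (@?g t)) _ => apply (cont_Cminus f g)
  | |- continuous (fun t => Cmult (@?f t) (@?g t)) _ => apply (cont_Cmult f g)
  | |- continuous (fun t => Cdiv (@?f t) (@?g t)) _ => apply (cont_Cdiv f g)
  | |- continuous (fun t => Copp (@?f t)) _ => apply (cont_Copp f)
  | |- continuous (fun t => Cinv (@?f t)) _ => apply (cont_Cinv f)
  | |- continuous (fun t => Cconj (@?f t)) _ => apply (cont_conj f)
  | |- continuous (fun t => Cexp (@?f t)) _ => apply (cont_Cexp f)
  | |- continuous (fun t => RtoC (@?f t)) _ => apply (cont_RtoC f)
  | |- continuous (fun t => Re (@?f t)) _ => apply (cont_Re f)
  | |- continuous (fun t => Im (@?f t)) _ => apply (cont_Im f)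
  | |- continuous (fun t => Cmod (@?f t)) _ => apply (cont_Cmod f)
  | |- continuous (fun t => Rplus (@?f t) (@?g t)) _ => apply (cont_Rplus f g)
  | |- continuous (fun t => Rminus (@?f t) (@?g t)) _ => apply (cont_Rminus f g)
  | |- continuous (fun t => Rmult (@?f t) (@?g t)) _ => apply (cont_Rmult f g)
  | |- continuous (fun t => Rdiv (@?f t) (@?g t)) _ => apply (cont_Rdiv f g)
  | |- continuous (fun t => Ropp (@?f t)) _ => apply (cont_Ropp f)
  | |- continuous (fun t => Rinv (@?f t)) _ => apply (cont_Rinv f)
  | |- continuous (fun t => exp (@?f t)) _ => apply (cont_exp f)
  | |- continuous (fun t => cos (@?f t)) _ => apply (cont_cos f)
  | |- continuous (fun t => sin (@?f t)) _ => apply (cont_sin f)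
  | |- continuous (fun t => ln (@?f t)) _ => apply (cont_ln f)
  end.

(* Non-vanishing conditions are left as goals. *)
Ltac ct := repeat (assumption || ct1).

Definition cdiff (f : C -> C) (z : C) : Prop := exists l, cderiv f z l.

(** The radius is a parameter because the integral kernels below are holomorphic only in disks
    slightly larger than the circle of integration. *)
Definition hol (r : R) (g : C -> C) : Prop := forall z : C, Cmod z < r -> cdiff g z.

Lemma hol_derive (r : R) (g : C -> C) (z : C) : hol r g -> Cmod z < r -> cderiv g z (C_derive g z).
Proof. intros H Hz. destruct (H z Hz) as [l Hl]. rewrite (cderiv_unique g z l Hl). exact Hl. Qed.

Lemma cont_hol {T : UniformSpace} (r : R) (g : C -> C) (f : T -> C) x :
  hol r g -> ctsC f x -> Cmod (f x) < r -> ctsC (fun t => g (f t)) x.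
Proof. intros Hg Hf Hr. destruct (Hg _ Hr) as [l Hl]. apply (cont_comp_cderiv g f x l); assumption. Qed.

(** * Curves in the plane: derivatives and integrals *)

Definition rderiv (F : R -> C) (t : R) (v : C) : Prop :=
  is_derive (fun s => Re (F s)) t (Re v) /\ is_derive (fun s => Im (F s)) t (Im v).

Lemma rderiv_eps (F : R -> C) (t : R) (v : C) :
  rderiv F t v <->
  (forall eps : R, 0 < eps -> exists d : R, 0 < d /\ forall s, Rabs (s - t) < d ->
     Cmod (F s - F t - RtoC (s - t) * v) <= eps * Rabs (s - t)).
Proof.
  assert (ER : forall s, Re (F s - F t - RtoC (s - t) * v)%C = Re (F s) - Re (F t) - (s - t) * Re v).
  { intros s. unfold Re, Im. simpl. ring. }
  assert (EI : forall s, Im (F s - F t - RtoC (s - t) * v)%C = Im (F s) - Im (F t) - (s - t) * Im v).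
  { intros s. unfold Re, Im. simpl. ring. }
  split.
  - intros [H1 H2] eps He.
    destruct (proj1 (is_derive_eps _ _ _) H1 (eps / 2)) as (d1 & Hd1 & K1); [lra|].
    destruct (proj1 (is_derive_eps _ _ _) H2 (eps / 2)) as (d2 & Hd2 & K2); [lra|].
    exists (Rmin d1 d2). split; [apply Rmin_pos; assumption|]. intros s Hs.
    apply Rle_trans with (1 := Cmod_le_Re_Im _). rewrite ER, EI.
    specialize (K1 s (Rlt_le_trans _ _ _ Hs (Rmin_l _ _))).
    specialize (K2 s (Rlt_le_trans _ _ _ Hs (Rmin_r _ _))). lra.
  - intros H. split; apply is_derive_eps; intros eps He; destruct (H eps He) as (d & Hd & K);
      exists d; (split; [exact Hd|]); intros s Hs; apply Rle_trans with (2 := K s Hs).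
    + rewrite <- ER. apply re_le_Cmod.
    + rewrite <- EI. apply im_le_Cmod.
Qed.

Lemma rderiv_eq (F : R -> C) (t : R) (v w : C) : rderiv F t v -> v = w -> rderiv F t w.
Proof. intros H <-. exact H. Qed.

Lemma rderiv_cont (F : R -> C) (t : R) (v : C) : rderiv F t v -> ctsC F t.
Proof.
  intros [H1 H2]. apply cont_C. split; apply (ex_derive_continuous (K := R_AbsRing) (V := R_NormedModule)).
  - exists (Re v). exact H1.
  - exists (Im v). exact H2.
Qed.

Lemma rderiv_const (c : C) (t : R) : rderiv (fun _ => c) t 0.
Proof. split; simpl; apply (is_derive_const (K := R_AbsRing) (V := R_NormedModule)). Qed.

Lemma rderiv_RtoC (f : R -> R) (t v : R) : is_derive f t v -> rderiv (fun s => RtoC (f s)) t (RtoC v).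
Proof. intros H. split; simpl; [exact H|apply (is_derive_const (K := R_AbsRing) (V := R_NormedModule))]. Qed.

Lemma rderiv_plus (F G : R -> C) (t : R) (v w : C) :
  rderiv F t v -> rderiv G t w -> rderiv (fun s => F s + G s)%C t (v + w).
Proof. intros [H1 H2] [H3 H4]. split; simpl; apply (is_derive_plus (K := R_AbsRing) (V := R_NormedModule)); assumption. Qed.

Lemma rderiv_minus (F G : R -> C) (t : R) (v w : C) :
  rderiv F t v -> rderiv G t w -> rderiv (fun s => F s - G s)%C t (v - w).
Proof. intros [H1 H2] [H3 H4]. split; simpl; apply (is_derive_minus (K := R_AbsRing) (V := R_NormedModule)); assumption. Qed.

Lemma is_derive_Rmult (f g : R -> R) (t v w : R) :
  is_derive f t v -> is_derive g t w -> is_derive (fun s => f s * g s) t (v * g t + f t * w).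
Proof. intros H1 H2. apply (is_derive_mult (K := R_AbsRing) f g); auto. intros; apply Rmult_comm. Qed.

Lemma rderiv_mult (F G : R -> C) (t : R) (v w : C) :
  rderiv F t v -> rderiv G t w -> rderiv (fun s => F s * G s)%C t (v * G t + F t * w).
Proof.
  intros [H1 H2] [H3 H4]. split; simpl.
  - pose proof (is_derive_minus (K := R_AbsRing) (V := R_NormedModule) _ _ _ _ _ (is_derive_Rmult _ _ _ _ _ H1 H3) (is_derive_Rmult _ _ _ _ _ H2 H4)) as K.
    replace (fst v * fst (G t) - snd v * snd (G t) + (fst (F t) * fst w - snd (F t) * snd w))
      with (minus (Re v * Re (G t) + Re (F t) * Re w) (Im v * Im (G t) + Im (F t) * Im w)).
    exact K. unfold minus, plus, opp, Re, Im; simpl; ring.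
  - pose proof (is_derive_plus (K := R_AbsRing) (V := R_NormedModule) _ _ _ _ _ (is_derive_Rmult _ _ _ _ _ H1 H4) (is_derive_Rmult _ _ _ _ _ H2 H3)) as K.
    replace (fst v * snd (G t) + snd v * fst (G t) + (fst (F t) * snd w + snd (F t) * fst w))
      with (plus (Re v * Im (G t) + Re (F t) * Im w) (Im v * Re (G t) + Im (F t) * Re w)).
    exact K. unfold plus, Re, Im; simpl; ring.
Qed.

Lemma cts_eps (F : R -> C) (t : R) :
  ctsC F t <->
  (forall eps : R, 0 < eps -> exists d : R, 0 < d /\ forall s, Rabs (s - t) < d -> Cmod (F s - F t) < eps).
Proof.
  split.
  - intros H eps He.
    assert (H0 : @locally C_UniformSpace (F t) (fun w => Cmod (w - F t) < eps)).
    { apply (proj2 (locally_Cmod (F t) (fun w => Cmod (w - F t) < eps))). exists eps. split; [exact He|]. tauto. }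
    specialize (H _ H0). apply locally_R in H. exact H.
  - intros H P HP. apply locally_Cmod in HP. destruct HP as (e & He & HP).
    destruct (H e He) as (d & Hd & H'). apply locally_R. exists d. split; [exact Hd|].
    intros s Hs. apply HP, H', Hs.
Qed.

Lemma rderiv_comp (g : C -> C) (F : R -> C) (t : R) (l v : C) :
  cderiv g (F t) l -> rderiv F t v -> rderiv (fun s => g (F s)) t (l * v)%C.
Proof.
  intros Hg HF. pose proof (rderiv_cont _ _ _ HF) as Hc. rewrite rderiv_eps in *. intros eps He.
  rewrite cderiv_eps in Hg.
  pose proof (Cmod_ge_0 v) as Hv. pose proof (Cmod_ge_0 l) as Hl.
  destruct (HF 1 Rlt_0_1) as (d1 & Hd1 & H1).
  destruct (Hg (eps / 2 / (Cmod v + 1))) as (d2 & Hd2 & H2). { apply Rdiv_lt_0_compat; lra. }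
  destruct (HF (eps / 2 / (Cmod l + 1))) as (d3 & Hd3 & H3). { apply Rdiv_lt_0_compat; lra. }
  assert (Hc2 : exists d, 0 < d /\ forall s, Rabs (s - t) < d -> Cmod (F s - F t) < d2).
  { exact (proj1 (cts_eps F t) Hc d2 Hd2). }
  destruct Hc2 as (d4 & Hd4 & H4).
  exists (Rmin (Rmin d1 d3) d4). split. { repeat apply Rmin_pos; assumption. }
  intros s Hs.
  assert (Hw1 : Rabs (s - t) < d1) by (eapply Rlt_le_trans; [exact Hs|]; eapply Rle_trans; [apply Rmin_l|apply Rmin_l]).
  assert (Hw3 : Rabs (s - t) < d3) by (eapply Rlt_le_trans; [exact Hs|]; eapply Rle_trans; [apply Rmin_l|apply Rmin_r]).
  assert (Hw4 : Rabs (s - t) < d4) by (eapply Rlt_le_trans; [exact Hs|]; apply Rmin_r).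
  specialize (H1 s Hw1). specialize (H3 s Hw3). specialize (H4 s Hw4). specialize (H2 _ H4).
  pose proof (Rabs_pos (s - t)) as Ha.
  assert (H5 : Cmod (F s - F t) <= (Cmod v + 1) * Rabs (s - t)).
  { replace (F s - F t)%C with ((F s - F t - RtoC (s - t) * v) + RtoC (s - t) * v)%C by ring.
    apply Rle_trans with (1 := Cmod_triangle _ _). rewrite Cmod_mult, Cmod_R. lra. }
  replace (g (F s) - g (F t) - RtoC (s - t) * (l * v))%C with
    ((g (F s) - g (F t) - (F s - F t) * l) + (F s - F t - RtoC (s - t) * v) * l)%C by ring.
  apply Rle_trans with (1 := Cmod_triangle _ _). rewrite Cmod_mult.
  assert (A1 : eps / 2 / (Cmod v + 1) * Cmod (F s - F t) <= eps / 2 * Rabs (s - t)).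
  { apply Rle_trans with (eps / 2 / (Cmod v + 1) * ((Cmod v + 1) * Rabs (s - t))).
    - apply Rmult_le_compat_l; [|exact H5]. apply Rlt_le, Rdiv_lt_0_compat; lra.
    - right. field. lra. }
  assert (A2 : Cmod (F s - F t - RtoC (s - t) * v) * Cmod l <= eps / 2 * Rabs (s - t)).
  { apply Rle_trans with (eps / 2 / (Cmod l + 1) * Rabs (s - t) * (Cmod l + 1)).
    - apply Rmult_le_compat; try apply Cmod_ge_0; lra.
    - right. field. lra. }
  lra.
Qed.

(** Componentwise, so that integrability, additivity and the fundamental theorem are inherited from
    real integrals. Only the bound on the modulus needs an extra idea, a rotation. *)
Definition Cint (F : R -> C) (a b : R) : C := (RInt (fun t => Re (F t)) a b, RInt (fun t => Im (F t)) a b).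

Definition cts_on (F : R -> C) (a b : R) : Prop := forall t, a <= t <= b -> ctsC F t.

Lemma ex_RInt_cont (f : R -> R) (a b : R) : a <= b ->
  (forall t, a <= t <= b -> ctsR f t) -> ex_RInt f a b.
Proof.
  intros Hab H. apply (ex_RInt_continuous (V := R_CompleteNormedModule)).
  rewrite Rmin_left, Rmax_right by exact Hab. exact H.
Qed.

Lemma ex_RInt_Re (F : R -> C) (a b : R) : a <= b -> cts_on F a b -> ex_RInt (fun t => Re (F t)) a b.
Proof. intros Hab H. apply ex_RInt_cont; [exact Hab|]. intros t Ht. apply cont_Re, H, Ht. Qed.

Lemma ex_RInt_Im (F : R -> C) (a b : R) : a <= b -> cts_on F a b -> ex_RInt (fun t => Im (F t)) a b.
Proof. intros Hab H. apply ex_RInt_cont; [exact Hab|]. intros t Ht. apply cont_Im, H, Ht. Qed.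

Lemma Cint_ext (F G : R -> C) (a b : R) : a <= b ->
  (forall t, a < t < b -> F t = G t) -> Cint F a b = Cint G a b.
Proof.
  intros Hab H. unfold Cint. f_equal; apply RInt_ext; rewrite Rmin_left, Rmax_right by exact Hab;
    intros t Ht; rewrite H; auto.
Qed.

Lemma Cint_plus (F G : R -> C) (a b : R) : a <= b -> cts_on F a b -> cts_on G a b ->
  Cint (fun t => F t + G t)%C a b = (Cint F a b + Cint G a b)%C.
Proof.
  intros Hab HF HG. apply C_ext; simpl.
  - apply (RInt_plus (V := R_CompleteNormedModule)); apply ex_RInt_Re; assumption.
  - apply (RInt_plus (V := R_CompleteNormedModule)); apply ex_RInt_Im; assumption.
Qed.

Lemma Cint_scal (c : C) (F : R -> C) (a b : R) : a <= b -> cts_on F a b ->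
  Cint (fun t => c * F t)%C a b = (c * Cint F a b)%C.
Proof.
  intros Hab HF.
  pose proof (ex_RInt_Re _ _ _ Hab HF) as H1. pose proof (ex_RInt_Im _ _ _ Hab HF) as H2.
  apply C_ext; simpl.
  - rewrite (RInt_minus (V := R_CompleteNormedModule)).
    + rewrite !(RInt_scal (V := R_CompleteNormedModule)) by assumption. reflexivity.
    + apply (ex_RInt_scal (V := R_CompleteNormedModule) _ _ _ (fst c)). exact H1.
    + apply (ex_RInt_scal (V := R_CompleteNormedModule) _ _ _ (snd c)). exact H2.
  - rewrite (RInt_plus (V := R_CompleteNormedModule)).
    + rewrite !(RInt_scal (V := R_CompleteNormedModule)) by assumption. reflexivity.
    + apply (ex_RInt_scal (V := R_CompleteNormedModule) _ _ _ (fst c)). exact H2.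
    + apply (ex_RInt_scal (V := R_CompleteNormedModule) _ _ _ (snd c)). exact H1.
Qed.

Lemma Cint_opp (F : R -> C) (a b : R) : a <= b -> cts_on F a b ->
  Cint (fun t => - F t)%C a b = (- Cint F a b)%C.
Proof.
  intros Hab HF. rewrite (Cint_ext _ (fun t => (- (1)) * F t)%C a b Hab) by (intros; ring).
  rewrite Cint_scal by assumption. ring.
Qed.

Lemma Cint_minus (F G : R -> C) (a b : R) : a <= b -> cts_on F a b -> cts_on G a b ->
  Cint (fun t => F t - G t)%C a b = (Cint F a b - Cint G a b)%C.
Proof.
  intros Hab HF HG. unfold Cminus. rewrite Cint_plus; try assumption.
  - rewrite Cint_opp by assumption. reflexivity.
  - intros t Ht. apply cont_Copp, HG, Ht.
Qed.

Lemma Cint_const (c : C) (a b : R) : Cint (fun _ => c) a b = (RtoC (b - a) * c)%C.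
Proof.
  apply C_ext; simpl; rewrite (RInt_const (V := R_CompleteNormedModule)); unfold scal; simpl;
    unfold mult; simpl; ring_simplify; reflexivity.
Qed.

Lemma Cint_Chasles (F : R -> C) (a b c : R) : a <= b -> b <= c -> cts_on F a c ->
  (Cint F a b + Cint F b c)%C = Cint F a c.
Proof.
  intros Hab Hbc H.
  assert (H1 : cts_on F a b) by (intros t Ht; apply H; lra).
  assert (H2 : cts_on F b c) by (intros t Ht; apply H; lra).
  apply C_ext; simpl.
  - apply (RInt_Chasles (V := R_CompleteNormedModule) (fun t => Re (F t))); apply ex_RInt_Re; assumption.
  - apply (RInt_Chasles (V := R_CompleteNormedModule) (fun t => Im (F t))); apply ex_RInt_Im; assumption.
Qed.

(** Turns estimates of a modulus into estimates of a real part, for integrals in [Cint_bound] and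
    for the maximum principle in [max_modulus]. *)
Lemma unit_rotation (z : C) : exists c : C, Cmod c = 1 /\ (c * z)%C = RtoC (Cmod z).
Proof.
  destruct (classic (z = 0%C)) as [->|Hz].
  - exists 1%C. rewrite Cmod_1, Cmod_0. split; [reflexivity|ring].
  - pose proof (proj1 (Cmod_gt_0 z) Hz) as Hm.
    assert (Hm0 : RtoC (Cmod z) <> 0%C) by (intros E; apply RtoC_inj in E; lra).
    exists (RtoC (Cmod z) / z)%C. split.
    + rewrite Cmod_div by exact Hz. rewrite Cmod_R, Rabs_pos_eq by lra. field. lra.
    + field. exact Hz.
Qed.

Lemma Cint_bound (F : R -> C) (a b M : R) : a <= b -> cts_on F a b ->
  (forall t, a <= t <= b -> Cmod (F t) <= M) -> Cmod (Cint F a b) <= (b - a) * M.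
Proof.
  intros Hab HF HM. destruct (unit_rotation (Cint F a b)) as (c & Hc & E).
  assert (E2 : Cmod (Cint F a b) = Re (Cint (fun t => c * F t)%C a b)).
  { rewrite Cint_scal by assumption. rewrite E. reflexivity. }
  rewrite E2. unfold Cint. simpl Re at 1.
  assert (HcF : cts_on (fun t => c * F t)%C a b) by (intros t Ht; specialize (HF t Ht); ct).
  apply Rle_trans with (RInt (fun _ => M) a b).
  - apply RInt_le; [exact Hab| |apply ex_RInt_const|].
    + apply (ex_RInt_Re _ _ _ Hab HcF).
    + intros t Ht. apply Rle_trans with (1 := Rle_abs _).
      apply Rle_trans with (1 := re_le_Cmod (c * F t)).
      rewrite Cmod_mult, Hc, Rmult_1_l. apply HM. lra.
  - rewrite RInt_const. unfold scal; simpl; unfold mult; simpl. lra.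
Qed.

Lemma Cint_derive (F G : R -> C) (a b : R) : a <= b ->
  (forall t, a <= t <= b -> rderiv F t (G t)) -> cts_on G a b -> Cint G a b = (F b - F a)%C.
Proof.
  intros Hab HF HG. apply C_ext; simpl; apply is_RInt_unique.
  - change (fst (F b) + - fst (F a)) with (minus (Re (F b)) (Re (F a))).
    apply (is_RInt_derive (V := R_CompleteNormedModule) (fun t => Re (F t))); rewrite Rmin_left, Rmax_right by exact Hab; intros t Ht.
    + apply HF, Ht.
    + apply (cont_Re G), HG, Ht.
  - change (snd (F b) + - snd (F a)) with (minus (Im (F b)) (Im (F a))).
    apply (is_RInt_derive (V := R_CompleteNormedModule) (fun t => Im (F t))); rewrite Rmin_left, Rmax_right by exact Hab; intros t Ht.
    + apply HF, Ht.
    + apply (cont_Im G), HG, Ht.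
Qed.

(** * Goursat's theorem *)

(** The contour integral of [H dz] around the rectangle, counterclockwise; on vertical sides
    [dz = i dy]. *)
Definition rect (H : C -> C) (x1 x2 y1 y2 : R) : C :=
  (Cint (fun x => H (x, y1)) x1 x2 - Cint (fun x => H (x, y2)) x1 x2
   + Ci * (Cint (fun y => H (x2, y)) y1 y2 - Cint (fun y => H (x1, y)) y1 y2))%C.

Definition rect_cts (H : C -> C) (x1 x2 y1 y2 : R) : Prop :=
  forall x y, x1 <= x <= x2 -> y1 <= y <= y2 -> ccont H (x, y).

Lemma cont_hline (y x : R) : ctsC (fun x => (x, y) : C) x.
Proof. apply cont_C. split; simpl; ct. Qed.

Lemma cont_vline (x y : R) : ctsC (fun y => (x, y) : C) y.
Proof. apply cont_C. split; simpl; ct. Qed.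

Lemma rect_h (H : C -> C) (a b y : R) :
  (forall x, a <= x <= b -> ccont H (x, y)) -> cts_on (fun x => H (x, y)) a b.
Proof.
  intros Hc x Hx. apply (continuous_comp (fun x => (x, y) : C) H); [apply cont_hline|apply Hc, Hx].
Qed.

Lemma rect_v (H : C -> C) (a b x : R) :
  (forall y, a <= y <= b -> ccont H (x, y)) -> cts_on (fun y => H (x, y)) a b.
Proof.
  intros Hc y Hy. apply (continuous_comp (fun y => (x, y) : C) H); [apply cont_vline|apply Hc, Hy].
Qed.

Lemma rect_cut_x H x1 m x2 y1 y2 : x1 <= m <= x2 ->
  cts_on (fun x => H (x, y1)) x1 x2 -> cts_on (fun x => H (x, y2)) x1 x2 ->
  rect H x1 x2 y1 y2 = (rect H x1 m y1 y2 + rect H m x2 y1 y2)%C.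
Proof.
  intros Hm H1 H2. unfold rect.
  rewrite <- (Cint_Chasles _ x1 m x2 (proj1 Hm) (proj2 Hm) H1).
  rewrite <- (Cint_Chasles _ x1 m x2 (proj1 Hm) (proj2 Hm) H2). ring.
Qed.

Lemma rect_cut_y H x1 x2 y1 m y2 : y1 <= m <= y2 ->
  cts_on (fun y => H (x1, y)) y1 y2 -> cts_on (fun y => H (x2, y)) y1 y2 ->
  rect H x1 x2 y1 y2 = (rect H x1 x2 y1 m + rect H x1 x2 m y2)%C.
Proof.
  intros Hm H1 H2. unfold rect.
  rewrite <- (Cint_Chasles _ y1 m y2 (proj1 Hm) (proj2 Hm) H1).
  rewrite <- (Cint_Chasles _ y1 m y2 (proj1 Hm) (proj2 Hm) H2). ring.
Qed.

Lemma rderiv_hline (y x : R) : rderiv (fun x => (x, y) : C) x 1.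
Proof. split; simpl. apply (is_derive_id (K := R_AbsRing)). apply (is_derive_const (K := R_AbsRing) (V := R_NormedModule)). Qed.

Lemma rderiv_vline (x y : R) : rderiv (fun y => (x, y) : C) y Ci.
Proof. split; simpl. apply (is_derive_const (K := R_AbsRing) (V := R_NormedModule)). apply (is_derive_id (K := R_AbsRing)). Qed.

(** Each side contributes the difference of [P] at its ends, and the four corner values cancel. *)
Lemma rect_primitive (P H : C -> C) x1 x2 y1 y2 : x1 <= x2 -> y1 <= y2 ->
  (forall x y, x1 <= x <= x2 -> y1 <= y <= y2 -> cderiv P (x, y) (H (x, y))) ->
  rect_cts H x1 x2 y1 y2 -> rect H x1 x2 y1 y2 = 0%C.
Proof.
  intros Hx Hy HP HH.
  assert (Eh : forall y, y1 <= y <= y2 -> Cint (fun x => H (x, y)) x1 x2 = (P (x2, y) - P (x1, y))%C).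
  { intros y Hy'. apply (Cint_derive (fun x => P (x, y))); [exact Hx| |].
    - intros t Ht. apply (rderiv_eq _ _ (H (t, y) * 1)%C); [|ring].
      apply (rderiv_comp P (fun x => (x, y) : C)); [apply HP; assumption|apply rderiv_hline].
    - apply rect_h. intros t Ht. apply HH; assumption. }
  assert (Ev : forall x, x1 <= x <= x2 -> (Ci * Cint (fun y => H (x, y)) y1 y2 = P (x, y2) - P (x, y1))%C).
  { intros x Hx'. assert (Hc : cts_on (fun y => H (x, y)) y1 y2).
    { apply rect_v. intros t Ht. apply HH; assumption. }
    rewrite <- Cint_scal by assumption.
    apply (Cint_derive (fun y => P (x, y))); [exact Hy| |].
    - intros t Ht. apply (rderiv_eq _ _ (H (x, t) * Ci)%C); [|ring].
      apply (rderiv_comp P (fun y => (x, y) : C)); [apply HP; assumption|apply rderiv_vline].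
    - intros t Ht. apply cont_Cmult; [apply continuous_const|apply Hc, Ht]. }
  unfold rect. rewrite !Eh by lra. replace (Ci * (Cint (fun y => H (x2, y)) y1 y2 - Cint (fun y => H (x1, y)) y1 y2))%C
    with (Ci * Cint (fun y => H (x2, y)) y1 y2 - Ci * Cint (fun y => H (x1, y)) y1 y2)%C by ring.
  rewrite !Ev by lra. ring.
Qed.

Lemma rect_minus F H x1 x2 y1 y2 : x1 <= x2 -> y1 <= y2 ->
  rect_cts F x1 x2 y1 y2 -> rect_cts H x1 x2 y1 y2 ->
  rect (fun z => F z - H z)%C x1 x2 y1 y2 = (rect F x1 x2 y1 y2 - rect H x1 x2 y1 y2)%C.
Proof.
  intros Hx Hy HF HH. unfold rect.
  assert (Eh : forall y, y1 <= y <= y2 -> Cint (fun x => F (x, y) - H (x, y))%C x1 x2 =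
    (Cint (fun x => F (x, y)) x1 x2 - Cint (fun x => H (x, y)) x1 x2)%C).
  { intros y Hy'. apply (Cint_minus (fun x => F (x, y)) (fun x => H (x, y)));
      [exact Hx|apply rect_h; intros; apply HF; lra|apply rect_h; intros; apply HH; lra]. }
  assert (Ev : forall x, x1 <= x <= x2 -> Cint (fun y => F (x, y) - H (x, y))%C y1 y2 =
    (Cint (fun y => F (x, y)) y1 y2 - Cint (fun y => H (x, y)) y1 y2)%C).
  { intros x Hx'. apply (Cint_minus (fun y => F (x, y)) (fun y => H (x, y)));
      [exact Hy|apply rect_v; intros; apply HF; lra|apply rect_v; intros; apply HH; lra]. }
  rewrite !Eh, !Ev by lra. ring.
Qed.

Lemma rect_bound_boundary (F : C -> C) x1 x2 y1 y2 M : x1 <= x2 -> y1 <= y2 ->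
  (forall x y, x1 <= x <= x2 -> y1 <= y <= y2 -> x = x1 \/ x = x2 \/ y = y1 \/ y = y2 ->
     ccont F (x, y) /\ Cmod (F (x, y)) <= M) ->
  Cmod (rect F x1 x2 y1 y2) <= 2 * ((x2 - x1) + (y2 - y1)) * M.
Proof.
  intros Hx Hy HF. unfold rect.
  assert (Bh : forall y, y = y1 \/ y = y2 -> Cmod (Cint (fun x => F (x, y)) x1 x2) <= (x2 - x1) * M).
  { intros y Hy'. apply Cint_bound; [exact Hx| |].
    - apply rect_h. intros. apply HF; try lra; tauto.
    - intros. apply HF; try lra; tauto. }
  assert (Bv : forall x, x = x1 \/ x = x2 -> Cmod (Cint (fun y => F (x, y)) y1 y2) <= (y2 - y1) * M).
  { intros x Hx'. apply Cint_bound; [exact Hy| |].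
    - apply rect_v. intros. apply HF; try lra; tauto.
    - intros. apply HF; try lra; tauto. }
  apply Rle_trans with (1 := Cmod_triangle _ _). rewrite Cmod_mult, Cmod_Ci.
  pose proof (Cmod_triangle (Cint (fun x => F (x, y1)) x1 x2) (- Cint (fun x => F (x, y2)) x1 x2)) as T1.
  pose proof (Cmod_triangle (Cint (fun y => F (x2, y)) y1 y2) (- Cint (fun y => F (x1, y)) y1 y2)) as T2.
  rewrite Cmod_opp in T1, T2. unfold Cminus.
  pose proof (Bh y1 ltac:(tauto)). pose proof (Bh y2 ltac:(tauto)).
  pose proof (Bv x1 ltac:(tauto)). pose proof (Bv x2 ltac:(tauto)). lra.
Qed.

Lemma rect_bound (F : C -> C) x1 x2 y1 y2 M : x1 <= x2 -> y1 <= y2 ->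
  rect_cts F x1 x2 y1 y2 ->
  (forall x y, x1 <= x <= x2 -> y1 <= y <= y2 -> Cmod (F (x, y)) <= M) ->
  Cmod (rect F x1 x2 y1 y2) <= 2 * ((x2 - x1) + (y2 - y1)) * M.
Proof.
  intros Hx Hy HF HM. apply rect_bound_boundary; [exact Hx|exact Hy|].
  intros x y H1 H2 _. split; [apply HF|apply HM]; assumption.
Qed.

(** The sequence lives in the subset types [{a | P n a}], since a successor is available only
    together with a proof of [P n a]. *)
Lemma dependent_choice {A : Type} (P : nat -> A -> Prop) (S0 : nat -> A -> A -> Prop) :
  (exists a, P O a) -> (forall n a, P n a -> exists b, P (S n) b /\ S0 n a b) ->
  exists s : nat -> A, forall n, P n (s n) /\ S0 n (s n) (s (S n)).
Proof.
  intros H0 HS.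
  pose (a0 := constructive_indefinite_description _ H0).
  pose (st := fun n (p : {a | P n a}) =>
    constructive_indefinite_description _ (HS n (proj1_sig p) (proj2_sig p))).
  pose (s := fix s n : {a | P n a} :=
    match n with
    | O => a0
    | S m => exist _ (proj1_sig (st m (s m))) (proj1 (proj2_sig (st m (s m))))
    end).
  exists (fun n => proj1_sig (s n)). intros n. split.
  - apply (proj2_sig (s n)).
  - simpl. apply (proj2 (proj2_sig (st n (s n)))).
Qed.

Lemma nested_limit (x : nat -> R) (a : R) : 0 <= a ->
  (forall n, x n <= x (S n) /\ x (S n) + a / 2 ^ S n <= x n + a / 2 ^ n) ->
  exists l, forall n, x n <= l <= x n + a / 2 ^ n.
Proof.
  intros Ha H.
  assert (Hp : forall n, 0 <= a / 2 ^ n).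
  { intros n. apply Rdiv_le_0_compat; [exact Ha|]. apply pow_lt; lra. }
  assert (Hm : forall n k, x n <= x (n + k)%nat /\ x (n + k)%nat + a / 2 ^ (n + k) <= x n + a / 2 ^ n).
  { intros n k. induction k as [|k IH].
    - rewrite Nat.add_0_r. lra.
    - rewrite Nat.add_succ_r. pose proof (H (n + k)%nat). lra. }
  assert (Hu : forall n k, x k <= x n + a / 2 ^ n).
  { intros n k. destruct (Nat.le_ge_cases n k) as [L|L].
    - replace k with (n + (k - n))%nat by lia. pose proof (Hm n (k - n)%nat).
      pose proof (Hp (n + (k - n))%nat). lra.
    - pose proof (Hm k (n - k)%nat) as K. replace (k + (n - k))%nat with n in K by lia. pose proof (Hp n). lra. }
  destruct (completeness (fun v => exists n, v = x n)) as [l [Hl1 Hl2]].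
  - exists (x O + a / 2 ^ 0). intros v [n ->]. apply Hu.
  - exists (x O). exists O. reflexivity.
  - exists l. intros n. split.
    + apply Hl1. exists n. reflexivity.
    + apply Hl2. intros v [k ->]. apply Hu.
Qed.

Lemma quarter (a b c d : C) (e : R) : 4 * e <= Cmod (a + b + (c + d)) ->
  e <= Cmod a \/ e <= Cmod b \/ e <= Cmod c \/ e <= Cmod d.
Proof.
  intros H. destruct (Rle_lt_dec e (Cmod a)); [tauto|]. destruct (Rle_lt_dec e (Cmod b)); [tauto|].
  destruct (Rle_lt_dec e (Cmod c)); [tauto|]. destruct (Rle_lt_dec e (Cmod d)); [tauto|]. exfalso.
  pose proof (Cmod_triangle (a + b) (c + d)). pose proof (Cmod_triangle a b). pose proof (Cmod_triangle c d). lra.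
Qed.

(** Bisection: some quarter of each rectangle keeps at least a quarter of the modulus of the
    integral. Near the common point [z0], [H] differs from the affine function [L] by a small
    multiple of the distance, and [L] has a primitive. Both the perimeter and this error shrink like
    [2 ^ - n], and their product beats [eta / 4 ^ n]. *)
Theorem goursat (H : C -> C) x1 x2 y1 y2 : x1 <= x2 -> y1 <= y2 ->
  (forall x y, x1 <= x <= x2 -> y1 <= y <= y2 -> exists l, cderiv H (x, y) l) ->
  rect H x1 x2 y1 y2 = 0%C.
Proof.
  intros Hx Hy Hd.
  destruct (classic (rect H x1 x2 y1 y2 = 0%C)) as [E|E]; [exact E|exfalso].
  apply Cmod_gt_0 in E. set (eta := Cmod (rect H x1 x2 y1 y2)) in *.
  set (a := x2 - x1). set (b := y2 - y1).
  assert (Ha : 0 <= a) by (unfold a; lra). assert (Hb : 0 <= b) by (unfold b; lra).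
  assert (Hc : forall x y, x1 <= x <= x2 -> y1 <= y <= y2 -> ccont H (x, y)).
  { intros x y Hx' Hy'. destruct (Hd x y Hx' Hy') as [l Hl]. apply cderiv_cont with (1 := Hl). }
  pose (P := fun (n : nat) (p : R * R) =>
    x1 <= fst p /\ fst p + a / 2 ^ n <= x2 /\ y1 <= snd p /\ snd p + b / 2 ^ n <= y2 /\
    eta / 4 ^ n <= Cmod (rect H (fst p) (fst p + a / 2 ^ n) (snd p) (snd p + b / 2 ^ n))).
  pose (Q := fun (n : nat) (p q : R * R) =>
    (fst p <= fst q /\ fst q + a / 2 ^ S n <= fst p + a / 2 ^ n) /\
    (snd p <= snd q /\ snd q + b / 2 ^ S n <= snd p + b / 2 ^ n)).
  destruct (dependent_choice P Q) as [s Hs].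
  { exists (x1, y1). unfold P; simpl. unfold Rdiv. rewrite Rinv_1, !Rmult_1_r.
    replace (x1 + a) with x2 by (unfold a; ring). replace (y1 + b) with y2 by (unfold b; ring).
    fold eta. lra. }
  { intros n [x y] (P1 & P2 & P3 & P4 & P5). simpl in *.
    assert (H2 : 0 < 2 ^ n) by (apply pow_lt; lra). assert (H4 : 0 < 4 ^ n) by (apply pow_lt; lra).
    set (u := a / (2 * 2 ^ n)). set (v := b / (2 * 2 ^ n)).
    assert (Eu : a / 2 ^ n = 2 * u) by (unfold u; field; lra).
    assert (Ev : b / 2 ^ n = 2 * v) by (unfold v; field; lra).
    assert (Hu : 0 <= u) by (apply Rdiv_le_0_compat; lra).
    assert (Hv : 0 <= v) by (apply Rdiv_le_0_compat; lra).
    rewrite Eu in *. rewrite Ev in *. unfold P, Q; simpl. fold u v. rewrite ?Eu, ?Ev.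
    replace (eta / 4 ^ n) with (4 * (eta / (4 * 4 ^ n))) in P5 by (field; lra).
    rewrite (rect_cut_x H x (x + u) (x + 2 * u)) in P5;
      [|lra|apply rect_h; intros; apply Hc; lra|apply rect_h; intros; apply Hc; lra].
    rewrite (rect_cut_y H x (x + u) y (y + v) (y + 2 * v)) in P5;
      [|lra|apply rect_v; intros; apply Hc; lra|apply rect_v; intros; apply Hc; lra].
    rewrite (rect_cut_y H (x + u) (x + 2 * u) y (y + v) (y + 2 * v)) in P5;
      [|lra|apply rect_v; intros; apply Hc; lra|apply rect_v; intros; apply Hc; lra].
    replace (x + 2 * u) with (x + u + u) in * by ring. replace (y + 2 * v) with (y + v + v) in * by ring.
    apply quarter in P5. destruct P5 as [K|[K|[K|K]]].
    - exists (x, y); simpl; repeat split; lra.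
    - exists (x, y + v); simpl; repeat split; lra.
    - exists (x + u, y); simpl; repeat split; lra.
    - exists (x + u, y + v); simpl; repeat split; lra. }
  destruct (nested_limit (fun n => fst (s n)) a Ha) as [xl Hxl]. { intros n. apply (Hs n). }
  destruct (nested_limit (fun n => snd (s n)) b Hb) as [yl Hyl]. { intros n. apply (Hs n). }
  destruct (Hd xl yl) as [l Hl].
  { pose proof (Hxl O). destruct (Hs O) as ((P1 & P2 & P3 & P4 & P5) & _). lra. }
  { pose proof (Hyl O). destruct (Hs O) as ((P1 & P2 & P3 & P4 & P5) & _). lra. }
  rewrite cderiv_eps in Hl.
  (* The perimeter [2 * (a + b) / 2 ^ n] times the error leaves [eta / 4 ^ n] with the factor
     [(a + b) ^ 2 / (2 * (a + b + 1) ^ 2) < 1]; the summand 1 covers degenerate rectangles. *)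
  destruct (Hl (eta / (4 * (a + b + 1) * (a + b + 1)))) as (d & Hd0 & HH).
  { apply Rdiv_lt_0_compat; [exact E|]. apply Rmult_lt_0_compat; lra. }
  destruct (nfloor_ex ((a + b) / d)) as [n0 Hn0]. { apply Rdiv_le_0_compat; lra. }
  set (n := S n0).
  assert (Hn : (a + b) / 2 ^ n < d).
  { assert (K : INR n <= 2 ^ n).
    { clear. induction n as [|n IH]; [simpl; lra|]. rewrite S_INR. simpl.
      assert (1 <= 2 ^ n) by (apply pow_R1_Rle; lra). lra. }
    assert (K2 : (a + b) / d < 2 ^ n). { unfold n in *. rewrite S_INR in K. lra. }
    apply (Rmult_lt_reg_r (2 ^ n)); [apply pow_lt; lra|].
    unfold Rdiv at 1. rewrite Rmult_assoc, Rinv_l, Rmult_1_r by (apply pow_nonzero; lra).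
    apply (Rmult_lt_compat_r d) in K2; [|exact Hd0].
    unfold Rdiv in K2. rewrite Rmult_assoc, Rinv_l, Rmult_1_r in K2 by lra. lra. }
  destruct (Hs n) as ((P1 & P2 & P3 & P4 & P5) & _).
  specialize (Hxl n). specialize (Hyl n). cbv beta in Hxl, Hyl. clearbody n.
  set (x := fst (s n)) in *. set (y := snd (s n)) in *.
  assert (H2 : 0 < 2 ^ n) by (apply pow_lt; lra).
  set (u := a / 2 ^ n) in *. set (v := b / 2 ^ n) in *.
  assert (Hu : 0 <= u) by (apply Rdiv_le_0_compat; lra).
  assert (Hv : 0 <= v) by (apply Rdiv_le_0_compat; lra).
  assert (Euv : (a + b) / 2 ^ n = u + v) by (unfold u, v; field; lra).
  set (z0 := (xl, yl) : C) in *.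
  pose (L := fun z : C => (H z0 + (z - z0) * l)%C).
  assert (HL : forall z, cderiv L z l).
  { intros z. unfold L. apply (cderiv_eq _ _ (0 + ((1 - 0) * l + (z - z0) * 0))%C); [|ring].
    apply cderiv_plus; [apply cderiv_const|]. apply (cderiv_mult (fun w => w - z0)%C (fun _ => l)).
    - apply cderiv_minus; [apply cderiv_id|apply cderiv_const].
    - apply cderiv_const. }
  assert (HLc : forall z, ccont L z) by (intros z; apply cderiv_cont with (1 := HL z)).
  assert (E0 : rect L x (x + u) y (y + v) = 0%C).
  { apply (rect_primitive (fun z => H z0 * (z - z0) + / 2 * ((z - z0) * (z - z0)) * l)%C); try lra.
    - intros p q _ _. set (z := (p, q) : C).
      assert (Dz : cderiv (fun w => w - z0)%C z (1 - 0)%C) by (apply cderiv_minus; [apply cderiv_id|apply cderiv_const]).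
      eapply cderiv_eq.
      + apply cderiv_plus. apply cderiv_mult; [apply cderiv_const|exact Dz].
        apply cderiv_mult; [|apply cderiv_const]. apply cderiv_mult; [apply cderiv_const|].
        apply cderiv_mult; exact Dz.
      + unfold L. field.
    - intros p q _ _. apply HLc. }
  assert (K : Cmod (rect (fun z => H z - L z)%C x (x + u) y (y + v)) <=
    2 * ((x + u - x) + (y + v - y)) * (eta / (4 * (a + b + 1) * (a + b + 1)) * (u + v))).
  { apply rect_bound; try lra.
    - intros p q Hp Hq. apply cont_Cminus; [apply Hc; lra|apply HLc].
    - intros p q Hp Hq. assert (Hz : Cmod ((p, q) - z0) <= u + v).
      { apply Rle_trans with (1 := Cmod_le_Re_Im _). simpl.
        assert (Rabs (p + - xl) <= u) by (apply Rabs_le; lra).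
        assert (Rabs (q + - yl) <= v) by (apply Rabs_le; lra). lra. }
      unfold L. replace (H (p, q) - (H z0 + ((p, q) - z0) * l))%C with (H (p, q) - H z0 - ((p, q) - z0) * l)%C by ring.
      assert (Hz2 : Cmod ((p, q) - z0) < d) by lra.
      apply Rle_trans with (1 := HH _ Hz2).
      apply Rmult_le_compat_l; [|exact Hz]. apply Rdiv_le_0_compat; [lra|]. apply Rmult_lt_0_compat; lra. }
  rewrite rect_minus, E0 in K; try lra.
  2:{ intros p q Hp Hq. apply Hc; lra. }
  2:{ intros p q _ _. apply HLc. }
  replace (rect H x (x + u) y (y + v) - 0)%C with (rect H x (x + u) y (y + v)) in K by ring.
  pose proof (Rle_trans _ _ _ P5 K) as F. rewrite <- Euv in F.
  replace (x + u - x + (y + v - y)) with ((a + b) / 2 ^ n) in F by (rewrite Euv; ring).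
  assert (H44 : 4 ^ n = 2 ^ n * 2 ^ n). { replace 4 with (2 * 2) by ring. apply Rpow_mult_distr. }
  rewrite H44 in F.
  apply (Rmult_le_compat_r (2 ^ n * 2 ^ n)) in F; [|nra].
  replace (eta / (2 ^ n * 2 ^ n) * (2 ^ n * 2 ^ n)) with eta in F by (field; lra).
  replace (2 * ((a + b) / 2 ^ n) * (eta / (4 * (a + b + 1) * (a + b + 1)) * ((a + b) / 2 ^ n)) * (2 ^ n * 2 ^ n))
    with (eta * ((a + b) * (a + b) / (2 * (a + b + 1) * (a + b + 1)))) in F by (field; lra).
  assert ((a + b) * (a + b) / (2 * (a + b + 1) * (a + b + 1)) < 1).
  { apply (Rmult_lt_reg_r (2 * (a + b + 1) * (a + b + 1))); [nra|].
    unfold Rdiv. rewrite Rmult_assoc, Rinv_l by nra. nra. }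
  nra.
Qed.

(* The exceptional point is isolated by a small square, whose boundary integral tends to 0. *)
Lemma goursat_bounded (H : C -> C) x1 x2 y1 y2 cx cy d0 M : 0 < d0 ->
  x1 < cx < x2 -> y1 < cy < y2 ->
  (forall x y, x1 <= x <= x2 -> y1 <= y <= y2 -> x <> cx \/ y <> cy ->
     exists l, cderiv H (x, y) l) ->
  (forall x y, Rabs (x - cx) <= d0 -> Rabs (y - cy) <= d0 -> x <> cx \/ y <> cy -> Cmod (H (x, y)) <= M) ->
  rect H x1 x2 y1 y2 = 0%C.
Proof.
  intros Hd00 Hx Hy Hd HM0.
  assert (Hc : forall x y, x1 <= x <= x2 -> y1 <= y <= y2 -> x <> cx \/ y <> cy -> ccont H (x, y)).
  { intros x y Hx' Hy' Hn. destruct (Hd x y Hx' Hy' Hn) as [l Hl]. apply cderiv_cont with (1 := Hl). }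
  assert (HM : 0 <= M).
  { apply Rle_trans with (1 := Cmod_ge_0 (H (cx + d0, cy))). apply HM0.
    - apply Rabs_le; lra.
    - apply Rabs_le; lra.
    - lra. }
  destruct (classic (rect H x1 x2 y1 y2 = 0%C)) as [E|E]; [exact E|exfalso].
  apply Cmod_gt_0 in E. set (eta := Cmod (rect H x1 x2 y1 y2)) in *.
  set (d := Rmin d0 (Rmin (Rmin (Rmin (cx - x1) (x2 - cx)) (Rmin (cy - y1) (y2 - cy))) (eta / (16 * (M + 1))))).
  assert (Hd0 : 0 < d).
  { repeat apply Rmin_pos; try lra. apply Rdiv_lt_0_compat; lra. }
  assert (d1 : d <= cx - x1) by (unfold d; eapply Rle_trans; [apply Rmin_r|]; eapply Rle_trans; [apply Rmin_l|]; eapply Rle_trans; [apply Rmin_l|]; apply Rmin_l).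
  assert (d2 : d <= x2 - cx) by (unfold d; eapply Rle_trans; [apply Rmin_r|]; eapply Rle_trans; [apply Rmin_l|]; eapply Rle_trans; [apply Rmin_l|]; apply Rmin_r).
  assert (d3 : d <= cy - y1) by (unfold d; eapply Rle_trans; [apply Rmin_r|]; eapply Rle_trans; [apply Rmin_l|]; eapply Rle_trans; [apply Rmin_r|]; apply Rmin_l).
  assert (d4 : d <= y2 - cy) by (unfold d; eapply Rle_trans; [apply Rmin_r|]; eapply Rle_trans; [apply Rmin_l|]; eapply Rle_trans; [apply Rmin_r|]; apply Rmin_r).
  assert (d5 : d <= eta / (16 * (M + 1))) by (unfold d; eapply Rle_trans; [apply Rmin_r|]; apply Rmin_r).
  assert (d6 : d <= d0) by apply Rmin_l. clearbody d.
  assert (Eq : rect H x1 x2 y1 y2 = rect H (cx - d) (cx + d) (cy - d) (cy + d)).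
  { rewrite (rect_cut_x H x1 (cx - d) x2) by (lra || (apply rect_h; intros; apply Hc; lra)).
    rewrite (rect_cut_x H (cx - d) (cx + d) x2) by (lra || (apply rect_h; intros; apply Hc; lra)).
    rewrite (rect_cut_y H (cx - d) (cx + d) y1 (cy - d) y2) by (lra || (apply rect_v; intros; apply Hc; lra)).
    rewrite (rect_cut_y H (cx - d) (cx + d) (cy - d) (cy + d) y2) by (lra || (apply rect_v; intros; apply Hc; lra)).
    rewrite (goursat H x1 (cx - d) y1 y2) by (lra || (intros; apply Hd; lra)).
    rewrite (goursat H (cx + d) x2 y1 y2) by (lra || (intros; apply Hd; lra)).
    rewrite (goursat H (cx - d) (cx + d) y1 (cy - d)) by (lra || (intros; apply Hd; lra)).
    rewrite (goursat H (cx - d) (cx + d) (cy + d) y2) by (lra || (intros; apply Hd; lra)).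
    ring. }
  assert (K : eta <= 2 * ((cx + d - (cx - d)) + (cy + d - (cy - d))) * M).
  { unfold eta. rewrite Eq. apply rect_bound_boundary; try lra.
    intros x y Hx' Hy' Hb. split; [apply Hc; lra|]. apply HM0; try (apply Rabs_le); lra. }
  replace (2 * ((cx + d - (cx - d)) + (cy + d - (cy - d))) * M) with (8 * (d * M)) in K by ring.
  assert (d * (M + 1) <= eta / 16).
  { apply (Rmult_le_compat_r (M + 1)) in d5; [|lra].
    replace (eta / (16 * (M + 1)) * (M + 1)) with (eta / 16) in d5 by (field; lra). exact d5. }
  nra.
Qed.

(** * Integrals over circles *)

Lemma cdiff_const c z : cdiff (fun _ => c) z.
Proof. eexists. apply cderiv_const. Qed.
Lemma cdiff_id z : cdiff (fun w => w) z.
Proof. eexists. apply cderiv_id. Qed.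
Lemma cdiff_plus f g z : cdiff f z -> cdiff g z -> cdiff (fun w => f w + g w)%C z.
Proof. intros [l Hl] [m Hm]. eexists. apply cderiv_plus; eassumption. Qed.
Lemma cdiff_minus f g z : cdiff f z -> cdiff g z -> cdiff (fun w => f w - g w)%C z.
Proof. intros [l Hl] [m Hm]. eexists. apply cderiv_minus; eassumption. Qed.
Lemma cdiff_opp f z : cdiff f z -> cdiff (fun w => - f w)%C z.
Proof. intros [l Hl]. eexists. apply cderiv_opp; eassumption. Qed.
Lemma cdiff_mult f g z : cdiff f z -> cdiff g z -> cdiff (fun w => f w * g w)%C z.
Proof. intros [l Hl] [m Hm]. eexists. apply cderiv_mult; eassumption. Qed.
Lemma cdiff_div f g z : cdiff f z -> cdiff g z -> g z <> 0%C -> cdiff (fun w => f w / g w)%C z.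
Proof. intros [l Hl] [m Hm] H. eexists. apply cderiv_div; eassumption. Qed.
Lemma cdiff_inv f z : cdiff f z -> f z <> 0%C -> cdiff (fun w => / f w)%C z.
Proof. intros [l Hl] H. eexists. apply cderiv_inv; eassumption. Qed.
Lemma cdiff_comp f g z : cdiff f (g z) -> cdiff g z -> cdiff (fun w => f (g w)) z.
Proof. intros [l Hl] [m Hm]. eexists. apply (cderiv_comp f g); eassumption. Qed.
Lemma cdiff_Cexp f z : cdiff f z -> cdiff (fun w => Cexp (f w)) z.
Proof. intros H. apply (cdiff_comp Cexp f); [|exact H]. eexists. apply cderiv_Cexp. Qed.
Lemma cdiff_cont f z : cdiff f z -> ccont f z.
Proof. intros [l Hl]. apply cderiv_cont with (1 := Hl). Qed.
Lemma cdiff_ext_loc f g z (d : R) : 0 < d -> (forall w, Cmod (w - z) < d -> f w = g w) -> cdiff f z -> cdiff g z.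
Proof. intros Hd H [l Hl]. exists l. apply (cderiv_ext_loc f g z l d); assumption. Qed.

Ltac ch1 :=
  lazymatch goal with
  | |- cdiff (fun _ => ?c) _ => apply cdiff_const
  | |- cdiff (fun x => x) _ => apply cdiff_id
  | |- cdiff (fun t => Cplus (@?f t) (@?g t)) _ => apply (cdiff_plus f g)
  | |- cdiff (fun t => Cminus (@?f t) (@?g t)) _ => apply (cdiff_minus f g)
  | |- cdiff (fun t => Cmult (@?f t) (@?g t)) _ => apply (cdiff_mult f g)
  | |- cdiff (fun t => Cdiv (@?f t) (@?g t)) _ => apply (cdiff_div f g)
  | |- cdiff (fun t => Copp (@?f t)) _ => apply (cdiff_opp f)
  | |- cdiff (fun t => Cinv (@?f t)) _ => apply (cdiff_inv f)
  | |- cdiff Cexp ?z => exact (ex_intro _ _ (cderiv_Cexp z))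
  | |- cdiff (fun t => Cexp (@?f t)) _ => apply (cdiff_Cexp f)
  end.
Ltac ch := repeat (assumption || ch1).

Lemma circle_point_eq (r t : R) : circle_point r t = ((r * cos t, r * sin t) : C).
Proof.
  unfold circle_point. replace (RtoC t * Ci)%C with ((0, t) : C) by (apply C_ext; simpl; ring).
  unfold Cexp. simpl. rewrite exp_0. apply C_ext; simpl; ring.
Qed.

Lemma Cexp_polar (x y : R) : Cexp (x, y) = circle_point (exp x) y.
Proof. rewrite circle_point_eq. reflexivity. Qed.

Lemma Cmod_circle_point (r t : R) : 0 <= r -> Cmod (circle_point r t) = r.
Proof.
  intros Hr. unfold circle_point. rewrite Cmod_mult, Cmod_R, Rabs_pos_eq by exact Hr.
  rewrite Cmod_Cexp. replace (Re (RtoC t * Ci)%C) with 0 by (simpl; ring). rewrite exp_0. ring.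
Qed.

Lemma cont_circle (r t : R) : ctsC (circle_point r) t.
Proof. unfold circle_point. ct. Qed.

Lemma circle_point_period (r t : R) : circle_point r (t + 2 * PI) = circle_point r t.
Proof. rewrite !circle_point_eq, cos_plus, sin_plus, cos_2PI, sin_2PI. f_equal; ring. Qed.

Lemma circle_point_neq_0 (r t : R) : 0 < r -> circle_point r t <> 0%C.
Proof. intros Hr. apply Cmod_gt_0. rewrite Cmod_circle_point; lra. Qed.

Lemma Cexp_Clog (z : C) : z <> 0%C -> Cexp (Clog z) = z.
Proof.
  intros Hz. pose proof (proj1 (Cmod_gt_0 z) Hz) as Hm.
  unfold Clog. rewrite Cexp_polar, exp_ln by exact Hm. rewrite circle_point_eq.
  pose proof (Cmod2_alt z) as E. pose proof (re_le_Cmod z) as Hre. apply Rabs_le_between in Hre.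
  assert (Hx : -1 <= Re z / Cmod z <= 1).
  { split; [apply (Rmult_le_reg_r (Cmod z))|apply (Rmult_le_reg_r (Cmod z))]; try lra; unfold Rdiv;
      rewrite Rmult_assoc, Rinv_l by lra; lra. }
  assert (Hs : sqrt (1 - (Re z / Cmod z)²) = Rabs (Im z) / Cmod z).
  { replace (1 - (Re z / Cmod z)²) with ((Rabs (Im z) / Cmod z)²).
    - apply sqrt_Rsqr. apply Rdiv_le_0_compat; [apply Rabs_pos|exact Hm].
    - unfold Rsqr. replace (Rabs (Im z) / Cmod z * (Rabs (Im z) / Cmod z)) with (Rabs (Im z) ^ 2 / Cmod z ^ 2) by (field; lra).
      rewrite pow2_abs. replace (Im z ^ 2) with (Cmod z ^ 2 - Re z ^ 2) by lra. field. lra. }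
  unfold Carg. destruct (Rlt_dec (Im z) 0) as [L|L].
  - rewrite cos_neg, sin_neg, cos_acos, sin_acos, Hs by exact Hx. rewrite Rabs_left by exact L.
    apply C_ext; simpl; unfold Re, Im; field; lra.
  - rewrite cos_acos, sin_acos, Hs by exact Hx. rewrite Rabs_pos_eq by lra.
    apply C_ext; simpl; unfold Re, Im; field; lra.
Qed.

Lemma polar_form (z : C) : z = circle_point (Cmod z) (Carg z).
Proof.
  destruct (classic (z = 0%C)) as [->|Hz].
  - unfold circle_point. rewrite Cmod_0. ring.
  - rewrite <- (Cexp_Clog z Hz) at 1. unfold Clog. rewrite Cexp_polar, exp_ln; [reflexivity|].
    apply Cmod_gt_0, Hz.
Qed.

Lemma RInt_shift_periodic (f : R -> R) (T a : R) :
  (forall t, ctsR f t) -> (forall t, f (t + T) = f t) -> RInt f a (a + T) = RInt f 0 T.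
Proof.
  intros Hc Hp.
  assert (Hex : forall u v, ex_RInt f u v).
  { intros u v. apply (ex_RInt_continuous (V := R_CompleteNormedModule)). intros; apply Hc. }
  rewrite <- (RInt_Chasles (V := R_CompleteNormedModule) f a 0 (a + T)) by apply Hex.
  rewrite <- (RInt_Chasles (V := R_CompleteNormedModule) f 0 T (a + T)) by apply Hex.
  assert (E : RInt f T (a + T) = RInt f 0 a).
  { replace T with (1 * 0 + T) at 1 by ring. replace (a + T) with (1 * a + T) by ring.
    rewrite <- (RInt_comp_lin (V := R_CompleteNormedModule) f 1 T 0 a) by apply Hex.
    apply RInt_ext. intros t _. unfold scal; simpl; unfold mult; simpl. rewrite !Rmult_1_l. apply Hp. }
  rewrite E. rewrite <- (opp_RInt_swap (V := R_CompleteNormedModule) f 0 a) by apply Hex.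
  unfold plus, opp; simpl. ring.
Qed.

Lemma Cint_shift (F : R -> C) (a : R) : (forall t, ctsC F t) -> (forall t, F (t + 2 * PI) = F t) ->
  Cint F (a - PI) (a + PI) = Cint F (- PI) PI.
Proof.
  intros Hc Hp.
  assert (E : forall f : R -> R, (forall t, ctsR f t) -> (forall t, f (t + 2 * PI) = f t) ->
    RInt f (a - PI) (a + PI) = RInt f (- PI) PI).
  { intros f H1 H2. replace (a + PI) with (a - PI + 2 * PI) by ring. replace PI with (- PI + 2 * PI) at 5 by ring.
    rewrite !RInt_shift_periodic by assumption. reflexivity. }
  unfold Cint. f_equal; apply E; intros t.
  - apply cont_Re, Hc.
  - rewrite Hp. reflexivity.
  - apply cont_Im, Hc.
  - rewrite Hp. reflexivity.
Qed.

Definition circ (g : C -> C) (r : R) : C := Cint (fun t => g (circle_point r t)) (- PI) PI.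

Lemma exp_le_compat (x y : R) : x <= y -> exp x <= exp y.
Proof. intros [H| ->]; [apply Rlt_le, exp_increasing, H|lra]. Qed.

Lemma cos_eq_1 (t : R) : - PI <= t <= PI -> cos t = 1 -> t = 0.
Proof.
  intros Ht H. assert (K : forall s, 0 <= s <= PI -> cos s = 1 -> s = 0).
  { intros s Hs E. rewrite <- cos_0 in E. apply cos_inj in E; lra. }
  destruct (Rle_dec 0 t) as [L|L]; [apply K; [lra|exact H]|].
  rewrite <- cos_neg in H. apply K in H; lra.
Qed.

Lemma circle_point_inj (r s t u : R) : 0 < r -> 0 < s -> - PI <= t - u <= PI ->
  circle_point r t = circle_point s u -> r = s /\ t = u.
Proof.
  intros Hr Hs Ht E.
  assert (Ers : r = s).
  { rewrite <- (Cmod_circle_point r t), <- (Cmod_circle_point s u), E by lra. reflexivity. }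
  subst s. split; [reflexivity|].
  assert (t - u = 0); [|lra]. apply cos_eq_1; [exact Ht|]. rewrite cos_minus.
  rewrite !circle_point_eq in E. injection E as E1 E2.
  apply Rmult_eq_reg_l in E1; [|lra]. apply Rmult_eq_reg_l in E2; [|lra]. rewrite E1, E2.
  pose proof (sin2_cos2 u). unfold Rsqr in *. lra.
Qed.

(* In logarithmic coordinates the circles are vertical segments; the horizontal sides cancel
   by periodicity, and the left side disappears as it moves to minus infinity. *)
Lemma circle_integral_0 (G : C -> C) (c : C) (r rr d0 M : R) :
  Cmod c < r -> r < rr -> 0 < d0 ->
  (forall z, Cmod z < rr -> z <> c -> cdiff G z) ->
  (forall z, Cmod (z - c) <= d0 -> z <> c -> Cmod (G z) <= M) ->
  circ (fun z => G z * z)%C r = 0%C.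
Proof.
  intros Hcr Hr Hd0 HG HM.
  pose proof (Cmod_ge_0 c) as Hc0. assert (Hr0 : 0 < r) by lra. pose proof PI_RGT_0 as HPI.
  (* The strip is centred at the argument of [c], so that the logarithm of a nonzero [c] is interior
     to the rectangle and not on its horizontal sides. [H] below is the pullback of [G z dz] under
     the exponential. *)
  set (th := Carg c).
  pose (H := fun X => (G (Cexp X) * Cexp X)%C).
  assert (Hne : forall x y, x < ln r + ln (rr / r) -> Cexp (x, y) <> c -> cdiff H (x, y)).
  { intros x y Hx Hn. unfold H. apply cdiff_mult; [|ch].
    apply (cdiff_comp G Cexp); [|apply cdiff_Cexp; ch]. apply HG; [|exact Hn].
    rewrite Cmod_Cexp. simpl. rewrite <- ln_mult in Hx by (try apply Rdiv_lt_0_compat; lra).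
    replace (r * (rr / r)) with rr in Hx by (field; lra).
    apply (exp_increasing) in Hx. rewrite exp_ln in Hx; lra. }
  assert (Hln : 0 < ln (rr / r)).
  { rewrite <- ln_1. apply ln_increasing; [lra|]. apply (Rmult_lt_reg_r r); [lra|]. unfold Rdiv.
    rewrite Rmult_assoc, Rinv_l; lra. }
  assert (Hper : forall x, H (x, th + PI) = H (x, th - PI)).
  { intros x. unfold H. rewrite !Cexp_polar. replace (th + PI) with (th - PI + 2 * PI) by ring.
    rewrite circle_point_period. reflexivity. }
  assert (HB : exists x0 B, x0 < ln r /\ 0 <= B /\ forall x, x <= x0 ->
     rect H x (ln r) (th - PI) (th + PI) = 0%C /\
     (forall y, ctsC (fun y => H (x, y)) y) /\ forall y, Cmod (H (x, y)) <= B * exp x).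
  (* A zero [c] is never a value of [Cexp], so the pullback has no exceptional point and [M] bounds
     [G] far to the left. Otherwise there is exactly one exceptional point in the strip, and [G] is
     bounded near 0 by continuity. *)
  { destruct (classic (c = 0%C)) as [E0|E0].
    - subst c. exists (Rmin (ln r - 1) (ln d0)), (Rabs M).
      assert (Hx0 : forall X, Cexp X <> 0%C) by apply Cexp_neq_0.
      split; [pose proof (Rmin_l (ln r - 1) (ln d0)); lra|]. split; [apply Rabs_pos|].
      intros x Hx. pose proof (Rmin_l (ln r - 1) (ln d0)). pose proof (Rmin_r (ln r - 1) (ln d0)). repeat split.
      + apply goursat; try lra. intros u v Hu Hv. apply Hne; [lra|apply Hx0].
      + intros y. apply (continuous_comp (fun y => (x, y) : C) H); [apply cont_vline|].
        apply cdiff_cont, Hne; [lra|apply Hx0].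
      + intros y. unfold H. rewrite Cmod_mult, Cmod_Cexp. simpl.
        apply Rmult_le_compat_r; [apply Rlt_le, exp_pos|]. apply Rle_trans with M; [|apply Rle_abs].
        apply HM; [|apply Hx0]. replace (Cexp (x, y) - 0)%C with (Cexp (x, y)) by ring.
        rewrite Cmod_Cexp. simpl. rewrite <- (exp_ln d0) by lra. apply exp_le_compat. lra.
    - pose proof (proj1 (Cmod_gt_0 c) E0) as Hcm.
      assert (Hccont : ccont G (RtoC 0)) by (apply cdiff_cont, HG; [rewrite Cmod_0; lra|congruence]).
      destruct (proj1 (ccont_eps G 0) Hccont 1 Rlt_0_1) as (d1 & Hd1 & K1).
      assert (Hpol : c = Cexp (ln (Cmod c), th)).
      { rewrite Cexp_polar, exp_ln by exact Hcm. apply polar_form. }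
      assert (Hlnc : ln (Cmod c) < ln r) by (apply ln_increasing; lra).
      exists (Rmin (ln (Cmod c) - 1) (ln d1 - 1)), (Cmod (G 0) + 1).
      pose proof (Rmin_l (ln (Cmod c) - 1) (ln d1 - 1)). pose proof (Rmin_r (ln (Cmod c) - 1) (ln d1 - 1)).
      split; [lra|]. split; [pose proof (Cmod_ge_0 (G 0)); lra|]. intros x Hx. repeat split.
      + destruct (proj1 (ccont_eps Cexp ((ln (Cmod c), th) : C)) (cderiv_cont _ _ _ (cderiv_Cexp _)) (Rmin d0 r)) as (d2 & Hd2 & K2).
        { apply Rmin_pos; lra. }
        assert (Hinj : forall u v, th - PI <= v <= th + PI -> u <> ln (Cmod c) \/ v <> th -> Cexp (u, v) <> c).
        { intros u v Hv Hn E. rewrite Hpol, !Cexp_polar in E.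
          apply circle_point_inj in E; [|apply exp_pos|apply exp_pos|lra].
          destruct E as [E1 E2]. apply exp_inv in E1. tauto. }
        (* The bound [3 < PI] keeps the small square inside the strip, where [Cexp] takes the value
           [c] only once; [d2 / 3] because the modulus is at most the sum of two coordinates. *)
        apply (goursat_bounded H _ _ _ _ (ln (Cmod c)) th (Rmin (d2 / 3) 3) (Rabs M * (Cmod c + r))).
        * apply Rmin_pos; lra.
        * lra.
        * lra.
        * intros u v Hu Hv Hn. apply Hne; [lra|]. apply Hinj; [lra|exact Hn].
        * intros u v Hu Hv Hn. pose proof (Rmin_l (d2 / 3) 3). pose proof (Rmin_r (d2 / 3) 3).
          assert (Hz : Cmod (Cexp (u, v) - c) < Rmin d0 r).
          { rewrite Hpol. apply K2. apply Rle_lt_trans with (1 := Cmod_le_Re_Im _). simpl. unfold Rminus in *. lra. }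
          pose proof (Rmin_l d0 r). pose proof (Rmin_r d0 r).
          unfold H. rewrite Cmod_mult. apply Rmult_le_compat; try apply Cmod_ge_0.
          -- apply Rle_trans with M; [|apply Rle_abs]. apply HM; [lra|]. apply Hinj; [|exact Hn].
             apply Rabs_le_between in Hv. pose proof PI2_3_2. lra.
          -- replace (Cexp (u, v)) with (c + (Cexp (u, v) - c))%C by ring.
             apply Rle_trans with (1 := Cmod_triangle _ _). lra.
      + intros y. apply (continuous_comp (fun y => (x, y) : C) H); [apply cont_vline|].
        apply cdiff_cont, Hne; [lra|]. intros E. apply (f_equal Cmod) in E. rewrite Cmod_Cexp in E. simpl in E.
        rewrite <- (exp_ln (Cmod c)) in E by exact Hcm. apply exp_inv in E. lra.
      + intros y. unfold H. rewrite Cmod_mult, Cmod_Cexp. simpl.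
        apply Rmult_le_compat_r; [apply Rlt_le, exp_pos|].
        replace (G (Cexp (x, y))) with (G 0 + (G (Cexp (x, y)) - G 0))%C by ring.
        apply Rle_trans with (1 := Cmod_triangle _ _). apply Rplus_le_compat_l, Rlt_le, K1.
        replace (Cexp (x, y) - 0)%C with (Cexp (x, y)) by ring.
        rewrite Cmod_Cexp. simpl. rewrite <- (exp_ln d1) by lra. apply exp_increasing. lra. }
  destruct HB as (x0 & B & Hx0 & HB0 & HB).
  assert (Hcts : forall y, ctsC (fun y => H (ln r, y)) y).
  { intros y. apply (continuous_comp (fun y => (ln r, y) : C) H); [apply cont_vline|].
    apply cdiff_cont, Hne; [lra|]. intros E. apply (f_equal Cmod) in E. rewrite Cmod_Cexp in E. simpl in E.
    rewrite exp_ln in E; lra. }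
  assert (Ecirc : circ (fun z => G z * z)%C r = Cint (fun y => H (ln r, y)) (th - PI) (th + PI)).
  { rewrite (Cint_shift (fun y => H (ln r, y))).
    - unfold circ. apply Cint_ext; [lra|]. intros t _. unfold H. rewrite Cexp_polar, exp_ln by lra. reflexivity.
    - exact Hcts.
    - intros t. unfold H. rewrite !Cexp_polar, circle_point_period. reflexivity. }
  destruct (classic (circ (fun z => G z * z)%C r = 0%C)) as [E|E]; [exact E|exfalso].
  apply Cmod_gt_0 in E. set (eta := Cmod (circ (fun z => G z * z)%C r)) in *.
  (* Far enough to the left for the side of length [2 * PI] to contribute at most [eta / 2]. *)
  set (x := Rmin x0 (ln (eta / (4 * PI * (B + 1))))).
  assert (Hq : 0 < eta / (4 * PI * (B + 1))) by (apply Rdiv_lt_0_compat; [exact E|]; apply Rmult_lt_0_compat; lra).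
  destruct (HB x (Rmin_l _ _)) as (K1 & K2 & K3).
  assert (E2 : circ (fun z => G z * z)%C r = Cint (fun y => H (x, y)) (th - PI) (th + PI)).
  { rewrite Ecirc. unfold rect in K1.
    rewrite (Cint_ext (fun u => H (u, th + PI)) (fun u => H (u, th - PI))) in K1.
    2:{ unfold x. pose proof (Rmin_l x0 (ln (eta / (4 * PI * (B + 1))))). lra. }
    2:{ intros; apply Hper. }
    set (p := Cint (fun y => H (ln r, y)) (th - PI) (th + PI)) in *.
    set (q := Cint (fun y => H (x, y)) (th - PI) (th + PI)) in *.
    replace p with (q + - Ci * (Ci * (p - q)))%C.
    - ring_simplify in K1. replace (Ci * (p - q))%C with (Ci * p - Ci * q)%C by ring.
      transitivity (q + - Ci * 0)%C; [|ring]. f_equal. f_equal. rewrite <- K1. ring.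
    - replace (- Ci * (Ci * (p - q)))%C with (- (Ci * Ci) * (p - q))%C by ring.
      replace (Ci * Ci)%C with (- (1))%C by (apply C_ext; simpl; ring). ring. }
  assert (F : eta <= (th + PI - (th - PI)) * (B * exp x)).
  { unfold eta. rewrite E2. apply Cint_bound; [lra|intros t _; apply K2|intros t _; apply K3]. }
  assert (Hex : exp x <= eta / (4 * PI * (B + 1))).
  { rewrite <- (exp_ln _ Hq). apply exp_le_compat. apply Rmin_r. }
  assert (F2 : eta <= 2 * PI * ((B + 1) * exp x)).
  { apply Rle_trans with (1 := F). replace (th + PI - (th - PI)) with (2 * PI) by ring.
    apply Rmult_le_compat_l; [lra|]. apply Rmult_le_compat_r; [apply Rlt_le, exp_pos|lra]. }
  assert (F3 : 2 * PI * ((B + 1) * exp x) <= eta / 2).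
  { replace (eta / 2) with (2 * PI * ((B + 1) * (eta / (4 * PI * (B + 1))))) by (field; lra).
    apply Rmult_le_compat_l; [lra|]. apply Rmult_le_compat_l; [lra|exact Hex]. }
  lra.
Qed.

(** * Mean value, Cauchy and Poisson formulas *)

Lemma hol_circ_cts (g : C -> C) (r rr : R) : 0 <= r -> r < rr -> hol rr g ->
  forall t, ctsC (fun t => g (circle_point r t)) t.
Proof.
  intros Hr Hrr Hg t. apply (cont_hol rr g); [exact Hg|apply cont_circle|].
  rewrite Cmod_circle_point; assumption.
Qed.

Lemma circ_ext (F G : C -> C) (r : R) : 0 <= r -> (forall z, Cmod z = r -> F z = G z) -> circ F r = circ G r.
Proof.
  intros Hr H. pose proof PI_RGT_0. apply Cint_ext; [lra|]. intros t _. apply H, Cmod_circle_point, Hr.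
Qed.

(** Common source of three formulas: the difference quotient of [g] stays bounded near [z], so
    [circle_integral_0] applies. [K = 1] gives the mean value (at [z = 0]) and Cauchy's formula;
    another [K] gives the Poisson kernel. *)
Lemma circ_quotient (g K : C -> C) (z : C) (r rr : R) :
  Cmod z < r -> r < rr -> hol rr g -> hol rr K ->
  circ (fun u => (g u - g z) / (u - z) * K u * u)%C r = 0%C.
Proof.
  intros Hz Hr Hg HK. assert (Hz2 : Cmod z < rr) by lra.
  destruct (Hg z Hz2) as [l Hl]. destruct (cderiv_lip g z l Hl) as (d1 & Hd1 & K1).
  destruct (proj1 (ccont_eps K z) (cdiff_cont K z (HK z Hz2)) 1 Rlt_0_1) as (d2 & Hd2 & K2).
  assert (Hd : 0 < Rmin d1 d2) by (apply Rmin_pos; assumption).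
  pose proof (Rmin_l d1 d2). pose proof (Rmin_r d1 d2).
  apply (circle_integral_0 (fun u => (g u - g z) / (u - z) * K u)%C z r rr (Rmin d1 d2 / 2)
           ((Cmod l + 1) * (Cmod (K z) + 1))); try lra.
  - intros u Hu Hn. specialize (Hg u Hu). specialize (HK u Hu). ch.
    intros E. apply Hn. replace u with (u - z + z)%C by ring. rewrite E. ring.
  - intros u Hu Hn.
    assert (Hn' : (u - z)%C <> 0%C).
    { intros E. apply Hn. replace u with (u - z + z)%C by ring. rewrite E. ring. }
    pose proof (proj1 (Cmod_gt_0 _) Hn') as Hp.
    rewrite Cmod_mult. apply Rmult_le_compat; try apply Cmod_ge_0.
    + rewrite Cmod_div by exact Hn'. apply (Rmult_le_reg_r (Cmod (u - z))); [exact Hp|].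
      unfold Rdiv. rewrite Rmult_assoc, Rinv_l, Rmult_1_r by lra. apply K1. lra.
    + replace (K u) with (K z + (K u - K z))%C by ring. apply Rle_trans with (1 := Cmod_triangle _ _).
      specialize (K2 u ltac:(lra)). lra.
Qed.

Lemma circ_const (c : C) (r : R) : circ (fun _ => c) r = (RtoC (2 * PI) * c)%C.
Proof. unfold circ. rewrite Cint_const. f_equal. f_equal. ring. Qed.

Lemma circ_minus (F G : C -> C) (r : R) :
  (forall t, ctsC (fun t => F (circle_point r t)) t) -> (forall t, ctsC (fun t => G (circle_point r t)) t) ->
  circ (fun z => F z - G z)%C r = (circ F r - circ G r)%C.
Proof.
  intros HF HG. pose proof PI_RGT_0.
  apply (Cint_minus (fun t => F (circle_point r t)) (fun t => G (circle_point r t))); [lra| |]; intros t _; auto.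
Qed.

Lemma Cminus_eq_0 (a b : C) : (a - b)%C = 0%C -> a = b.
Proof. intros E. replace a with (a - b + b)%C by ring. rewrite E. ring. Qed.

Lemma mean_value (g : C -> C) (r rr : R) : 0 < r -> r < rr -> hol rr g ->
  circ g r = (RtoC (2 * PI) * g 0)%C.
Proof.
  intros Hr Hrr Hg. assert (Hc : hol rr (fun _ => 1%C)) by (intros z _; apply cdiff_const).
  assert (E := circ_quotient g (fun _ => 1%C) 0 r rr). rewrite Cmod_0 in E. specialize (E Hr Hrr Hg Hc).
  rewrite (circ_ext _ (fun u => g u - g 0)%C) in E; [|lra|].
  - rewrite circ_minus, circ_const in E.
    + apply Cminus_eq_0, E.
    + apply (hol_circ_cts g r rr); [lra|lra|exact Hg].
    + intros t. apply continuous_const.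
  - intros z Hz. field. intros E0.
    subst z. rewrite Cmod_0 in Hz. lra.
Qed.

Lemma Cint_conj (F : R -> C) (a b : R) : a <= b -> cts_on F a b ->
  Cint (fun t => Cconj (F t)) a b = Cconj (Cint F a b).
Proof.
  intros Hab HF. apply C_ext; simpl; [reflexivity|].
  apply (RInt_opp (V := R_CompleteNormedModule) (fun t => Im (F t))). apply ex_RInt_Im; assumption.
Qed.

Lemma Cconj_neq_0 (z : C) : z <> 0%C -> Cconj z <> 0%C.
Proof. intros H. apply Cmod_gt_0. rewrite Cmod_conj. apply Cmod_gt_0, H. Qed.

Lemma RtoC_neq_0 (x : R) : x <> 0 -> RtoC x <> 0%C.
Proof. intros H E. apply H. apply RtoC_inj. exact E. Qed.

Lemma Csub_neq_0 (u z : C) : u <> z -> (u - z)%C <> 0%C.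
Proof. intros H E. apply H. apply Cminus_eq_0, E. Qed.

Lemma Cmod_lt_neq (u z : C) : Cmod z < Cmod u -> u <> z.
Proof. intros H ->. lra. Qed.

(** For [z <> 0] the only zero in [u] is the reflection of [z] in the circle, of modulus
    [r ^ 2 / Cmod z]. The chosen radius is the harmonic mean of [r] and that modulus, written so
    that it makes sense for [z = 0] too. *)
Lemma kernel_radius (z : C) (r : R) : Cmod z < r ->
  exists r1, r < r1 /\ forall u, Cmod u < r1 -> (RtoC (r ^ 2) - Cconj z * u)%C <> 0%C.
Proof.
  intros Hz. pose proof (Cmod_ge_0 z). exists (2 * r ^ 2 / (r + Cmod z)).
  split.
  - apply (Rmult_lt_reg_r (r + Cmod z)); [lra|]. unfold Rdiv. rewrite Rmult_assoc, Rinv_l by lra. nra.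
  - intros u Hu E. apply Cminus_eq_0 in E. apply (f_equal Cmod) in E.
    rewrite Cmod_R, Cmod_mult, Cmod_conj, Rabs_pos_eq in E by nra.
    apply (Rmult_lt_compat_r (r + Cmod z)) in Hu; [|lra].
    unfold Rdiv in Hu. rewrite Rmult_assoc, Rinv_l in Hu by lra. pose proof (Cmod_ge_0 u). nra.
Qed.

Lemma kernel_circle (z u : C) (r : R) : Cmod u = r ->
  (RtoC (r ^ 2) - Cconj z * u)%C = (u * Cconj (u - z))%C.
Proof. intros <-. rewrite Cmod2_conj. destruct u, z; apply C_ext; simpl; ring. Qed.

(** On the circle, [u / (u - z)] is the conjugate of [r ^ 2 / (r ^ 2 - Cconj z * u)], which is
    holomorphic across the closed disk and equals 1 at the centre; so the mean value property gives
    the integral. *)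
Lemma cauchy_kernel (z : C) (r : R) : Cmod z < r -> circ (fun u => u / (u - z))%C r = RtoC (2 * PI).
Proof.
  intros Hz. pose proof (Cmod_ge_0 z). pose proof PI_RGT_0.
  destruct (kernel_radius z r Hz) as (r1 & Hr1 & Hk).
  assert (Hh : hol r1 (fun u => RtoC (r ^ 2) / (RtoC (r ^ 2) - Cconj z * u))%C).
  { intros u Hu. pose proof (Hk u Hu). apply (cdiff_div (fun _ => RtoC (r ^ 2)) (fun u => RtoC (r ^ 2) - Cconj z * u)%C); ch. }
  pose proof (mean_value _ r r1 ltac:(lra) Hr1 Hh) as E.
  assert (E2 : circ (fun u => u / (u - z))%C r = Cconj (circ (fun u => RtoC (r ^ 2) / (RtoC (r ^ 2) - Cconj z * u))%C r)).
  { unfold circ. rewrite <- Cint_conj; [|lra|].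
    - apply Cint_ext; [lra|]. intros t _. pose proof (Cmod_circle_point r t ltac:(lra)) as Hm.
      set (u := circle_point r t) in *. rewrite (kernel_circle z u r Hm).
      assert (Hu : u <> 0%C) by (apply Cmod_gt_0; lra).
      assert (Huz : (u - z)%C <> 0%C) by (apply Csub_neq_0, Cmod_lt_neq; lra).
      pose proof (Cconj_neq_0 _ Hu). pose proof (Cconj_neq_0 _ Huz).
      rewrite <- Hm, Cmod2_conj, Cdiv_conj, !Cmult_conj, !Cconj_conj by (apply Cmult_neq_0; assumption).
      field. auto.
    - intros t _. apply (hol_circ_cts _ r r1 ltac:(lra) Hr1 Hh). }
  rewrite E2, E. 
  assert (Hr2 : RtoC (r ^ 2) <> 0%C) by (apply RtoC_neq_0; nra).
  replace (RtoC (r ^ 2) / (RtoC (r ^ 2) - Cconj z * 0))%C with (RtoC 1).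
  2:{ replace (RtoC (r ^ 2) - Cconj z * 0)%C with (RtoC (r ^ 2)) by ring. field. exact Hr2. }
  apply C_ext; simpl; ring.
Qed.

Lemma cauchy_formula (g : C -> C) (z : C) (r rr : R) : Cmod z < r -> r < rr -> hol rr g ->
  circ (fun u => g u * u / (u - z))%C r = (RtoC (2 * PI) * g z)%C.
Proof.
  intros Hz Hr Hg. pose proof (Cmod_ge_0 z). pose proof PI_RGT_0.
  assert (Hc : hol rr (fun _ => 1%C)) by (intros w _; apply cdiff_const).
  pose proof (circ_quotient g (fun _ => 1%C) z r rr Hz Hr Hg Hc) as E.
  assert (Hnz : forall u, Cmod u = r -> (u - z)%C <> 0%C).
  { intros u Hu. apply Csub_neq_0, Cmod_lt_neq. lra. }
  rewrite (circ_ext _ (fun u => g u * u / (u - z) - g z * (u / (u - z)))%C) in E; [|lra|].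
  2:{ intros u Hu. pose proof (Hnz u Hu). field. assumption. }
  assert (C1 : forall t, ctsC (fun t => circle_point r t / (circle_point r t - z))%C t).
  { intros t. pose proof (cont_circle r t). ct. apply Hnz, Cmod_circle_point. lra. }
  rewrite circ_minus in E.
  - apply Cminus_eq_0 in E. rewrite E. unfold circ. rewrite Cint_scal; [|lra|intros t _; apply C1].
    fold (circ (fun u => u / (u - z))%C r). rewrite cauchy_kernel by exact Hz. ring.
  - intros t. pose proof (hol_circ_cts g r rr ltac:(lra) Hr Hg t). pose proof (cont_circle r t). ct.
    apply Hnz, Cmod_circle_point. lra.
  - intros t. apply cont_Cmult; [apply continuous_const|apply C1].
Qed.

(** * The Poisson formula and the maximum principle *)

Definition poisson (r : R) (z u : C) : R := (r ^ 2 - Cmod z ^ 2) / Cmod (u - z) ^ 2.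

Lemma poisson_pos (r : R) (z u : C) : Cmod z < r -> Cmod u = r -> 0 < poisson r z u.
Proof.
  intros Hz Hu. pose proof (Cmod_ge_0 z). apply Rdiv_lt_0_compat; [nra|].
  apply pow_lt. apply Cmod_gt_0, Csub_neq_0, Cmod_lt_neq. lra.
Qed.

Lemma poisson_cts (r : R) (z : C) (t : R) : Cmod z < r -> ctsR (fun t => poisson r z (circle_point r t)) t.
Proof.
  intros Hz. pose proof (Cmod_ge_0 z). pose proof (cont_circle r t). unfold poisson. simpl. ct.
  assert (0 < Cmod (circle_point r t - z)); [|nra].
  apply Cmod_gt_0, Csub_neq_0, Cmod_lt_neq. rewrite Cmod_circle_point; lra.
Qed.

Lemma poisson_Re (r : R) (z u : C) : Cmod z < r -> Cmod u = r ->
  poisson r z u = Re ((RtoC (r ^ 2) + Cconj z * u) / (RtoC (r ^ 2) - Cconj z * u))%C.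
Proof.
  intros Hz Hu. pose proof (Cmod_ge_0 z).
  assert (Hu0 : u <> 0%C) by (apply Cmod_gt_0; lra).
  assert (Huz : (u - z)%C <> 0%C) by (apply Csub_neq_0, Cmod_lt_neq; lra).
  rewrite (kernel_circle z u r Hu). pose proof (Cconj_neq_0 _ Huz).
  replace (RtoC (r ^ 2) + Cconj z * u)%C with (u * Cconj (u + z))%C
    by (rewrite <- Hu, Cmod2_conj; destruct u, z; apply C_ext; simpl; ring).
  replace (u * Cconj (u + z) / (u * Cconj (u - z)))%C with (Cconj (u + z) * (u - z) / ((u - z) * Cconj (u - z)))%C by (field; auto).
  rewrite <- Cmod2_conj. unfold poisson, Cdiv. rewrite <- RtoC_inv, re_scal_r.
  unfold Rdiv. f_equal. rewrite <- Hu. rewrite !Cmod2_alt. destruct u, z; simpl; ring.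
  apply pow_nonzero. apply Rgt_not_eq. apply Cmod_gt_0. exact Huz.
Qed.

Lemma poisson_1 (r : R) (z : C) : Cmod z < r ->
  RInt (fun t => poisson r z (circle_point r t)) (- PI) PI = 2 * PI.
Proof.
  intros Hz. pose proof (Cmod_ge_0 z). pose proof PI_RGT_0.
  destruct (kernel_radius z r Hz) as (r1 & Hr1 & Hk).
  assert (Hh : hol r1 (fun u => (RtoC (r ^ 2) + Cconj z * u) / (RtoC (r ^ 2) - Cconj z * u))%C).
  { intros u Hu. pose proof (Hk u Hu). apply (cdiff_div (fun u => RtoC (r ^ 2) + Cconj z * u)%C (fun u => RtoC (r ^ 2) - Cconj z * u)%C); ch. }
  pose proof (mean_value _ r r1 ltac:(lra) Hr1 Hh) as E. apply (f_equal Re) in E.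
  unfold circ, Cint in E. simpl Re at 1 in E.
  rewrite (RInt_ext _ (fun t => Re ((RtoC (r ^ 2) + Cconj z * circle_point r t) / (RtoC (r ^ 2) - Cconj z * circle_point r t))%C)).
  - etransitivity; [exact E|].
    assert (Hr2 : RtoC (r ^ 2) <> 0%C) by (apply RtoC_neq_0; nra).
    replace ((RtoC (r ^ 2) + Cconj z * 0) / (RtoC (r ^ 2) - Cconj z * 0))%C with (RtoC 1).
    + simpl. ring.
    + replace (RtoC (r ^ 2) - Cconj z * 0)%C with (RtoC (r ^ 2)) by ring. field. exact Hr2.
  - intros t _. apply poisson_Re; [exact Hz|apply Cmod_circle_point; lra].
Qed.

Lemma poisson_formula (g : C -> C) (z : C) (r rr : R) : Cmod z < r -> r < rr -> hol rr g ->
  RInt (fun t => poisson r z (circle_point r t) * Re (g (circle_point r t))) (- PI) PI = 2 * PI * Re (g z).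
Proof.
  intros Hz Hr Hg. pose proof (Cmod_ge_0 z). pose proof PI_RGT_0.
  destruct (kernel_radius z r Hz) as (r1 & Hr1 & Hk).
  (* On the circle, [K u * u / (u - z)] is exactly [poisson r z u], a real number, so the real part
     can be taken under the integral. *)
  pose (K := fun u => (RtoC (r ^ 2 - Cmod z ^ 2) / (RtoC (r ^ 2) - Cconj z * u))%C).
  set (r2 := Rmin rr r1). assert (Hr2 : r < r2) by (apply Rmin_glb_lt; assumption).
  assert (Hh : hol r2 K).
  { intros u Hu. pose proof (Hk u (Rlt_le_trans _ _ _ Hu (Rmin_r _ _))).
    apply (cdiff_div (fun u => RtoC (r ^ 2 - Cmod z ^ 2))%C (fun u => RtoC (r ^ 2) - Cconj z * u)%C); ch. }
  assert (Hg2 : hol r2 g). { intros u Hu. apply Hg. apply Rlt_le_trans with (1 := Hu). apply Rmin_l. }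
  pose proof (circ_quotient g K z r r2 Hz Hr2 Hg2 Hh) as E.
  rewrite (circ_ext _ (fun u => RtoC (poisson r z u) * (g u - g z))%C) in E; [|lra|].
  2:{ intros u Hu. unfold K. rewrite (kernel_circle z u r Hu).
    assert (Hu0 : u <> 0%C) by (apply Cmod_gt_0; lra).
    assert (Huz : (u - z)%C <> 0%C) by (apply Csub_neq_0, Cmod_lt_neq; lra).
    pose proof (Cconj_neq_0 _ Huz).
    unfold poisson. rewrite RtoC_div by (apply pow_nonzero, Rgt_not_eq, Cmod_gt_0, Huz).
    rewrite (Cmod2_conj (u - z)). field. repeat split; try assumption. }
  apply (f_equal Re) in E. unfold circ, Cint in E. simpl Re at 1 in E.
  assert (P1 := fun t => poisson_cts r z t Hz).
  assert (G1 : forall t, ctsR (fun t => Re (g (circle_point r t))) t).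
  { intros t. apply cont_Re. apply (hol_circ_cts g r rr ltac:(lra) Hr Hg). }
  rewrite (RInt_ext _ (fun t => minus (poisson r z (circle_point r t) * Re (g (circle_point r t)))
      (scal (Re (g z)) (poisson r z (circle_point r t))))) in E.
  2:{ intros t _. unfold minus, plus, opp, scal; simpl; unfold mult, Re; simpl. ring. }
  rewrite (RInt_minus (V := R_CompleteNormedModule)) in E.
  - rewrite (RInt_scal (V := R_CompleteNormedModule)), poisson_1 in E.
    + unfold minus, plus, opp, scal in E; simpl in E; unfold mult in E; simpl in E. lra.
    + exact Hz.
    + apply ex_RInt_cont; [lra|intros; apply P1].
  - apply ex_RInt_cont; [lra|]. intros t _. specialize (P1 t). specialize (G1 t). ct.
  - apply (ex_RInt_scal (V := R_CompleteNormedModule)). apply ex_RInt_cont; [lra|intros; apply P1].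
Qed.

(** Rotate [g z] onto the positive axis: its modulus is then a Poisson average of real parts, each
    at most [M]. *)
Lemma max_modulus (g : C -> C) (z : C) (r rr M : R) : Cmod z < r -> r < rr -> hol rr g ->
  (forall u, Cmod u = r -> Cmod (g u) <= M) -> Cmod (g z) <= M.
Proof.
  intros Hz Hr Hg HM. pose proof (Cmod_ge_0 z). pose proof PI_RGT_0.
  destruct (unit_rotation (g z)) as (c & Hc & E).
  assert (Hcg : hol rr (fun u => c * g u)%C) by (intros u Hu; specialize (Hg u Hu); apply (cdiff_mult (fun _ => c) g); ch).
  pose proof (poisson_formula _ z r rr Hz Hr Hcg) as P. cbv beta in P.
  replace (Re (c * g z)%C) with (Cmod (g z)) in P by (rewrite E; reflexivity).
  assert (P1 := fun t => poisson_cts r z t Hz).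
  assert (L : RInt (fun t => poisson r z (circle_point r t) * Re (c * g (circle_point r t))%C) (- PI) PI <=
    RInt (fun t => scal M (poisson r z (circle_point r t))) (- PI) PI).
  { apply RInt_le; [lra| | |].
    - apply ex_RInt_cont; [lra|]. intros t _. specialize (P1 t).
      apply cont_Rmult; [exact P1|]. apply (cont_Re (fun t => c * g (circle_point r t))%C).
      apply (hol_circ_cts (fun u => c * g u)%C r rr ltac:(lra) Hr Hcg).
    - apply (ex_RInt_scal (V := R_CompleteNormedModule)). apply ex_RInt_cont; [lra|intros; apply P1].
    - intros t _. unfold scal; simpl; unfold mult; simpl. rewrite Rmult_comm.
      pose proof (Cmod_circle_point r t ltac:(lra)) as Hm.
      apply Rmult_le_compat_r; [apply Rlt_le, poisson_pos; assumption|].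
      apply Rle_trans with (1 := Rle_abs _). apply Rle_trans with (1 := re_le_Cmod (c * g (circle_point r t))).
      rewrite Cmod_mult, Hc, Rmult_1_l. apply HM, Hm. }
  rewrite P, (RInt_scal (V := R_CompleteNormedModule)), poisson_1 in L.
  - unfold scal in L; simpl in L; unfold mult in L; simpl in L. nra.
  - exact Hz.
  - apply ex_RInt_cont; [lra|intros; apply P1].
Qed.

(** * Holomorphic functions in a disk *)

Lemma cts_on_bounded (F : R -> C) (a b : R) : a <= b -> cts_on F a b ->
  exists M, forall t, a <= t <= b -> Cmod (F t) <= M.
Proof.
  intros Hab HF.
  destruct (continuity_ab_maj (fun t => Cmod (F t)) a b Hab) as (m & Hm & _).
  - intros t Ht. apply continuity_pt_filterlim. apply (cont_Cmod F), HF, Ht.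
  - exists (Cmod (F m)). exact Hm.
Qed.

Lemma cderiv_quadratic (f : C -> C) (z l : C) (d K : R) : 0 < d ->
  (forall w, Cmod (w - z) < d -> Cmod (f w - f z - (w - z) * l) <= K * Cmod (w - z) ^ 2) -> cderiv f z l.
Proof.
  intros Hd HK. apply cderiv_eps. intros eps He.
  exists (Rmin d (eps / (Rabs K + 1))). pose proof (Rabs_pos K).
  assert (0 < eps / (Rabs K + 1)) by (apply Rdiv_lt_0_compat; lra).
  split; [apply Rmin_pos; assumption|]. intros w Hw.
  pose proof (Rmin_l d (eps / (Rabs K + 1))). pose proof (Rmin_r d (eps / (Rabs K + 1))).
  apply Rle_trans with (1 := HK w ltac:(lra)). pose proof (Cmod_ge_0 (w - z)). pose proof (Rle_abs K).
  assert (E : Cmod (w - z) * (Rabs K + 1) <= eps).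
  { assert (Hw2 : Cmod (w - z) <= eps / (Rabs K + 1)) by lra.
    apply (Rmult_le_compat_r (Rabs K + 1)) in Hw2; [|lra].
    replace (eps / (Rabs K + 1) * (Rabs K + 1)) with eps in Hw2 by (field; lra). exact Hw2. }
  simpl. rewrite Rmult_1_r, <- Rmult_assoc. apply Rmult_le_compat_r; [assumption|].
  nra.
Qed.

Lemma Cinv_bound (u : C) (d : R) : 0 < d -> d <= Cmod u -> Cmod (/ u) <= / d.
Proof.
  intros Hd Hu. rewrite Cmod_inv by (apply Cmod_gt_0; lra). apply Rinv_le_contravar; assumption.
Qed.

Lemma Cmult_bound (a b : C) (A B : R) : Cmod a <= A -> Cmod b <= B -> Cmod (a * b) <= A * B.
Proof. intros. rewrite Cmod_mult. apply Rmult_le_compat; try apply Cmod_ge_0; assumption. Qed.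

Section CauchyKernels.
Variables (phi : R -> C) (r M : R).
Hypothesis Hr : 0 < r.
Hypothesis Hphi : forall t, ctsC phi t.
Hypothesis HM : forall t, - PI <= t <= PI -> Cmod (phi t) <= M.

(** The integral of Cauchy type with density [phi], followed by its first two derivatives in [z];
    the weight coming from [dz] is part of [phi]. Two derivatives are enough to see that the
    derivative of a holomorphic function is holomorphic. *)
Definition cauchy_int1 (z : C) : C := Cint (fun t => phi t * / (circle_point r t - z))%C (- PI) PI.
Definition cauchy_int2 (z : C) : C :=
  Cint (fun t => phi t * (/ (circle_point r t - z) * / (circle_point r t - z)))%C (- PI) PI.
Definition cauchy_int3 (z : C) : C :=
  Cint (fun t => phi t * (2 * (/ (circle_point r t - z) * / (circle_point r t - z) * / (circle_point r t - z))))%C (- PI) PI.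

Lemma ker_far (rho : R) (z : C) (t : R) : rho < r -> Cmod z <= rho ->
  r - rho <= Cmod (circle_point r t - z) /\ (circle_point r t - z)%C <> 0%C.
Proof.
  intros Hrho Hz.
  assert (r - rho <= Cmod (circle_point r t - z)).
  { pose proof (Cmod_triangle (circle_point r t - z) z) as T.
    replace (circle_point r t - z + z)%C with (circle_point r t) in T by ring.
    rewrite Cmod_circle_point in T by lra. lra. }
  split; [assumption|]. apply Cmod_gt_0. lra.
Qed.

Lemma ker_cts (rho : R) (z : C) : rho < r -> Cmod z <= rho -> forall t, ctsC (fun t => / (circle_point r t - z))%C t.
Proof. intros H1 H2 t. pose proof (cont_circle r t). ct. apply (ker_far rho); assumption. Qed.

Lemma bound_nonneg : 0 <= M.
Proof. pose proof PI_RGT_0. apply Rle_trans with (1 := Cmod_ge_0 (phi 0)). apply HM. lra. Qed.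

(** The remainder of the kernel is exactly [(w - z) ^ 2 / ((u - w) * (u - z) ^ 2)]. The resulting
    constant depends only on [rho], a uniformity used later for differentiation under an
    integral. *)
Lemma cauchy_int1_taylor (rho : R) (z w : C) : rho < r -> Cmod z <= rho -> Cmod w <= rho ->
  Cmod (cauchy_int1 w - cauchy_int1 z - (w - z) * cauchy_int2 z) <= 2 * PI * (M * (/ (r - rho) * / (r - rho) * / (r - rho))) * Cmod (w - z) ^ 2.
Proof.
  intros H1 Hz Hw. pose proof PI_RGT_0. pose proof bound_nonneg.
  pose proof (ker_cts rho z H1 Hz) as Cz. pose proof (ker_cts rho w H1 Hw) as Cw.
  unfold cauchy_int1, cauchy_int2.
  rewrite <- Cint_scal, <- !Cint_minus; try lra;
    try (intros t _; specialize (Cz t); specialize (Cw t); specialize (Hphi t); ct; apply (ker_far rho); assumption).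
  eapply Rle_trans. apply Cint_bound with (M := Cmod (w - z) ^ 2 * (M * (/ (r - rho) * / (r - rho) * / (r - rho)))).
  - lra.
  - intros t _; specialize (Cz t); specialize (Cw t); specialize (Hphi t); ct; apply (ker_far rho); assumption.
  - intros t Ht. destruct (ker_far rho z t H1 Hz) as [F1 F2]. destruct (ker_far rho w t H1 Hw) as [F3 F4].
    set (u := circle_point r t) in *.
    replace (phi t * / (u - w) - phi t * / (u - z) - (w - z) * (phi t * (/ (u - z) * / (u - z))))%C
      with (((w - z) * (w - z)) * (phi t * (/ (u - w) * / (u - z) * / (u - z))))%C by (field; auto).
    rewrite Cmod_mult, (Cmod_mult (w - z)). simpl. rewrite Rmult_1_r.
    apply Rmult_le_compat_l; [pose proof (Cmod_ge_0 (w - z)); nra|].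
    apply Cmult_bound; [apply HM; exact Ht|].
    repeat apply Cmult_bound; apply Cinv_bound; try assumption; lra.
  - right. ring.
Qed.

Lemma cauchy_int2_taylor (rho : R) (z w : C) : rho < r -> Cmod z <= rho -> Cmod w <= rho ->
  Cmod (cauchy_int2 w - cauchy_int2 z - (w - z) * cauchy_int3 z) <=
  2 * PI * (M * (3 * (/ (r - rho) * / (r - rho) * / (r - rho) * / (r - rho)))) * Cmod (w - z) ^ 2.
Proof.
  intros H1 Hz Hw. pose proof PI_RGT_0. pose proof bound_nonneg.
  pose proof (ker_cts rho z H1 Hz) as Cz. pose proof (ker_cts rho w H1 Hw) as Cw.
  unfold cauchy_int2, cauchy_int3.
  rewrite <- Cint_scal, <- !Cint_minus; try lra;
    try (intros t _; specialize (Cz t); specialize (Cw t); specialize (Hphi t); ct; apply (ker_far rho); assumption).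
  eapply Rle_trans. apply Cint_bound with (M := Cmod (w - z) ^ 2 * (M * (3 * (/ (r - rho) * / (r - rho) * / (r - rho) * / (r - rho))))).
  - lra.
  - intros t _; specialize (Cz t); specialize (Cw t); specialize (Hphi t); ct; apply (ker_far rho); assumption.
  - intros t Ht. destruct (ker_far rho z t H1 Hz) as [F1 F2]. destruct (ker_far rho w t H1 Hw) as [F3 F4].
    set (u := circle_point r t) in *.
    replace (phi t * (/ (u - w) * / (u - w)) - phi t * (/ (u - z) * / (u - z)) -
       (w - z) * (phi t * (2 * (/ (u - z) * / (u - z) * / (u - z)))))%C
      with (((w - z) * (w - z)) * (phi t * (/ (u - w) * / (u - w) * / (u - z) * / (u - z) +
         (/ (u - w) * / (u - z) * / (u - z) * / (u - z) + / (u - w) * / (u - z) * / (u - z) * / (u - z)))))%C by (field; auto).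
    rewrite Cmod_mult, (Cmod_mult (w - z)). simpl. rewrite Rmult_1_r.
    apply Rmult_le_compat_l; [pose proof (Cmod_ge_0 (w - z)); nra|].
    apply Cmult_bound; [apply HM; exact Ht|].
    assert (Bw : Cmod (/ (u - w)) <= / (r - rho)) by (apply Cinv_bound; lra).
    assert (Bz : Cmod (/ (u - z)) <= / (r - rho)) by (apply Cinv_bound; lra).
    apply Rle_trans with (1 := Cmod_triangle _ _).
    pose proof (Cmod_triangle (/ (u - w) * / (u - z) * / (u - z) * / (u - z)) (/ (u - w) * / (u - z) * / (u - z) * / (u - z))) as T.
    assert (B1 : Cmod (/ (u - w) * / (u - w) * / (u - z) * / (u - z)) <= / (r - rho) * / (r - rho) * / (r - rho) * / (r - rho))
      by (repeat apply Cmult_bound; assumption).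
    assert (B2 : Cmod (/ (u - w) * / (u - z) * / (u - z) * / (u - z)) <= / (r - rho) * / (r - rho) * / (r - rho) * / (r - rho))
      by (repeat apply Cmult_bound; assumption).
    lra.
  - right. ring.
Qed.

Lemma cauchy_int2_bound (rho : R) (z : C) : rho < r -> Cmod z <= rho ->
  Cmod (cauchy_int2 z) <= 2 * PI * (M * (/ (r - rho) * / (r - rho))).
Proof.
  intros H1 Hz. pose proof PI_RGT_0. pose proof (ker_cts rho z H1 Hz) as Cz. unfold cauchy_int2.
  eapply Rle_trans. apply Cint_bound with (M := M * (/ (r - rho) * / (r - rho))); [lra| |].
  - intros t _; specialize (Cz t); specialize (Hphi t); ct; apply (ker_far rho); assumption.
  - intros t Ht. destruct (ker_far rho z t H1 Hz) as [F1 F2].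
    apply Cmult_bound; [apply HM; exact Ht|]. repeat apply Cmult_bound; apply Cinv_bound; lra.
  - right. ring.
Qed.

Lemma ker_near (z : C) : Cmod z < r -> let rho := (Cmod z + r) / 2 in
  rho < r /\ Cmod z <= rho /\ 0 < (r - Cmod z) / 2 /\ forall w, Cmod (w - z) < (r - Cmod z) / 2 -> Cmod w <= rho.
Proof.
  intros Hz rho. unfold rho. repeat split; try lra. intros w Hw.
  replace w with (z + (w - z))%C by ring. apply Rle_trans with (1 := Cmod_triangle _ _). lra.
Qed.

Lemma cauchy_int1_deriv (z : C) : Cmod z < r -> cderiv cauchy_int1 z (cauchy_int2 z).
Proof.
  intros Hz. destruct (ker_near z Hz) as (N1 & N2 & N3 & N4).
  eapply cderiv_quadratic; [exact N3|]. intros w Hw.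
  apply (cauchy_int1_taylor _ z w N1 N2 (N4 w Hw)).
Qed.

Lemma cauchy_int2_deriv (z : C) : Cmod z < r -> cderiv cauchy_int2 z (cauchy_int3 z).
Proof.
  intros Hz. destruct (ker_near z Hz) as (N1 & N2 & N3 & N4).
  eapply cderiv_quadratic; [exact N3|]. intros w Hw.
  apply (cauchy_int2_taylor _ z w N1 N2 (N4 w Hw)).
Qed.
End CauchyKernels.

Lemma cauchy_cauchy_int1 (g : C -> C) (z : C) (r rr : R) : Cmod z < r -> r < rr -> hol rr g ->
  g z = (/ RtoC (2 * PI) * cauchy_int1 (fun t => g (circle_point r t) * circle_point r t) r z)%C.
Proof.
  intros Hz Hr Hg. pose proof PI_RGT_0. pose proof (cauchy_formula g z r rr Hz Hr Hg) as E.
  unfold circ, Cdiv in E. unfold cauchy_int1. rewrite E. field. apply RtoC_neq_0. lra.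
Qed.

Lemma hol_cauchy_data (g : C -> C) (r rr : R) : 0 < r -> r < rr -> hol rr g ->
  (forall t, ctsC (fun t => g (circle_point r t) * circle_point r t)%C t) /\
  exists M, forall t, - PI <= t <= PI -> Cmod (g (circle_point r t) * circle_point r t) <= M.
Proof.
  intros Hr Hrr Hg. pose proof PI_RGT_0.
  assert (Hc : forall t, ctsC (fun t => g (circle_point r t) * circle_point r t)%C t).
  { intros t. pose proof (hol_circ_cts g r rr ltac:(lra) Hrr Hg t). pose proof (cont_circle r t). ct. }
  split; [exact Hc|]. apply (cts_on_bounded (fun t => g (circle_point r t) * circle_point r t)%C); [lra|].
  intros t _. apply Hc.
Qed.

Lemma scaled_deriv (f g : C -> C) (c z l : C) (d : R) : 0 < d ->
  (forall w, Cmod (w - z) < d -> g w = (c * f w)%C) -> cderiv f z l -> cderiv g z (c * l)%C.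
Proof.
  intros Hd E Hf. apply (cderiv_ext_loc (fun w => c * f w)%C g z _ d Hd).
  - intros w Hw. symmetry. apply E, Hw.
  - apply (cderiv_eq _ _ (0 * f z + c * l)%C); [|ring].
    apply (cderiv_mult (fun _ => c) f); [apply cderiv_const|exact Hf].
Qed.

Lemma hol_derive_cauchy_int2 (g : C -> C) (z : C) (r rr : R) : Cmod z < r -> r < rr -> hol rr g ->
  C_derive g z = (/ RtoC (2 * PI) * cauchy_int2 (fun t => g (circle_point r t) * circle_point r t) r z)%C.
Proof.
  intros Hz Hr Hg. pose proof (Cmod_ge_0 z).
  destruct (hol_cauchy_data g r rr ltac:(lra) Hr Hg) as [Hc [M HM]].
  apply cderiv_unique. apply (scaled_deriv (cauchy_int1 (fun t => g (circle_point r t) * circle_point r t)%C r) g _ z _ (r - Cmod z)); [lra| |].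
  - intros w Hw. apply (cauchy_cauchy_int1 g w r rr); try assumption.
    replace w with (z + (w - z))%C by ring. apply Rle_lt_trans with (1 := Cmod_triangle _ _). lra.
  - apply (cauchy_int1_deriv _ r M); try assumption. lra.
Qed.

Lemma hol_C_derive (rr : R) (g : C -> C) : hol rr g -> hol rr (C_derive g).
Proof.
  intros Hg z Hz. set (r := (Cmod z + rr) / 2). pose proof (Cmod_ge_0 z).
  destruct (hol_cauchy_data g r rr ltac:(unfold r; lra) ltac:(unfold r; lra) Hg) as [Hc [M HM]].
  eexists. eapply (scaled_deriv (cauchy_int2 (fun t => g (circle_point r t) * circle_point r t)%C r) _ (/ RtoC (2 * PI)) z _ (r - Cmod z)); [unfold r; lra| |].
  - intros w Hw. apply (hol_derive_cauchy_int2 g w r rr); try assumption; [|unfold r; lra].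
    replace w with (z + (w - z))%C by ring. apply Rle_lt_trans with (1 := Cmod_triangle _ _). lra.
  - apply (cauchy_int2_deriv _ r M); try assumption; unfold r; lra.
Qed.

(** One constant for the whole closed disk: the quadratic remainder allows [ravg] to be
    differentiated under the integral, and the Lipschitz bound drives the limit in [littlewood]. *)
Lemma hol_taylor (rr rho : R) (g : C -> C) : 0 <= rho -> rho < rr -> hol rr g ->
  exists K, 0 <= K /\ forall z w, Cmod z <= rho -> Cmod w <= rho ->
    Cmod (g w - g z - (w - z) * C_derive g z) <= K * Cmod (w - z) ^ 2 /\
    Cmod (C_derive g z) <= K /\ Cmod (g w - g z) <= K * Cmod (w - z).
Proof.
  intros Hrho Hr Hg. set (r := (rho + rr) / 2). pose proof PI_RGT_0.
  destruct (hol_cauchy_data g r rr ltac:(unfold r; lra) ltac:(unfold r; lra) Hg) as [Hc [M HM]].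
  set (phi := (fun t => g (circle_point r t) * circle_point r t)%C) in *.
  pose proof (bound_nonneg phi M HM) as HM0'.
  set (d := / (r - rho)). assert (Hd : 0 < d) by (apply Rinv_0_lt_compat; unfold r; lra).
  set (c := Cmod (/ RtoC (2 * PI))). assert (Hc0 : 0 <= c) by apply Cmod_ge_0.
  set (K1 := c * (2 * PI * (M * (d * d * d)))). set (K2 := c * (2 * PI * (M * (d * d)))).
  assert (HK1 : 0 <= K1). { apply Rmult_le_pos; [lra|]. apply Rmult_le_pos; [lra|]. apply Rmult_le_pos; [lra|]. assert (0 < d * d) by nra. nra. }
  assert (HK2 : 0 <= K2). { apply Rmult_le_pos; [lra|]. apply Rmult_le_pos; [lra|]. apply Rmult_le_pos; [lra|]. assert (0 < d * d) by nra. nra. }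
  assert (T : forall z w, Cmod z <= rho -> Cmod w <= rho ->
    Cmod (g w - g z - (w - z) * C_derive g z) <= K1 * Cmod (w - z) ^ 2 /\ Cmod (C_derive g z) <= K2).
  { intros z w Hz Hw.
    rewrite (hol_derive_cauchy_int2 g z r rr), (cauchy_cauchy_int1 g z r rr), (cauchy_cauchy_int1 g w r rr) by (try assumption; unfold r; lra).
    fold phi. split.
    - replace (/ (2 * PI)%R * cauchy_int1 phi r w - / (2 * PI)%R * cauchy_int1 phi r z - (w - z) * (/ (2 * PI)%R * cauchy_int2 phi r z))%C
        with (/ (2 * PI)%R * (cauchy_int1 phi r w - cauchy_int1 phi r z - (w - z) * cauchy_int2 phi r z))%C by ring.
      rewrite Cmod_mult. fold c. unfold K1. rewrite Rmult_assoc. apply Rmult_le_compat_l; [exact Hc0|].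
      apply (cauchy_int1_taylor phi r M ltac:(unfold r; lra) Hc HM rho); try assumption; unfold r; lra.
    - rewrite Cmod_mult. fold c. apply Rmult_le_compat_l; [exact Hc0|].
      apply (cauchy_int2_bound phi r M ltac:(unfold r; lra) Hc HM rho); try assumption; unfold r; lra. }
  exists (K1 + K2 + K1 * (2 * rho)). split. { assert (0 <= K1 * (2 * rho)) by (apply Rmult_le_pos; lra). lra. }
  assert (0 <= K1 * (2 * rho)) by (apply Rmult_le_pos; lra).
  intros z w Hz Hw. destruct (T z w Hz Hw) as [T1 T2]. pose proof (Cmod_ge_0 (w - z)).
  assert (Hwz : Cmod (w - z) <= 2 * rho).
  { unfold Cminus. apply Rle_trans with (1 := Cmod_triangle _ _). rewrite Cmod_opp. lra. }
  split; [|split].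
  - apply Rle_trans with (1 := T1). apply Rmult_le_compat_r; [nra|lra].
  - lra.
  - replace (g w - g z)%C with ((g w - g z - (w - z) * C_derive g z) + (w - z) * C_derive g z)%C by ring.
    apply Rle_trans with (1 := Cmod_triangle _ _). rewrite Cmod_mult.
    assert (Cmod (w - z) * Cmod (C_derive g z) <= K2 * Cmod (w - z)) by nra.
    assert (K1 * Cmod (w - z) ^ 2 <= K1 * (2 * rho) * Cmod (w - z)).
    { simpl. rewrite Rmult_1_r, <- Rmult_assoc. apply Rmult_le_compat_r; [assumption|]. nra. }
    nra.
Qed.

(** Removes the singularity of [g z / z]. Subtracting Cauchy's formulas at [z] and 0 leaves the
    kernel [z / (u - z)] against [g u], so near 0 the quotient is an integral of Cauchy type; away
    from 0 the quotient itself is differentiable. *)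
Lemma hol_factor (rr : R) (g : C -> C) : 0 < rr -> hol rr g -> g 0%C = 0%C ->
  exists q, hol rr q /\ forall z, Cmod z < rr -> g z = (z * q z)%C.
Proof.
  intros Hrr Hg H0. set (r := rr / 2).
  destruct (hol_cauchy_data g r rr ltac:(unfold r; lra) ltac:(unfold r; lra) Hg) as [Hc _].
  set (phi := fun t => g (circle_point r t)).
  assert (Hphi : forall t, ctsC phi t) by (apply (hol_circ_cts g r rr); try assumption; unfold r; lra).
  pose proof PI_RGT_0.
  destruct (cts_on_bounded phi (- PI) PI ltac:(lra) (fun t _ => Hphi t)) as [M HM].
  assert (E1 : forall z, Cmod z < r -> g z = (z * (/ RtoC (2 * PI) * cauchy_int1 phi r z))%C).
  { intros z Hz. pose proof (Cmod_ge_0 z).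
    replace (g z) with (g z - g 0%C)%C by (rewrite H0; ring).
    rewrite (cauchy_cauchy_int1 g z r rr), (cauchy_cauchy_int1 g 0 r rr) by (try assumption; try rewrite Cmod_0; unfold r in *; lra).
    transitivity (/ RtoC (2 * PI) * (z * cauchy_int1 phi r z))%C; [|ring].
    assert (K0 : Cmod 0 <= Cmod z) by (rewrite Cmod_0; lra).
    assert (Z1 : forall t, ctsC (fun t => / (circle_point r t - z))%C t) by (apply (ker_cts r ltac:(unfold r; lra) (Cmod z)); lra).
    assert (Z2 : forall t, ctsC (fun t => / (circle_point r t - 0))%C t) by (apply (ker_cts r ltac:(unfold r; lra) (Cmod z)); lra).
    match goal with |- (_ * ?a - _ * ?b)%C = _ => transitivity (/ RtoC (2 * PI) * (a - b))%C; [ring|] end.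
    f_equal. unfold cauchy_int1. rewrite <- Cint_scal, <- Cint_minus; try lra.
    - apply Cint_ext; [lra|]. intros t _.
      pose proof (proj2 (ker_far r ltac:(unfold r; lra) (Cmod z) z t ltac:(lra) ltac:(lra))).
      pose proof (circle_point_neq_0 r t ltac:(unfold r; lra)).
      unfold phi. field. split; [|assumption]. replace (circle_point r t - 0)%C with (circle_point r t) by ring. assumption.
    - intros t _. specialize (Z1 t). specialize (Hc t). apply cont_Cmult; assumption.
    - intros t _. specialize (Z2 t). specialize (Hc t). apply cont_Cmult; assumption.
    - intros t _. specialize (Z1 t). specialize (Hphi t). apply cont_Cmult; assumption. }
  exists (fun z => if Rlt_dec (Cmod z) r then (/ RtoC (2 * PI) * cauchy_int1 phi r z)%C else (g z / z)%C).
  assert (Hin : forall z, Cmod z < r -> exists l,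
    cderiv (fun z => if Rlt_dec (Cmod z) r then (/ RtoC (2 * PI) * cauchy_int1 phi r z)%C else (g z / z)%C) z l).
  { intros z Hz. eexists. eapply (scaled_deriv (cauchy_int1 phi r) _ (/ RtoC (2 * PI)) z _ (r - Cmod z)); [lra| |].
    - intros w Hw. destruct (Rlt_dec (Cmod w) r) as [L|L]; [reflexivity|exfalso; apply L].
      replace w with (z + (w - z))%C by ring. apply Rle_lt_trans with (1 := Cmod_triangle _ _). lra.
    - apply (cauchy_int1_deriv phi r M); try assumption; unfold r; lra. }
  split.
  - intros z Hz. destruct (Rlt_dec (Cmod z) r) as [L|L]; [apply Hin, L|].
    assert (Hz0 : z <> 0%C). { apply Cmod_gt_0. unfold r in L. lra. }
    apply (cdiff_ext_loc (fun w => g w / w)%C _ z (Cmod z)).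
    + apply Cmod_gt_0, Hz0.
    + intros w Hw.
      assert (Hw0 : w <> 0%C). { intros ->. rewrite Cmod_sub_sym in Hw. replace (z - 0)%C with z in Hw by ring. lra. }
      destruct (Rlt_dec (Cmod w) r) as [L2|L2]; [|reflexivity].
      rewrite (E1 w L2). field. split; [apply RtoC_neq_0; lra|exact Hw0].
    + specialize (Hg z Hz). ch.
  - intros z Hz. destruct (Rlt_dec (Cmod z) r) as [L|L]; [apply E1, L|].
    field. apply Cmod_gt_0. unfold r in L. lra.
Qed.

(** The maximum principle on circles of radius [r] gives the bound [/ r] for the quotient, and [r]
    may be taken close to 1. The weak bound on [w] is all that is available at a contact point, in
    [jack]. *)
Lemma schwarz (w : C -> C) : hol 1 w -> w 0%C = 0%C -> (forall z, Cmod z < 1 -> Cmod (w z) <= 1) ->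
  exists v, hol 1 v /\ (forall z, Cmod z < 1 -> w z = (z * v z)%C) /\ forall z, Cmod z < 1 -> Cmod (v z) <= 1.
Proof.
  intros Hw H0 H1. destruct (hol_factor 1 w Rlt_0_1 Hw H0) as (v & Hv & E).
  exists v. split; [exact Hv|]. split; [exact E|]. intros z Hz. pose proof (Cmod_ge_0 z).
  assert (B : forall r, Cmod z < r < 1 -> Cmod (v z) <= / r).
  { intros r Hr. apply (max_modulus v z r 1); try lra; [exact Hv|]. intros u Hu.
    specialize (H1 u ltac:(lra)). rewrite E, Cmod_mult, Hu in H1 by lra.
    apply (Rmult_le_reg_l r); [lra|]. rewrite Rinv_r by lra. exact H1. }
  apply Rnot_lt_le. intros L. set (m := Cmod (v z)) in *.
  set (r := (Rmax (Cmod z) (/ m) + 1) / 2).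
  assert (Hm : / m < 1). { rewrite <- Rinv_1. apply Rinv_lt_contravar; lra. }
  pose proof (Rmax_l (Cmod z) (/ m)). pose proof (Rmax_r (Cmod z) (/ m)).
  assert (Rmax (Cmod z) (/ m) < 1) by (apply Rmax_lub_lt; lra).
  assert (Hr : Cmod z < r < 1) by (unfold r; lra).
  specialize (B r Hr). assert (Hrm : / m < r) by (unfold r; lra).
  apply Rinv_lt_contravar in Hrm; [|apply Rmult_lt_0_compat; [apply Rinv_0_lt_compat; lra|lra]].
  rewrite Rinv_inv in Hrm. lra.
Qed.

(** * Radial averages *)

(* [Rpower 0 beta = 1] in the library; this variant is continuous at [0]. *)
Definition pw (beta s : R) : R := if Rle_dec s 0 then 0 else Rpower s beta.

Lemma pw_0 beta : pw beta 0 = 0.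
Proof. unfold pw. destruct (Rle_dec 0 0); [reflexivity|lra]. Qed.

Lemma pw_pos_eq beta s : 0 < s -> pw beta s = Rpower s beta.
Proof. intros Hs. unfold pw. destruct (Rle_dec s 0); [lra|reflexivity]. Qed.

Lemma pw_1 beta : pw beta 1 = 1.
Proof. rewrite pw_pos_eq by lra. unfold Rpower. rewrite ln_1, Rmult_0_r, exp_0. reflexivity. Qed.

Lemma pw_ge_0 beta s : 0 <= pw beta s.
Proof. unfold pw. destruct (Rle_dec s 0); [lra|]. unfold Rpower. apply Rlt_le, exp_pos. Qed.

Lemma pw_le_1 beta s : 0 < beta -> s <= 1 -> pw beta s <= 1.
Proof.
  intros Hb Hs. unfold pw. destruct (Rle_dec s 0); [lra|]. unfold Rpower.
  rewrite <- exp_0. apply exp_le_compat.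
  assert (ln s <= 0); [|nra]. rewrite <- ln_1. apply ln_le; lra.
Qed.

Lemma pw_derive beta s : 0 < s -> is_derive (pw beta) s (beta * pw beta s / s).
Proof.
  intros Hs. apply (is_derive_ext_loc (fun s => Rpower s beta)).
  - apply locally_R. exists s. split; [exact Hs|]. intros y Hy. apply Rabs_lt_between in Hy.
    symmetry. apply pw_pos_eq. lra.
  - rewrite pw_pos_eq by exact Hs. unfold Rpower. auto_derive; [exact Hs|]. field. lra.
Qed.

Lemma pw_cont beta s : 0 < beta -> ctsR (pw beta) s.
Proof.
  intros Hb. destruct (Rlt_le_dec 0 s) as [L|L].
  - apply (ex_derive_continuous (K := R_AbsRing) (V := R_NormedModule)). eexists. apply pw_derive, L.
  - intros P [e He].
    apply locally_R. exists (Rpower e (/ beta) + - s). 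
    assert (Hp : 0 < Rpower e (/ beta)) by apply exp_pos.
    split; [lra|]. intros y Hy. apply Rabs_lt_between in Hy. apply He.
    assert (E0 : pw beta s = 0) by (unfold pw; destruct (Rle_dec s 0); [reflexivity|lra]).
    change (Rabs (pw beta y - pw beta s) < e). rewrite E0, Rminus_0_r, Rabs_pos_eq by apply pw_ge_0.
    unfold pw. destruct (Rle_dec y 0) as [Ly|Ly]; [apply cond_pos|].
    apply Rlt_le_trans with (Rpower (Rpower e (/ beta)) beta).
    + unfold Rpower. apply exp_increasing. apply Rmult_lt_compat_l; [exact Hb|]. apply ln_increasing; [lra|].
      fold (Rpower e (/ beta)). lra.
    + rewrite Rpower_mult, Rinv_l, Rpower_1; [lra|apply cond_pos|lra].
Qed.

(* [ravg (1 / alpha) 0 g z] is [alpha * int_0^1 s^(alpha - 1) g (s z) ds] after the substitution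
   [s -> s^(1 / alpha)], which removes the singularity at [0]; the weights [k >= 1] appear when it is
   differentiated in [z]. *)
Definition ravg (beta : R) (k : nat) (g : C -> C) (z : C) : C :=
  Cint (fun s => RtoC (pw beta s ^ k) * g (RtoC (pw beta s) * z))%C 0 1.

Lemma pw_disk beta s z : 0 < beta -> s <= 1 -> Cmod (RtoC (pw beta s) * z) <= Cmod z.
Proof.
  intros Hb Hs. rewrite Cmod_mult, Cmod_R, Rabs_pos_eq by apply pw_ge_0.
  pose proof (pw_le_1 beta s Hb Hs). pose proof (pw_ge_0 beta s). pose proof (Cmod_ge_0 z). nra.
Qed.

Lemma pw_pow_bounds beta s k : 0 < beta -> s <= 1 -> 0 <= pw beta s ^ k <= 1.
Proof.
  intros Hb Hs. pose proof (pw_le_1 beta s Hb Hs). pose proof (pw_ge_0 beta s). split.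
  - apply pow_le. assumption.
  - rewrite <- (pow1 k). apply pow_incr. lra.
Qed.

Lemma cont_Rpow {T : UniformSpace} (f : T -> R) k x : ctsR f x -> ctsR (fun t => f t ^ k) x.
Proof.
  intros Hf. induction k as [|k IH]; simpl; [apply continuous_const|]. apply cont_Rmult; assumption.
Qed.

Lemma ravg_cts beta k g z : 0 < beta -> hol 1 g -> Cmod z < 1 ->
  cts_on (fun s => RtoC (pw beta s ^ k) * g (RtoC (pw beta s) * z))%C 0 1.
Proof.
  intros Hb Hg Hz s Hs. pose proof (pw_cont beta s Hb) as Hp.
  apply cont_Cmult; [apply cont_RtoC, cont_Rpow, Hp|].
  apply (cont_hol 1 g); [exact Hg| |].
  - apply cont_Cmult; [apply cont_RtoC, Hp|apply continuous_const].
  - apply Rle_lt_trans with (2 := Hz). apply pw_disk; lra.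
Qed.

(** The remainder at the points [pw s * z] and [pw s * w] carries the factor [pw s ^ 2 <= 1], so the
    uniform constant of [hol_taylor] can be integrated over [s]. *)
Lemma ravg_deriv beta k g z : 0 < beta -> hol 1 g -> Cmod z < 1 ->
  cderiv (ravg beta k g) z (ravg beta (S k) (C_derive g) z).
Proof.
  intros Hb Hg Hz. set (rho := (Cmod z + 1) / 2). pose proof (Cmod_ge_0 z).
  destruct (hol_taylor 1 rho g) as (K0 & HK & T); [unfold rho; lra|unfold rho; lra|exact Hg|].
  apply (cderiv_quadratic _ _ _ ((1 - Cmod z) / 2) K0); [lra|]. intros w Hw.
  assert (Hwr : Cmod w <= rho).
  { replace w with (z + (w - z))%C by ring. apply Rle_trans with (1 := Cmod_triangle _ _). unfold rho. lra. }
  assert (Hw1 : Cmod w < 1) by (unfold rho in Hwr; lra).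
  pose proof (ravg_cts beta k g z Hb Hg Hz) as C1. pose proof (ravg_cts beta k g w Hb Hg Hw1) as C2.
  pose proof (ravg_cts beta (S k) (C_derive g) z Hb (hol_C_derive 1 g Hg) Hz) as C3.
  unfold ravg. rewrite <- Cint_scal by (lra || exact C3).
  rewrite <- Cint_minus by (lra || assumption). rewrite <- Cint_minus; [|lra| |].
  2:{ intros t Ht. apply cont_Cminus; [apply C2|apply C1]; exact Ht. }
  2:{ intros t Ht. apply cont_Cmult; [apply continuous_const|apply C3; exact Ht]. }
  replace (K0 * Cmod (w - z) ^ 2) with ((1 - 0) * (K0 * Cmod (w - z) ^ 2)) by ring.
  apply Cint_bound; [lra| |].
  - intros t Ht. apply cont_Cminus; [apply cont_Cminus; [apply C2|apply C1]; exact Ht|].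
    apply cont_Cmult; [apply continuous_const|apply C3; exact Ht].
  - intros t Ht. pose proof (pw_ge_0 beta t). pose proof (pw_le_1 beta t Hb ltac:(lra)).
    pose proof (pw_pow_bounds beta t k Hb ltac:(lra)) as Bk. set (p := pw beta t) in *.
    replace (RtoC (p ^ k) * g (RtoC p * w) - RtoC (p ^ k) * g (RtoC p * z) - (w - z) * (RtoC (p ^ S k) * C_derive g (RtoC p * z)))%C
      with (RtoC (p ^ k) * (g (RtoC p * w) - g (RtoC p * z) - (RtoC p * w - RtoC p * z) * C_derive g (RtoC p * z)))%C
      by (simpl pow; rewrite RtoC_mult; ring).
    destruct (T (RtoC p * z)%C (RtoC p * w)%C) as (T1 & _ & _).
    { apply Rle_trans with (1 := pw_disk beta t z Hb ltac:(lra)). unfold rho; lra. }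
    { apply Rle_trans with (1 := pw_disk beta t w Hb ltac:(lra)). exact Hwr. }
    replace (RtoC p * w - RtoC p * z)%C with (RtoC p * (w - z))%C in * by ring.
    rewrite (Cmod_mult (RtoC p)), Cmod_R, Rabs_pos_eq in T1 by assumption.
    rewrite Cmod_mult, Cmod_R, Rabs_pos_eq by apply Bk. pose proof (Cmod_ge_0 (w - z)).
    pose proof (Cmod_ge_0 (g (RtoC p * w) - g (RtoC p * z) - RtoC p * (w - z) * C_derive g (RtoC p * z))%C).
    assert (K0 * (p * Cmod (w - z)) ^ 2 <= K0 * Cmod (w - z) ^ 2).
    { apply Rmult_le_compat_l; [exact HK|]. apply pow_incr. nra. }
    nra.
Qed.

Lemma ravg_hol beta k g : 0 < beta -> hol 1 g -> hol 1 (ravg beta k g).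
Proof. intros Hb Hg z Hz. eexists. apply ravg_deriv; assumption. Qed.

Lemma ravg_C_derive beta k g z : 0 < beta -> hol 1 g -> Cmod z < 1 ->
  C_derive (ravg beta k g) z = ravg beta (S k) (C_derive g) z.
Proof. intros. apply cderiv_unique, ravg_deriv; assumption. Qed.

(** Needed at the lower end of the average, where [pw beta] need not be differentiable: the factor
    [s] makes mere continuity of [c] sufficient. *)
Lemma rderiv_at_0 (c : R -> C) : ctsC c 0 -> rderiv (fun s => RtoC s * c s)%C 0 (c 0).
Proof.
  intros Hc. apply rderiv_eps. intros eps He. destruct (proj1 (cts_eps c 0) Hc eps He) as (d & Hd & K0).
  exists d. split; [exact Hd|]. intros s Hs.
  replace (RtoC s * c s - RtoC 0 * c 0 - RtoC (s - 0) * c 0)%C with (RtoC s * (c s - c 0))%C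
    by (rewrite RtoC_minus; ring).
  rewrite Cmod_mult, Cmod_R. rewrite Rminus_0_r. rewrite Rmult_comm.
  apply Rmult_le_compat_r; [apply Rabs_pos|]. apply Rlt_le, K0, Hs.
Qed.

(* The derivative of [s * pw s ^ k * g (pw s * z)] in [s], integrated over [0, 1]. *)
Lemma ravg_ode beta k g z : 0 < beta -> hol 1 g -> Cmod z < 1 ->
  g z = (RtoC (1 + beta * INR k) * ravg beta k g z + RtoC beta * z * C_derive (ravg beta k g) z)%C.
Proof.
  intros Hb Hg Hz. rewrite ravg_C_derive by assumption.
  pose proof (ravg_cts beta k g z Hb Hg Hz) as C1.
  pose proof (ravg_cts beta (S k) (C_derive g) z Hb (hol_C_derive 1 g Hg) Hz) as C3.
  unfold ravg. rewrite <- !Cint_scal by (lra || assumption).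
  rewrite <- Cint_plus; [|lra| |].
  2:{ intros t Ht. apply cont_Cmult; [apply continuous_const|apply C1; exact Ht]. }
  2:{ intros t Ht. apply cont_Cmult; [apply continuous_const|apply C3; exact Ht]. }
  rewrite (Cint_derive (fun s => RtoC s * (RtoC (pw beta s ^ k) * g (RtoC (pw beta s) * z)))%C).
  - rewrite pw_1, pow1. replace (RtoC 1 * z)%C with z by ring. ring.
  - lra.
  - intros t Ht. destruct (Req_dec t 0) as [->|Ht0].
    + eapply rderiv_eq; [apply rderiv_at_0, C1; lra|]. rewrite pw_0. destruct k as [|k].
      * simpl. rewrite Rmult_0_r, Rplus_0_r, Rmult_0_l. ring.
      * simpl. rewrite !Rmult_0_l. ring.
    + assert (Htp : 0 < t) by lra. pose proof (pw_derive beta t Htp) as D.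
      set (p := pw beta t) in *.
      assert (Dz : rderiv (fun s => RtoC (pw beta s) * z)%C t (RtoC (beta * p / t) * z + RtoC p * 0)%C).
      { apply (rderiv_mult (fun s => RtoC (pw beta s)) (fun _ => z)); [apply rderiv_RtoC, D|apply rderiv_const]. }
      assert (Hin : Cmod (RtoC p * z) < 1).
      { apply Rle_lt_trans with (2 := Hz). apply pw_disk; lra. }
      pose proof (rderiv_comp g (fun s => RtoC (pw beta s) * z)%C t _ _ (hol_derive 1 g _ Hg Hin) Dz) as Dg.
      assert (Dk : rderiv (fun s => RtoC (pw beta s ^ k)) t (RtoC (INR k * (beta * p / t) * p ^ pred k))).
      { apply rderiv_RtoC. apply is_derive_pow. exact D. }
      pose proof (rderiv_mult _ _ _ _ _ Dk Dg) as Dm.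
      assert (Ds : rderiv (fun s => RtoC s) t (RtoC 1)) by (apply rderiv_RtoC, (is_derive_id (K := R_AbsRing))).
      pose proof (rderiv_mult _ _ _ _ _ Ds Dm) as Df. cbv beta in Df.
      apply (rderiv_eq _ _ _ _ Df). fold p.
      assert (Et : RtoC t <> 0%C) by (apply RtoC_neq_0; exact Ht0).
      assert (Ek : RtoC (INR k * (beta * p / t) * p ^ pred k) = (RtoC (beta * INR k) * RtoC (p ^ k) / RtoC t)%C).
      { destruct k as [|k]; [simpl INR; rewrite Rmult_0_r, !Rmult_0_l; field; exact Et|].
        simpl pred. replace (p ^ S k) with (p * p ^ k) by reflexivity.
        rewrite <- RtoC_mult, <- RtoC_div by exact Ht0. f_equal. field. exact Ht0. }
      rewrite Ek. replace (p ^ S k) with (p * p ^ k) by reflexivity.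
      rewrite RtoC_plus, RtoC_div, !RtoC_mult by exact Ht0. field. exact Et.
  - intros t Ht. apply cont_Cplus; (apply cont_Cmult; [apply continuous_const|]); [apply C1|apply C3]; exact Ht.
Qed.

Lemma RInt_pos_strict (f : R -> R) (a b : R) : a < b -> (forall t, a <= t <= b -> ctsR f t) ->
  (forall t, a <= t <= b -> 0 < f t) -> 0 < RInt f a b.
Proof.
  intros Hab Hc Hp. apply RInt_gt_0; [exact Hab|intros; apply Hp; lra|].
  intros t Ht. apply Hc, Ht.
Qed.

Lemma Wop0_Re_pos beta g z : 0 < beta -> hol 1 g -> (forall u, Cmod u < 1 -> 0 < Re (g u)) ->
  Cmod z < 1 -> 0 < Re (ravg beta 0 g z).
Proof.
  intros Hb Hg Hp Hz. unfold ravg, Cint. simpl Re at 1. apply RInt_pos_strict; [lra| |].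
  - intros t Ht. apply (cont_Re _ _ (ravg_cts beta 0 g z Hb Hg Hz t Ht)).
  - intros t Ht. assert (Hd : Cmod (RtoC (pw beta t) * z) < 1).
    { apply Rle_lt_trans with (2 := Hz). apply pw_disk; lra. }
    specialize (Hp _ Hd). revert Hp. unfold Re. simpl. lra.
Qed.

Lemma ravg_0 beta k g : 0 < beta -> hol 1 g -> ravg beta k g 0 = (/ RtoC (1 + beta * INR k) * g 0%C)%C.
Proof.
  intros Hb Hg. pose proof (pos_INR k).
  rewrite (ravg_ode beta k g 0 Hb Hg) at 1 by (rewrite Cmod_0; lra).
  field. apply RtoC_neq_0. nra.
Qed.

Lemma ravg_ext beta k g h z : 0 < beta -> (forall u, Cmod u <= Cmod z -> g u = h u) -> ravg beta k g z = ravg beta k h z.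
Proof.
  intros Hb E. apply Cint_ext; [lra|]. intros t Ht. rewrite E; [reflexivity|]. apply pw_disk; lra.
Qed.

(** No substitution is made in the improper integral. By [ravg_ode] with weight 0,
    [Rpower s alpha * Phi (s * z) / alpha] is a primitive of the integrand, where [Phi] is the
    average; it tends to 0 with [s], because [Phi] is bounded near 0. *)
Lemma RInt_gen_ravg alpha g z : 0 < alpha -> hol 1 g -> Cmod z < 1 ->
  (RtoC alpha * RInt_gen (V := C_R_CompleteNormedModule)
     (fun s : R => (RtoC (Rpower s (alpha - 1)) * g (RtoC s * z))%C) (at_right 0) (at_point 1))%C
  = ravg (/ alpha) 0 g z.
Proof.
  intros Ha Hg Hz. set (Phi := ravg (/ alpha) 0 g).
  assert (Hb : 0 < / alpha) by (apply Rinv_0_lt_compat, Ha).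
  assert (HPhi : hol 1 Phi) by (apply ravg_hol; assumption).
  assert (Ea : RtoC alpha <> 0%C) by (apply RtoC_neq_0; lra).
  assert (Hsz : forall s, 0 <= s <= 1 -> Cmod (RtoC s * z) < 1).
  { intros s Hs. rewrite Cmod_mult, Cmod_R, Rabs_pos_eq by lra. pose proof (Cmod_ge_0 z). nra. }
  assert (D : forall s, 0 < s <= 1 -> rderiv (fun s => / RtoC alpha * (RtoC (Rpower s alpha) * Phi (RtoC s * z)))%C s
     (RtoC (Rpower s (alpha - 1)) * g (RtoC s * z))%C).
  { intros s Hs.
    assert (D1 : rderiv (fun s => RtoC (Rpower s alpha)) s (RtoC (alpha * Rpower s (alpha - 1)))).
    { apply rderiv_RtoC. apply is_derive_Reals. apply derivable_pt_lim_power. lra. }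
    assert (D2 : rderiv (fun s => RtoC s * z)%C s (RtoC 1 * z + RtoC s * 0)%C).
    { apply (rderiv_mult (fun s => RtoC s) (fun _ => z)); [apply rderiv_RtoC, (is_derive_id (K := R_AbsRing))|apply rderiv_const]. }
    pose proof (rderiv_comp Phi (fun s => RtoC s * z)%C s _ _ (hol_derive 1 Phi _ HPhi (Hsz s ltac:(lra))) D2) as D3.
    pose proof (rderiv_mult _ _ _ _ _ (rderiv_const (/ RtoC alpha) s) (rderiv_mult _ _ _ _ _ D1 D3)) as D4.
    apply (rderiv_eq _ _ _ _ D4).
    rewrite (ravg_ode (/ alpha) 0 g (RtoC s * z) Hb Hg (Hsz s ltac:(lra))). fold Phi.
    simpl INR. rewrite Rmult_0_r, Rplus_0_r.
    replace (Rpower s alpha) with (s * Rpower s (alpha - 1)).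
    - rewrite RtoC_inv by lra. rewrite !RtoC_mult. field. exact Ea.
    - transitivity (Rpower s 1 * Rpower s (alpha - 1)); [rewrite Rpower_1 by lra; reflexivity|].
      rewrite <- Rpower_plus. f_equal. ring. }
  assert (Hf : forall s, 0 < s <= 1 -> ctsC (fun s => RtoC (Rpower s (alpha - 1)) * g (RtoC s * z))%C s).
  { intros s Hs. apply cont_Cmult.
    - apply cont_RtoC. unfold Rpower. apply cont_exp, cont_Rmult; [apply continuous_const|].
      apply cont_ln; [apply continuous_id|lra].
    - apply (cont_hol 1 g); [exact Hg| |apply Hsz; lra]. apply cont_Cmult; [|apply continuous_const].
      apply cont_RtoC, continuous_id. }
  assert (L : is_RInt_gen (V := C_R_CompleteNormedModule)
     (fun s : R => (RtoC (Rpower s (alpha - 1)) * g (RtoC s * z))%C) (at_right 0) (at_point 1) (/ RtoC alpha * Phi z)%C).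
  { intros P HP. apply locally_Cmod in HP. destruct HP as (e & He & HP).
    set (B := Cmod (/ RtoC alpha) * (Cmod (Phi 0%C) + 1)).
    assert (HB : 0 <= B). { apply Rmult_le_pos; [apply Cmod_ge_0|]. pose proof (Cmod_ge_0 (Phi 0%C)). lra. }
    assert (Hc0 : ccont Phi (RtoC 0)) by (apply cdiff_cont, HPhi; rewrite Cmod_0; lra).
    destruct (proj1 (ccont_eps Phi (RtoC 0)) Hc0 1 Rlt_0_1) as (d1 & Hd1 & K1).
    pose proof (pw_cont alpha 0 Ha) as Hpw.
    assert (Hpw2 : exists d, 0 < d /\ forall s, Rabs (s - 0) < d -> Rabs (pw alpha s - pw alpha 0) < e / (B + 1)).
    { assert (He2 : 0 < e / (B + 1)) by (apply Rdiv_lt_0_compat; lra).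
      apply locally_R. apply (Hpw (fun v => Rabs (v - pw alpha 0) < e / (B + 1))). apply locally_R.
      exists (e / (B + 1)). tauto. }
    destruct Hpw2 as (d2 & Hd2 & K2).
    set (d := Rmin (Rmin d1 d2) 1). assert (Hd : 0 < d) by (repeat apply Rmin_pos; lra).
    assert (Hdd1 : d <= d1) by (eapply Rle_trans; apply Rmin_l).
    assert (Hdd2 : d <= d2) by (eapply Rle_trans; [apply Rmin_l|apply Rmin_r]).
    assert (Hdd3 : d <= 1) by apply Rmin_r.
    exists (fun a => 0 < a < d) (fun b => b = 1).
    - apply locally_R. exists d. split; [exact Hd|]. intros y Hy Hy0. apply Rabs_lt_between in Hy. lra.
    - reflexivity.
    - intros a b Hab ->. simpl.
      exists (Cint (fun s : R => (RtoC (Rpower s (alpha - 1)) * g (RtoC s * z))%C) a 1). split.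
      + apply (is_RInt_fct_extend_pair (U := R_NormedModule) (V := R_NormedModule)).
        * apply (RInt_correct (V := R_CompleteNormedModule)). apply (ex_RInt_Re (fun s => RtoC (Rpower s (alpha - 1)) * g (RtoC s * z))%C); [lra|].
          intros s Hs. apply Hf. lra.
        * apply (RInt_correct (V := R_CompleteNormedModule)). apply (ex_RInt_Im (fun s => RtoC (Rpower s (alpha - 1)) * g (RtoC s * z))%C); [lra|].
          intros s Hs. apply Hf. lra.
      + apply HP. rewrite (Cint_derive _ _ a 1 ltac:(lra) (fun t Ht => D t ltac:(lra))).
        2:{ intros s Hs. apply Hf. lra. }
        unfold Rpower at 1. rewrite ln_1, Rmult_0_r, exp_0. replace (RtoC 1 * z)%C with z by ring.
        replace (/ alpha * (1 * Phi z) - / alpha * (Rpower a alpha * Phi (a * z)) - / alpha * Phi z)%C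
          with (- (RtoC (Rpower a alpha) * (/ alpha * Phi (a * z))))%C by ring.
        rewrite Cmod_opp, Cmod_mult, Cmod_R.
        specialize (K2 a). rewrite pw_0, pw_pos_eq, !Rminus_0_r in K2 by lra.
        rewrite (Rabs_pos_eq a) in K2 by lra. specialize (K2 ltac:(lra)).
        assert (Kz : Cmod (/ RtoC alpha * Phi (RtoC a * z)%C)%C <= B).
        { rewrite Cmod_mult. apply Rmult_le_compat_l; [apply Cmod_ge_0|].
          replace (Phi (a * z)%C) with (Phi 0%C + (Phi (a * z)%C - Phi 0%C))%C by ring.
          apply Rle_trans with (1 := Cmod_triangle _ _). apply Rplus_le_compat_l, Rlt_le, K1.
          replace (a * z - 0)%C with (a * z)%C by ring. rewrite Cmod_mult, Cmod_R, Rabs_pos_eq by lra.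
          pose proof (Cmod_ge_0 z). nra. }
        apply Rle_lt_trans with (Rabs (Rpower a alpha) * B).
        * apply Rmult_le_compat_l; [apply Rabs_pos|exact Kz].
        * apply Rle_lt_trans with (Rabs (Rpower a alpha) * (B + 1)).
          { apply Rmult_le_compat_l; [apply Rabs_pos|lra]. }
          apply (Rmult_lt_compat_r (B + 1)) in K2; [|lra].
          replace (e / (B + 1) * (B + 1)) with e in K2 by (field; lra). exact K2. }
  rewrite (is_RInt_gen_unique (V := C_R_CompleteNormedModule) _ _ L). field. exact Ea.
Qed.

(** * First contact and convexity *)

(** Compactness of the closed disk in the single form used below, for minima, for first contacts and
    for the continuity of lifted functions. Points outside the disk get balls that miss it, which
    reduces the claim to a square. *)
Lemma disk_compact (r : R) (Q : C -> R -> Prop) :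
  (forall w d d', Q w d -> 0 < d' <= d -> Q w d') ->
  (forall z, Cmod z <= r -> exists d, 0 < d /\ forall w, Cmod (w - z) < d -> Q w d) ->
  exists d, 0 < d /\ forall w, Cmod w <= r -> Q w d.
Proof.
  intros Hmon Hloc.
  assert (Hall : forall z : C, exists d : posreal, forall w, Cmod (w - z) < 2 * d -> Cmod w <= r -> Q w d).
  { intros z. destruct (Rle_lt_dec (Cmod z) r) as [L|L].
    - destruct (Hloc z L) as (d & Hd & Hz). assert (Hd2 : 0 < d / 2) by lra.
      exists (mkposreal _ Hd2). simpl. intros w Hw _. apply (Hmon w d); [apply Hz; lra|lra].
    - assert (Hd : 0 < (Cmod z - r) / 2) by lra. exists (mkposreal _ Hd). simpl. intros w Hw Hr. exfalso.
      pose proof (Cmod_triangle (z - w) w) as T. replace (z - w + w)%C with z in T by ring.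
      rewrite Cmod_sub_sym in T. lra. }
  destruct (compactness_value_2d (- r) r (- r) r
    (fun x y => proj1_sig (constructive_indefinite_description _ (Hall (x, y))))) as [d Hd].
  exists d. split; [apply cond_pos|]. intros w Hw.
  pose proof (re_le_Cmod w) as H1. pose proof (im_le_Cmod w) as H2.
  apply Rabs_le_between in H1. apply Rabs_le_between in H2.
  specialize (Hd (Re w) (Im w) ltac:(lra) ltac:(lra)). apply NNPP. intros Hn. apply Hd.
  intros (u & v & _ & _ & K1 & K2 & K3). apply Hn.
  destruct (constructive_indefinite_description _ (Hall (u, v))) as [dz Hz]. simpl in K1, K2, K3.
  apply (Hmon w dz); [|split; [apply cond_pos|exact K3]]. apply Hz; [|exact Hw].
  apply Rle_lt_trans with (1 := Cmod_le_Re_Im _).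
  change (Re (w - (u, v))%C) with (Re w - u). change (Im (w - (u, v))%C) with (Im w - v). lra.
Qed.

Notation ucont := (@continuous C_UniformSpace R_UniformSpace).

Lemma ucont_eps (u : C -> R) (z : C) : ucont u z ->
  forall eps, 0 < eps -> exists d, 0 < d /\ forall w, Cmod (w - z) < d -> Rabs (u w - u z) < eps.
Proof.
  intros Hu eps He.
  assert (H0 : @locally R_UniformSpace (u z) (fun v => Rabs (v - u z) < eps)).
  { apply locally_R. exists eps. tauto. }
  apply Hu in H0. apply locally_Cmod in H0. exact H0.
Qed.

(** Compactness is used twice: for a lower bound, written [- / d] so that it weakens as [d] shrinks,
    and then, if the infimum [m] were not attained, for a gap [m + d] contradicting its
    definition. *)
Lemma disk_min (r : R) (u : C -> R) : 0 <= r -> (forall z, Cmod z <= r -> ucont u z) ->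
  exists z0, Cmod z0 <= r /\ forall z, Cmod z <= r -> u z0 <= u z.
Proof.
  intros Hr Hu.
  destruct (disk_compact r (fun w d => - / d <= u w)) as (d & Hd & HB).
  { intros w d d' H Hd. apply Rle_trans with (2 := H). apply Ropp_le_contravar, Rinv_le_contravar; lra. }
  { intros z Hz. destruct (ucont_eps u z (Hu z Hz) 1 Rlt_0_1) as (d & Hd & K1).
    set (b := Rabs (u z) + 1). assert (Hb : 0 < b) by (unfold b; pose proof (Rabs_pos (u z)); lra).
    exists (Rmin d (/ b)). assert (Hm : 0 < Rmin d (/ b)) by (apply Rmin_pos; [lra|apply Rinv_0_lt_compat; lra]).
    split; [exact Hm|]. intros w Hw. pose proof (Rmin_l d (/ b)). pose proof (Rmin_r d (/ b)) as Hr2.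
    specialize (K1 w ltac:(lra)). apply Rinv_le_contravar in Hr2; [|exact Hm]. rewrite Rinv_inv in Hr2.
    apply Rabs_lt_between in K1. pose proof (Rle_abs (- u z)). rewrite Rabs_Ropp in H0. assert (Eb : b = Rabs (u z) + 1) by reflexivity. clearbody b. lra. }
  destruct (completeness (fun x => forall z, Cmod z <= r -> x <= u z)) as [m [Hm1 Hm2]].
  { exists (u 0%C). intros x Hx. apply Hx. rewrite Cmod_0. exact Hr. }
  { exists (- / d). exact HB. }
  assert (Hm : forall z, Cmod z <= r -> m <= u z).
  { intros z Hz. apply Hm2. intros x Hx. apply Hx, Hz. }
  apply NNPP. intros Hn.
  assert (Hgt : forall z, Cmod z <= r -> m < u z).
  { intros z Hz. destruct (Rle_lt_or_eq_dec _ _ (Hm z Hz)) as [L|L]; [exact L|]. exfalso. apply Hn.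
    exists z. split; [exact Hz|]. intros w Hw. rewrite <- L. apply Hm, Hw. }
  destruct (disk_compact r (fun w d => m + d <= u w)) as (d2 & Hd2 & HB2).
  { intros w d1 d1' H1 H2. lra. }
  { intros z Hz. specialize (Hgt z Hz). destruct (ucont_eps u z (Hu z Hz) ((u z - m) / 2)) as (d1 & Hd1 & K1); [lra|].
    exists (Rmin d1 ((u z - m) / 2)). split; [apply Rmin_pos; lra|]. intros w Hw.
    pose proof (Rmin_l d1 ((u z - m) / 2)). pose proof (Rmin_r d1 ((u z - m) / 2)).
    specialize (K1 w ltac:(lra)). apply Rabs_lt_between in K1. lra. }
  specialize (Hm1 _ HB2). lra.
Qed.

Lemma radial_limit_ge (u : C -> R) (z : C) : ucont u z ->
  (forall t, 0 <= t < 1 -> 0 < u (RtoC t * z)%C) -> 0 <= u z.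
Proof.
  intros Hu Hp. apply Rnot_lt_le. intros L.
  destruct (ucont_eps u z Hu (- u z)) as (d & Hd & K1); [lra|].
  pose proof (Cmod_ge_0 z) as Hz.
  set (s := Rmin (d / 2 / (Cmod z + 1)) (/ 2)).
  assert (Hs0 : 0 < d / 2 / (Cmod z + 1)) by (apply Rdiv_lt_0_compat; lra).
  assert (Hs : 0 < s) by (apply Rmin_pos; lra).
  assert (Hs1 : s <= d / 2 / (Cmod z + 1)) by apply Rmin_l. assert (Hs2 : s <= / 2) by apply Rmin_r.
  specialize (Hp (1 - s) ltac:(lra)). specialize (K1 (RtoC (1 - s) * z)%C).
  replace (RtoC (1 - s) * z - z)%C with (- (RtoC s * z))%C in K1 by (rewrite RtoC_minus; ring).
  rewrite Cmod_opp, Cmod_mult, Cmod_R, Rabs_pos_eq in K1 by lra.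
  assert (s * Cmod z < d).
  { apply Rle_lt_trans with (s * (Cmod z + 1)); [nra|]. apply (Rmult_le_compat_r (Cmod z + 1)) in Hs1; [|lra].
    replace (d / 2 / (Cmod z + 1) * (Cmod z + 1)) with (d / 2) in Hs1 by (field; lra). lra. }
  specialize (K1 H). apply Rabs_lt_between in K1. lra.
Qed.

(** [r0] is the infimum of the moduli of points with [u <= 0], taken as the supremum of the lower
    bounds. Were [u] positive on the whole closed disk of radius [r0], compactness would carry
    positivity beyond [r0]. *)
Lemma first_contact (u : C -> R) (z1 : C) :
  (forall z, Cmod z < 1 -> ucont u z) -> 0 < u 0%C -> Cmod z1 < 1 -> u z1 <= 0 ->
  exists z0, Cmod z0 < 1 /\ u z0 = 0 /\ (forall z, Cmod z < Cmod z0 -> 0 < u z) /\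
    forall z, Cmod z <= Cmod z0 -> 0 <= u z.
Proof.
  intros Hu H0 Hz1 Hu1.
  destruct (completeness (fun x => forall z, Cmod z < 1 -> u z <= 0 -> x <= Cmod z)) as [r0 [Hr1 Hr2]].
  { exists (Cmod z1). intros x Hx. apply Hx; assumption. }
  { exists 0. intros z _ _. apply Cmod_ge_0. }
  assert (Hr0 : 0 <= r0) by (apply Hr1; intros z _ _; apply Cmod_ge_0).
  assert (Hrz : r0 <= Cmod z1) by (apply Hr2; intros x Hx; apply Hx; assumption).
  assert (Hin : forall z, Cmod z < r0 -> 0 < u z).
  { intros z Hz. apply Rnot_le_lt. intros L. assert (r0 <= Cmod z); [|lra].
    apply Hr2. intros x Hx. apply Hx; [lra|exact L]. }
  assert (Hcl : forall z, Cmod z <= r0 -> 0 <= u z).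
  { intros z Hz. destruct (Rle_lt_or_eq_dec _ _ Hz) as [L|L]; [apply Rlt_le, Hin, L|].
    destruct (Rle_lt_or_eq_dec _ _ Hr0) as [L0|L0].
    - apply radial_limit_ge; [apply Hu; lra|]. intros t Ht. apply Hin.
      rewrite Cmod_mult, Cmod_R, Rabs_pos_eq by lra. nra.
    - assert (z = 0%C) by (apply Cmod_eq_0; lra). subst z. lra. }
  assert (Hex : exists z0, Cmod z0 <= r0 /\ u z0 <= 0).
  { apply NNPP. intros Hn.
    destruct (disk_compact r0 (fun w d => forall w', Cmod (w' - w) < d -> 0 < u w')) as (d & Hd & HB).
    { intros w d d' K1 K2 w' K3. apply K1. lra. }
    { intros z Hz. assert (Hz0 : 0 < u z). { apply Rnot_le_lt. intros L. apply Hn. exists z. tauto. }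
      destruct (ucont_eps u z (Hu z ltac:(lra)) (u z) Hz0) as (d & Hd & K1).
      exists (d / 2). split; [lra|]. intros w Hw w' Hw'. specialize (K1 w').
      assert (Cmod (w' - z) < d).
      { replace (w' - z)%C with ((w' - w) + (w - z))%C by ring. apply Rle_lt_trans with (1 := Cmod_triangle _ _). lra. }
      specialize (K1 H). apply Rabs_lt_between in K1. lra. }
    assert (r0 + d <= r0); [|lra]. apply Hr1. intros z Hz Huz. apply Rnot_lt_le. intros L.
    destruct (Rle_lt_dec (Cmod z) r0) as [L2|L2].
    - apply Hn. exists z. tauto.
    - assert (0 < u z); [|lra]. apply (HB (RtoC (r0 / Cmod z) * z)%C).
      + rewrite Cmod_mult, Cmod_R, Rabs_pos_eq by (apply Rdiv_le_0_compat; lra).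
        right. field. lra.
      + replace (z - RtoC (r0 / Cmod z) * z)%C with (RtoC (1 - r0 / Cmod z) * z)%C by (rewrite RtoC_minus; ring).
        assert (r0 / Cmod z < 1).
        { apply (Rmult_lt_reg_r (Cmod z)); [lra|]. unfold Rdiv. rewrite Rmult_assoc, Rinv_l; lra. }
        rewrite Cmod_mult, Cmod_R, Rabs_pos_eq by lra.
        replace ((1 - r0 / Cmod z) * Cmod z) with (Cmod z - r0) by (field; lra). lra. }
  destruct Hex as (z0 & Hz0 & Huz0).
  assert (Hz0r : Cmod z0 = r0).
  { apply Rle_antisym; [exact Hz0|]. apply Hr2. intros x Hx. apply Hx; [lra|exact Huz0]. }
  exists z0. rewrite Hz0r. split; [lra|]. split; [|split; assumption].
  apply Rle_antisym; [exact Huz0|apply Hcl, Hz0].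
Qed.

Lemma derive_left_min (f : R -> R) (x v : R) : is_derive f x v ->
  (forall t, x - 1 < t <= x -> f x <= f t) -> v <= 0.
Proof.
  intros Hf Hmin. apply Rnot_lt_le. intros L.
  destruct (proj1 (is_derive_eps f x v) Hf (v / 2)) as (d & Hd & K1); [lra|].
  set (s := Rmin (d / 2) (/ 2)). assert (Hs : 0 < s) by (apply Rmin_pos; lra).
  assert (Hs1 : s <= d / 2) by apply Rmin_l. assert (Hs2 : s <= / 2) by apply Rmin_r.
  specialize (Hmin (x - s) ltac:(lra)). specialize (K1 (x - s)).
  replace (x - s - x) with (- s) in K1 by ring. rewrite Rabs_Ropp, Rabs_pos_eq in K1 by lra.
  specialize (K1 ltac:(lra)). apply Rabs_le_between in K1. nra.
Qed.

(* The paths [z0 * exp (t * c)], [t <= 0], stay in the closed disk of radius [|z0|] when [Re c >= 0]. *)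
Lemma contact_direction (g : C -> C) (z0 l c : C) : cderiv g z0 l ->
  (forall z, Cmod z <= Cmod z0 -> Re (g z0) <= Re (g z)) -> 0 <= Re c -> Re (z0 * l * c)%C <= 0.
Proof.
  intros Hg Hmin Hc.
  assert (E0 : (z0 * Cexp (RtoC 0 * c))%C = z0) by (replace (RtoC 0 * c)%C with (RtoC 0) by ring; rewrite Cexp_0; ring).
  assert (D1 : rderiv (fun t => RtoC t * c)%C 0 (RtoC 1 * c + RtoC 0 * 0)%C).
  { apply (rderiv_mult (fun t => RtoC t) (fun _ => c)); [apply rderiv_RtoC, (is_derive_id (K := R_AbsRing))|apply rderiv_const]. }
  pose proof (rderiv_comp Cexp (fun t => RtoC t * c)%C 0 _ _ (cderiv_Cexp _) D1) as D2.
  pose proof (rderiv_mult _ _ _ _ _ (rderiv_const z0 0) D2) as D3. cbv beta in D3.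
  assert (D4 : rderiv (fun t => g (z0 * Cexp (RtoC t * c))%C) 0 (z0 * l * c)%C).
  { eapply rderiv_eq. eapply (rderiv_comp g (fun t => z0 * Cexp (RtoC t * c))%C 0 l); [rewrite E0; exact Hg|exact D3].
    replace (RtoC 0 * c)%C with (RtoC 0) by ring. rewrite Cexp_0. ring. }
  apply (derive_left_min _ 0 _ (proj1 D4)). intros t Ht. cbv beta. rewrite E0. apply Hmin.
  rewrite Cmod_mult, Cmod_Cexp. replace (Re (RtoC t * c)%C) with (t * Re c) by (unfold Re; simpl; ring).
  assert (exp (t * Re c) <= 1). { rewrite <- exp_0. apply exp_le_compat. nra. }
  pose proof (Cmod_ge_0 z0). nra.
Qed.

(** The radial direction 1 gives the sign, and the two tangential directions [Ci] and [- Ci]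
    annihilate the imaginary part. *)
Lemma contact_derivative (g : C -> C) (z0 l : C) : cderiv g z0 l ->
  (forall z, Cmod z <= Cmod z0 -> Re (g z0) <= Re (g z)) -> exists k, k <= 0 /\ (z0 * l)%C = RtoC k.
Proof.
  intros Hg Hmin. exists (Re (z0 * l)%C). split.
  - pose proof (contact_direction g z0 l 1 Hg Hmin ltac:(simpl; lra)) as H.
    replace (z0 * l * 1)%C with (z0 * l)%C in H by ring. exact H.
  - pose proof (contact_direction g z0 l Ci Hg Hmin ltac:(simpl; lra)) as H1.
    pose proof (contact_direction g z0 l (- Ci) Hg Hmin ltac:(simpl; lra)) as H2.
    apply C_ext; [reflexivity|]. set (p := (z0 * l)%C) in *. change (Im p = 0).
    unfold Re in H1, H2. simpl in H1, H2. unfold Im, p. simpl. lra.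
Qed.

(** Where [Cmod Y] is maximal, the real part of [- Cconj (Y z0) * Y] is minimal, so
    [contact_derivative] applies to this product. *)
Lemma contact_modulus (Y : C -> C) (z0 l : C) : cderiv Y z0 l ->
  (forall z, Cmod z <= Cmod z0 -> Cmod (Y z) <= Cmod (Y z0)) ->
  exists k, 0 <= k /\ (z0 * l * Cconj (Y z0))%C = RtoC k.
Proof.
  intros HY Hmax.
  destruct (contact_derivative (fun z => - (Cconj (Y z0)) * Y z)%C z0 (- Cconj (Y z0) * l)%C) as (k & Hk & E).
  - apply (cderiv_eq _ _ (0 * Y z0 + - Cconj (Y z0) * l)%C); [|ring].
    apply (cderiv_mult (fun _ => - Cconj (Y z0))%C Y); [apply cderiv_const|exact HY].
  - intros z Hz. specialize (Hmax z Hz).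
    replace (- Cconj (Y z0) * Y z0)%C with (- RtoC (Cmod (Y z0) ^ 2))%C by (rewrite Cmod2_conj; ring).
    pose proof (re_le_Cmod (- Cconj (Y z0) * Y z)) as H.
    rewrite Cmod_mult, Cmod_opp, Cmod_conj in H. apply Rabs_le_between in H.
    pose proof (Cmod_ge_0 (Y z)). pose proof (Cmod_ge_0 (Y z0)).
    unfold Re at 1. simpl fst. nra.
  - exists (- k). split; [lra|]. rewrite RtoC_opp, <- E. ring.
Qed.

Lemma hol_Re_ucont (g : C -> C) (z : C) : cdiff g z -> ucont (fun z => Re (g z)) z.
Proof. intros H. apply cont_Re. apply cdiff_cont, H. Qed.

Lemma Re_div_real (k : R) (q : C) : q <> 0%C -> Re (RtoC k / q)%C = k * Re q / (Cmod q ^ 2).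
Proof.
  intros Hq. pose proof (Cconj_neq_0 q Hq).
  assert (Cmod q ^ 2 <> 0) by (apply pow_nonzero, Rgt_not_eq, Cmod_gt_0, Hq).
  replace (RtoC k / q)%C with (RtoC k * Cconj q / RtoC (Cmod q ^ 2))%C.
  - unfold Cdiv. rewrite <- RtoC_inv by assumption. rewrite re_scal_r, re_scal_l, re_conj. reflexivity.
  - rewrite Cmod2_conj. field. auto.
Qed.

Lemma Re_pos_neq_0 (q : C) : 0 < Re q -> q <> 0%C.
Proof. intros H ->. simpl in H. lra. Qed.

(** At a first zero of [Re g] the number [z0 g'(z0)] is a real [k <= 0], and then [Re (k / Q) <= 0]
    contradicts the hypothesis. *)
Lemma Re_ode_pos (g Q : C -> C) : hol 1 g -> (forall z, Cmod z < 1 -> 0 < Re (Q z)) ->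
  (forall z, Cmod z < 1 -> 0 < Re (g z + z * C_derive g z / Q z)%C) ->
  forall z, Cmod z < 1 -> 0 < Re (g z).
Proof.
  intros Hg HQ Hode z Hz. apply Rnot_le_lt. intros L.
  destruct (first_contact (fun z => Re (g z)) z) as (z0 & Hz0 & E0 & _ & Hmin).
  - intros w Hw. apply hol_Re_ucont, Hg, Hw.
  - specialize (Hode 0%C). rewrite Cmod_0 in Hode. specialize (Hode ltac:(lra)).
    replace (g 0 + 0 * C_derive g 0 / Q 0)%C with (g 0%C) in Hode; [exact Hode|].
    field. apply Re_pos_neq_0, HQ. rewrite Cmod_0. lra.
  - exact Hz.
  - exact L.
  - destruct (contact_derivative g z0 (C_derive g z0)) as (k & Hk & Ek).
    + apply (hol_derive 1); assumption.
    + intros w Hw. rewrite E0. apply Hmin, Hw.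
    + specialize (Hode z0 Hz0). specialize (HQ z0 Hz0). rewrite Ek, re_plus, E0, Re_div_real in Hode by (apply Re_pos_neq_0, HQ).
      assert (0 <= / (Cmod (Q z0) ^ 2)).
      { apply Rlt_le, Rinv_0_lt_compat, pow_lt, Cmod_gt_0, Re_pos_neq_0, HQ. }
      unfold Rdiv in Hode. assert (k * Re (Q z0) <= 0) by nra. nra.
Qed.

Lemma ravg_plus beta k g h z : 0 < beta -> hol 1 g -> hol 1 h -> Cmod z < 1 ->
  ravg beta k (fun u => g u + h u)%C z = (ravg beta k g z + ravg beta k h z)%C.
Proof.
  intros Hb Hg Hh Hz. unfold ravg. rewrite <- Cint_plus; [|lra|apply ravg_cts; assumption|apply ravg_cts; assumption].
  apply Cint_ext; [lra|]. intros t _. ring.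
Qed.

Lemma ravg_scal beta k c g z : 0 < beta -> hol 1 g -> Cmod z < 1 ->
  ravg beta k (fun u => c * g u)%C z = (c * ravg beta k g z)%C.
Proof.
  intros Hb Hg Hz. unfold ravg. rewrite <- Cint_scal; [|lra|apply ravg_cts; assumption].
  apply Cint_ext; [lra|]. intros t _. ring.
Qed.

Lemma ravg_minus beta k g h z : 0 < beta -> hol 1 g -> hol 1 h -> Cmod z < 1 ->
  ravg beta k (fun u => g u - h u)%C z = (ravg beta k g z - ravg beta k h z)%C.
Proof.
  intros Hb Hg Hh Hz. unfold ravg. rewrite <- Cint_minus; [|lra|apply ravg_cts; assumption|apply ravg_cts; assumption].
  apply Cint_ext; [lra|]. intros t _. ring.
Qed.

(** * Averaging derivatives of convex maps *)

Definition logder (T : C -> C) (z : C) : C := (1 + z * C_derive T z / T z)%C.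

(* The classical condition for a primitive of [T] to be a convex univalent function. *)
Definition convex_derivative (T : C -> C) : Prop :=
  hol 1 T /\ forall z, Cmod z < 1 -> T z <> 0%C /\ 0 < Re (logder T z).

Lemma Cmod_half_disk (V : C) : Cmod (2 * V - 1) ^ 2 = 1 + 4 * (Cmod V ^ 2 - Re V).
Proof. rewrite !Cmod2_alt. destruct V; simpl; ring. Qed.

(* With [V = ravg beta 1 T / T] and [q = 1 + z T' / T] one has [beta z V' = 1 - V (1 + beta q)], and
   [Re (1 / V) > 1] says that [V] lies in the disk of centre and radius [1/2]. *)
Lemma ravg_quotient_disk beta T : 0 < beta -> convex_derivative T ->
  forall z, Cmod z < 1 -> Cmod (2 * (ravg beta 1 T z / T z) - 1) < 1.
Proof.
  intros Hb [HT Hq] z Hz. set (V := fun z => (ravg beta 1 T z / T z)%C).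
  assert (HW : hol 1 (ravg beta 1 T)) by (apply ravg_hol; assumption).
  assert (HV : hol 1 V).
  { intros w Hw. pose proof (HW w Hw). pose proof (HT w Hw). apply (cdiff_div (ravg beta 1 T) T); try assumption. apply Hq, Hw. }
  assert (Hode : forall w, Cmod w < 1 -> (RtoC beta * (w * C_derive V w) = 1 - V w * (1 + RtoC beta * logder T w))%C).
  { intros w Hw. destruct (Hq w Hw) as [Hn _].
    assert (EV : C_derive V w = ((C_derive (ravg beta 1 T) w * T w - ravg beta 1 T w * C_derive T w) / (T w * T w))%C).
    { apply cderiv_unique. apply cderiv_div; [apply (hol_derive 1); assumption|apply (hol_derive 1); assumption|exact Hn]. }
    pose proof (ravg_ode beta 1 T w Hb HT Hw) as E. simpl INR in E.
    rewrite EV. unfold V, logder.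
    replace (RtoC beta * (w * ((C_derive (ravg beta 1 T) w * T w - ravg beta 1 T w * C_derive T w) / (T w * T w))))%C
      with ((RtoC beta * w * C_derive (ravg beta 1 T) w) / T w - RtoC beta * w * ravg beta 1 T w * C_derive T w / (T w * T w))%C by (field; exact Hn).
    replace (RtoC beta * w * C_derive (ravg beta 1 T) w)%C with (T w - RtoC (1 + beta * 1) * ravg beta 1 T w)%C by (rewrite E at 1; ring).
    rewrite RtoC_plus, RtoC_mult. field. exact Hn. }
  change (Cmod (2 * V z - 1) < 1). apply Rnot_le_lt. intros L.
  assert (HY : hol 1 (fun z => 2 * V z - 1)%C) by (intros w Hw; specialize (HV w Hw); ch).
  destruct (first_contact (fun z => 1 - Cmod (2 * V z - 1)) z) as (z0 & Hz0 & E0 & _ & Hmin).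
  - intros w Hw. apply cont_Rminus; [apply continuous_const|]. apply cont_Cmod. apply cdiff_cont, HY, Hw.
  - assert (E : V 0%C = RtoC (/ (1 + beta))).
    { unfold V. rewrite ravg_0 by assumption. simpl INR. rewrite Rmult_1_r, RtoC_inv by lra.
      field. split; [apply RtoC_neq_0; lra|apply Hq; rewrite Cmod_0; lra]. }
    rewrite E, <- RtoC_mult, <- RtoC_minus, Cmod_R.
    replace (2 * / (1 + beta) - 1) with ((1 - beta) / (1 + beta)) by (field; lra).
    assert (Rabs ((1 - beta) / (1 + beta)) < 1); [|lra]. apply Rabs_lt_between.
    split; apply (Rmult_lt_reg_r (1 + beta)); try lra; unfold Rdiv; rewrite Rmult_assoc, Rinv_l; lra.
  - exact Hz.
  - lra.
  - set (Y := fun z => (2 * V z - 1)%C) in *.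
    assert (EY : Cmod (Y z0) = 1) by (unfold Y; lra).
    destruct (contact_modulus Y z0 (2 * C_derive V z0)%C) as (k & Hk & Ek).
    + apply (cderiv_eq _ _ (0 * V z0 + 2 * C_derive V z0 - 0)%C); [|ring].
      apply cderiv_minus; [|apply cderiv_const]. apply (cderiv_mult (fun _ => RtoC 2) V); [apply cderiv_const|].
      apply (hol_derive 1); assumption.
    + intros w Hw. rewrite EY. specialize (Hmin w Hw). unfold Y. lra.
    + destruct (Hq z0 Hz0) as [_ Hre]. specialize (Hode z0 Hz0).
      assert (EV : Cmod (V z0) ^ 2 = Re (V z0)).
      { pose proof (Cmod_half_disk (V z0)) as K0. change (Cmod (Y z0) ^ 2 = 1 + 4 * (Cmod (V z0) ^ 2 - Re (V z0))) in K0.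
        rewrite EY in K0. lra. }
      assert (EY2 : (Y z0 * Cconj (Y z0) = 1)%C) by (rewrite <- Cmod2_conj, EY; f_equal; ring).
      assert (E2 : (2 * (z0 * C_derive V z0) = RtoC k * Y z0)%C).
      { rewrite <- Ek. replace (z0 * (2 * C_derive V z0) * Cconj (Y z0) * Y z0)%C
          with (2 * (z0 * C_derive V z0) * (Y z0 * Cconj (Y z0)))%C by ring. rewrite EY2. ring. }
      set (q := logder T z0) in *. set (D := (z0 * C_derive V z0)%C) in *.
      assert (E3 : (RtoC (beta * k) * Y z0 = 2 * (1 - V z0 * (1 + RtoC beta * q)))%C).
      { rewrite <- Hode, RtoC_mult. replace (RtoC beta * RtoC k * Y z0)%C with (RtoC beta * (RtoC k * Y z0))%C by ring.
        rewrite <- E2. ring. }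
      unfold Y in E3. destruct (V z0) as [p s] eqn:EVz. destruct q as [q1 q2].
      rewrite Cmod2_alt in EV. unfold Re, Im in *. simpl in EV, Hre, E3.
      injection E3 as F1 F2. 
      (* real part of [conj V] times the differential equation *)
      assert (F3 : (beta * k) * (p * (2 * p - 1) + s * (2 * s)) = 2 * (p - (p * p + s * s) - beta * q1 * (p * p + s * s))).
      { apply (f_equal (fun x => p * x)) in F1. apply (f_equal (fun x => s * x)) in F2. simpl in F1, F2. lra. }
      assert (F4 : p * p + s * s = p) by lra.
      assert (Hp : 0 <= p) by nra.
      assert (Hp2 : p * (2 * p - 1) + s * (2 * s) = p) by nra.
      rewrite Hp2, F4 in F3.
      destruct (Rle_lt_or_eq_dec _ _ Hp) as [Lp|Lp].
      * assert (0 < beta * q1 * p) by (repeat apply Rmult_lt_0_compat; assumption).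
        assert (0 <= beta * k * p) by (repeat apply Rmult_le_pos; lra). lra.
      (* Here [V z0 = 0], and the differential equation reads [- (beta * k) = 2], impossible for
         [k >= 0]. *)
      * subst p. assert (s = 0) by nra. subst s. nra.
Qed.

(** [ravg_ode] says [1 + beta * logder (ravg beta 1 T) = 1 / V] with [V] as in [ravg_quotient_disk],
    so the disk found there is precisely positivity of the new [logder]. *)
Lemma ravg_convex_derivative beta T : 0 < beta -> convex_derivative T -> convex_derivative (ravg beta 1 T).
Proof.
  intros Hb HC. pose proof (ravg_quotient_disk beta T Hb HC) as HV. destruct HC as [HT Hq].
  split; [apply ravg_hol; assumption|]. intros z Hz. specialize (HV z Hz). destruct (Hq z Hz) as [Hn _].
  set (V := (ravg beta 1 T z / T z)%C) in *.
  assert (HV2 : Cmod V ^ 2 < Re V).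
  { pose proof (Cmod_half_disk V) as E. pose proof (Cmod_ge_0 (2 * V - 1)). nra. }
  assert (HVn : V <> 0%C). { intros E. rewrite E in HV2. rewrite Cmod_0 in HV2. simpl in HV2. lra. }
  assert (HWn : ravg beta 1 T z <> 0%C). { intros E. apply HVn. unfold V. rewrite E. field. exact Hn. }
  split; [exact HWn|].
  assert (E : (1 + RtoC beta * logder (ravg beta 1 T) z)%C = (RtoC 1 / V)%C).
  { pose proof (ravg_ode beta 1 T z Hb HT Hz) as E. simpl INR in E. unfold V, logder.
    replace (RtoC 1 / (ravg beta 1 T z / T z))%C with (T z / ravg beta 1 T z)%C by (field; auto).
    rewrite E at 1. rewrite RtoC_plus, RtoC_mult. field. exact HWn. }
  apply (f_equal Re) in E. rewrite Re_div_real, re_plus, re_scal_l in E by exact HVn.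
  assert (Hv : 0 < Cmod V ^ 2) by (apply pow_lt, Cmod_gt_0, HVn).
  assert (1 < 1 * Re V / Cmod V ^ 2).
  { apply (Rmult_lt_reg_r (Cmod V ^ 2)); [exact Hv|]. unfold Rdiv. rewrite Rmult_assoc, Rinv_l by lra. lra. }
  rewrite <- E in H. simpl (Re (RtoC 1)) in H. nra.
Qed.

(* With [W = ravg beta 1], the quotient [R = W E / W T] satisfies [R + z R' / Q = E / T], where
   [Q = T / (beta W T)] has positive real part. *)
Lemma ravg_ratio_pos beta T E : 0 < beta -> convex_derivative T -> hol 1 E ->
  (forall z, Cmod z < 1 -> 0 < Re (E z / T z)%C) ->
  forall z, Cmod z < 1 -> 0 < Re (ravg beta 1 E z / ravg beta 1 T z)%C.
Proof.
  intros Hb HC HE HR. pose proof (ravg_convex_derivative beta T Hb HC) as HC1. destruct HC as [HT Hq]. destruct HC1 as [HT1 Hq1].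
  assert (HE1 : hol 1 (ravg beta 1 E)) by (apply ravg_hol; assumption).
  assert (HQ : forall z, Cmod z < 1 -> (T z / (RtoC beta * ravg beta 1 T z) = RtoC (/ beta) + logder (ravg beta 1 T) z)%C).
  { intros z Hz. destruct (Hq1 z Hz) as [Hn _]. pose proof (ravg_ode beta 1 T z Hb HT Hz) as E0. simpl INR in E0.
    unfold logder. rewrite E0 at 1. rewrite RtoC_plus, RtoC_mult, RtoC_inv by lra. field.
    split; [exact Hn|apply RtoC_neq_0; lra]. }
  apply (Re_ode_pos (fun z => ravg beta 1 E z / ravg beta 1 T z)%C (fun z => T z / (RtoC beta * ravg beta 1 T z))%C).
  - intros z Hz. specialize (HE1 z Hz). specialize (HT1 z Hz). apply (cdiff_div (ravg beta 1 E) (ravg beta 1 T)); try assumption. apply Hq1, Hz.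
  - intros z Hz. rewrite HQ by exact Hz. rewrite re_plus. destruct (Hq1 z Hz) as [_ Hp].
    assert (0 < / beta) by (apply Rinv_0_lt_compat, Hb). simpl (Re (RtoC (/ beta))). lra.
  - intros z Hz. specialize (HR z Hz). destruct (Hq z Hz) as [Hn _]. destruct (Hq1 z Hz) as [Hn1 _].
    assert (EV : C_derive (fun z => ravg beta 1 E z / ravg beta 1 T z)%C z =
      ((C_derive (ravg beta 1 E) z * ravg beta 1 T z - ravg beta 1 E z * C_derive (ravg beta 1 T) z) / (ravg beta 1 T z * ravg beta 1 T z))%C).
    { apply cderiv_unique. apply cderiv_div; [apply (hol_derive 1); assumption|apply (hol_derive 1); assumption|exact Hn1]. }
    rewrite EV. pose proof (ravg_ode beta 1 T z Hb HT Hz) as E0. pose proof (ravg_ode beta 1 E z Hb HE Hz) as E1.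
    simpl INR in E0, E1.
    replace (ravg beta 1 E z / ravg beta 1 T z + z * ((C_derive (ravg beta 1 E) z * ravg beta 1 T z - ravg beta 1 E z * C_derive (ravg beta 1 T) z) / (ravg beta 1 T z * ravg beta 1 T z)) / (T z / (RtoC beta * ravg beta 1 T z)))%C
      with (E z / T z)%C; [exact HR|].
    assert (Hb0 : RtoC beta <> 0%C) by (apply RtoC_neq_0; lra).
    set (e := ravg beta 1 E z) in *. set (w := ravg beta 1 T z) in *.
    set (e' := C_derive (ravg beta 1 E) z) in *. set (w' := C_derive (ravg beta 1 T) z) in *.
    assert (Ew : (RtoC beta * z * w')%C = (T z - RtoC (1 + beta * 1) * w)%C) by (rewrite E0; ring).
    assert (Ee : (RtoC beta * z * e')%C = (E z - RtoC (1 + beta * 1) * e)%C) by (rewrite E1; ring).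
    replace (e / w + z * ((e' * w - e * w') / (w * w)) / (T z / (RtoC beta * w)))%C
      with ((e * T z + (RtoC beta * z * e') * w - e * (RtoC beta * z * w')) / (w * T z))%C by (field; auto).
    rewrite Ew, Ee. field. auto.
Qed.

(** Adding [e * T] to [E] shifts both quotients by [e], which turns the weak inequality into the
    strict one. *)
Lemma ravg_ratio_nonneg beta T E : 0 < beta -> convex_derivative T -> hol 1 E ->
  (forall z, Cmod z < 1 -> 0 <= Re (E z / T z)%C) ->
  forall z, Cmod z < 1 -> 0 <= Re (ravg beta 1 E z / ravg beta 1 T z)%C.
Proof.
  intros Hb HC HE HR z Hz. apply Rnot_lt_le. intros L.
  set (e := - Re (ravg beta 1 E z / ravg beta 1 T z)%C).
  assert (He : 0 < e) by (unfold e; lra).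
  assert (HeT : hol 1 (fun u => RtoC e * T u)%C) by (intros u Hu; pose proof (proj1 HC u Hu); apply (cdiff_mult (fun _ => RtoC e) T); ch).
  assert (P : 0 < Re (ravg beta 1 (fun u => E u + RtoC e * T u)%C z / ravg beta 1 T z)%C).
  { apply ravg_ratio_pos; try assumption.
    - intros u Hu. apply (cdiff_plus E (fun u => RtoC e * T u)%C); [apply HE, Hu|apply HeT, Hu].
    - intros u Hu. specialize (HR u Hu). replace ((E u + RtoC e * T u) / T u)%C with (E u / T u + RtoC e)%C
        by (field; apply HC, Hu). rewrite re_plus. simpl (Re (RtoC e)). lra. }
  rewrite ravg_plus, ravg_scal in P; try assumption; [|apply HC].
  replace ((ravg beta 1 E z + RtoC e * ravg beta 1 T z) / ravg beta 1 T z)%C with (ravg beta 1 E z / ravg beta 1 T z + RtoC e)%C in P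
    by (field; apply (ravg_convex_derivative beta T Hb HC); exact Hz).
  rewrite re_plus in P. simpl (Re (RtoC e)) in P. unfold e in P. lra.
Qed.

(** * Subordination *)

Fixpoint ravg_iter (beta : R) (k m : nat) (g : C -> C) : C -> C :=
  match m with
  | O => g
  | S m' => ravg beta k (ravg_iter beta k m' g)
  end.

Lemma ravg_iter_hol beta k m g : 0 < beta -> hol 1 g -> hol 1 (ravg_iter beta k m g).
Proof. intros Hb Hg. induction m as [|m IH]; simpl; [exact Hg|]. apply ravg_hol; assumption. Qed.

Lemma ravg_iter_ext beta k m g h z : 0 < beta -> (forall u, Cmod u <= Cmod z -> g u = h u) ->
  ravg_iter beta k m g z = ravg_iter beta k m h z.
Proof.
  intros Hb. revert z. induction m as [|m IH]; intros z E; simpl.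
  - apply E. lra.
  - apply ravg_ext; [exact Hb|]. intros u Hu. apply IH. intros v Hv. apply E. lra.
Qed.

Lemma ravg_dilate beta k g u z : ravg beta k (fun v => g (u * v)%C) z = ravg beta k g (u * z)%C.
Proof.
  apply Cint_ext; [lra|]. intros t _. do 2 f_equal. ring.
Qed.

Lemma ravg_iter_dilate beta k m g u z : 0 < beta -> ravg_iter beta k m (fun v => g (u * v)%C) z = ravg_iter beta k m g (u * z)%C.
Proof.
  intros Hb. revert z. induction m as [|m IH]; intros z; simpl; [reflexivity|].
  rewrite <- ravg_dilate. apply ravg_ext; [exact Hb|]. intros v _. apply IH.
Qed.

Lemma ravg_iter_C_derive beta m g z : 0 < beta -> hol 1 g -> Cmod z < 1 ->
  C_derive (ravg_iter beta 0 m g) z = ravg_iter beta 1 m (C_derive g) z.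
Proof.
  intros Hb Hg. revert z. induction m as [|m IH]; intros z Hz; simpl; [reflexivity|].
  rewrite ravg_C_derive; [|exact Hb|apply ravg_iter_hol; assumption|exact Hz].
  apply ravg_ext; [exact Hb|]. intros u Hu. apply IH. lra.
Qed.

Lemma ravg_mult_id beta E z : 0 < beta -> hol 1 E -> Cmod z < 1 ->
  ravg beta 0 (fun u => u * E u)%C z = (z * ravg beta 1 E z)%C.
Proof.
  intros Hb HE Hz. unfold ravg. rewrite <- Cint_scal; [|lra|apply ravg_cts; assumption].
  apply Cint_ext; [lra|]. intros t _. simpl pow. rewrite Rmult_1_r. ring.
Qed.

(** A factor [u] passes through the average by raising its weight from 0 to 1. That is also the
    weight acquired by the derivative of an average, so the difference factor [E] and the derivative
    of the majorant undergo the same operator and their quotient can be followed. *)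
Lemma ravg_iter_difference beta m g p E z : 0 < beta -> hol 1 g -> hol 1 E ->
  (forall u, Cmod u < 1 -> p u = (g u - u * E u)%C) -> Cmod z < 1 ->
  ravg_iter beta 0 m p z = (ravg_iter beta 0 m g z - z * ravg_iter beta 1 m E z)%C.
Proof.
  intros Hb Hg HE Hp. revert z. induction m as [|m IH]; intros z Hz; simpl; [apply Hp, Hz|].
  assert (H1 : hol 1 (ravg_iter beta 0 m g)) by (apply ravg_iter_hol; assumption).
  assert (H2 : hol 1 (ravg_iter beta 1 m E)) by (apply ravg_iter_hol; assumption).
  rewrite <- (ravg_mult_id beta (ravg_iter beta 1 m E)) by assumption.
  rewrite <- ravg_minus; try assumption.
  - apply ravg_ext; [exact Hb|]. intros u Hu. apply IH. lra.
  - intros u Hu. specialize (H2 u Hu). ch.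
Qed.

Lemma ravg_iter_Re_pos beta m g : 0 < beta -> hol 1 g -> (forall u, Cmod u < 1 -> 0 < Re (g u)) ->
  forall z, Cmod z < 1 -> 0 < Re (ravg_iter beta 0 m g z).
Proof.
  intros Hb Hg Hp. induction m as [|m IH]; simpl; [exact Hp|].
  intros z Hz. apply Wop0_Re_pos; try assumption. apply ravg_iter_hol; assumption.
Qed.

Lemma ravg_iter_convex_derivative beta m T : 0 < beta -> convex_derivative T -> convex_derivative (ravg_iter beta 1 m T).
Proof. intros Hb HT. induction m as [|m IH]; simpl; [exact HT|]. apply ravg_convex_derivative; assumption. Qed.

Lemma ravg_iter_ratio_pos beta m T E : 0 < beta -> convex_derivative T -> hol 1 E ->
  (forall z, Cmod z < 1 -> 0 < Re (E z / T z)%C) ->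
  forall z, Cmod z < 1 -> 0 < Re (ravg_iter beta 1 m E z / ravg_iter beta 1 m T z)%C.
Proof.
  intros Hb HT HE HR. induction m as [|m IH]; simpl; [exact HR|].
  apply ravg_ratio_pos; try assumption; [apply ravg_iter_convex_derivative|apply ravg_iter_hol]; assumption.
Qed.

Lemma ravg_iter_ratio_nonneg beta m T E : 0 < beta -> convex_derivative T -> hol 1 E ->
  (forall z, Cmod z < 1 -> 0 <= Re (E z / T z)%C) ->
  forall z, Cmod z < 1 -> 0 <= Re (ravg_iter beta 1 m E z / ravg_iter beta 1 m T z)%C.
Proof.
  intros Hb HT HE HR. induction m as [|m IH]; simpl; [exact HR|].
  apply ravg_ratio_nonneg; try assumption; [apply ravg_iter_convex_derivative|apply ravg_iter_hol]; assumption.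
Qed.

(** The real part is half the derivative at 0 of the squared distance from [L (gam t)] to [v]. *)
Lemma nearest_point_direction (L : C -> C) (v zs l d : C) (gam : R -> C) :
  cderiv L zs l -> gam 0 = zs -> rderiv gam 0 d ->
  (forall t, -1 < t <= 0 -> Cmod (L zs - v) <= Cmod (L (gam t) - v)) ->
  Re (Cconj (L zs - v) * l * d)%C <= 0.
Proof.
  intros HL H0 Hd Hmin.
  assert (D : rderiv (fun t => L (gam t) - v)%C 0 (l * d - 0)%C).
  { apply (rderiv_minus (fun t => L (gam t)) (fun _ => v)); [|apply rderiv_const].
    apply (rderiv_comp L gam); [rewrite H0; exact HL|exact Hd]. }
  set (F := fun t => (L (gam t) - v)%C) in *. destruct D as [D1 D2].
  pose proof (is_derive_plus (K := R_AbsRing) (V := R_NormedModule) _ _ _ _ _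
    (is_derive_Rmult _ _ _ _ _ D1 D1) (is_derive_Rmult _ _ _ _ _ D2 D2)) as D3.
  apply derive_left_min in D3.
  - unfold F in D3. rewrite H0 in D3. unfold plus in D3; simpl in D3. unfold Re, Im in *. simpl in *. lra.
  - intros t Ht. specialize (Hmin t ltac:(lra)). change (Cmod (L zs - v) <= Cmod (F t)) in Hmin.
    replace (L zs - v)%C with (F 0) in Hmin by (unfold F; rewrite H0; reflexivity).
    assert (K0 : Cmod (F 0) ^ 2 <= Cmod (F t) ^ 2) by (apply pow_incr; split; [apply Cmod_ge_0|exact Hmin]).
    rewrite !Cmod2_alt in K0. clearbody F. unfold plus; simpl. unfold Re, Im in *. lra.
Qed.

(* A nearest point of [L (closed disk)] to [v] lies on the boundary curve, with [v] on the outer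
   normal, unless the distance is zero. *)
Lemma value_in_closed_disk (L : C -> C) (v : C) (r : R) : 0 < r < 1 -> hol 1 L ->
  (forall z, Cmod z < 1 -> C_derive L z <> 0%C) ->
  (forall z, Cmod z = r -> 0 <= Re ((L z - v) / (z * C_derive L z))%C) ->
  exists z, Cmod z <= r /\ L z = v.
Proof.
  intros Hr HL HT Hsup.
  destruct (disk_min r (fun z => Cmod (L z - v))) as (zs & Hzs & Hmin); [lra| |].
  { intros z Hz. apply (cont_Cmod (fun z => L z - v)%C). apply cont_Cminus; [|apply continuous_const].
    apply cdiff_cont, HL. lra. }
  exists zs. split; [exact Hzs|]. apply NNPP. intros Hne.
  assert (Hd : (L zs - v)%C <> 0%C) by (apply Csub_neq_0, Hne).
  set (d0 := (L zs - v)%C) in *. pose proof (HT zs ltac:(lra)) as HTz.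
  pose proof (hol_derive 1 L zs HL ltac:(lra)) as HD. set (l := C_derive L zs) in *.
  pose proof (Cconj_neq_0 _ Hd) as Hdc.
  destruct (Rle_lt_or_eq_dec _ _ Hzs) as [Lt|Eq].
  - set (q := (Cconj d0 * l)%C). assert (Hq : q <> 0%C) by (apply Cmult_neq_0; assumption).
    pose proof (proj1 (Cmod_gt_0 q) Hq) as Hqm.
    (* Scaled so that the straight path stays in the disk of radius [r] while [-1 < t <= 0]. Its
       direction makes the squared distance decrease strictly. *)
    set (s := (r - Cmod zs) / Cmod q). assert (Hs : 0 < s) by (apply Rdiv_lt_0_compat; lra).
    assert (K0 : Re (Cconj d0 * l * (RtoC s * Cconj q))%C <= 0).
    { apply (nearest_point_direction L v zs l _ (fun t => zs + RtoC t * (RtoC s * Cconj q))%C HD).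
      - ring.
      - eapply rderiv_eq.
        + apply (rderiv_plus (fun _ => zs) (fun t => RtoC t * (RtoC s * Cconj q))%C); [apply rderiv_const|].
          apply (rderiv_mult (fun t => RtoC t) (fun _ => RtoC s * Cconj q)%C); [apply rderiv_RtoC, (is_derive_id (K := R_AbsRing))|apply rderiv_const].
        + change (RtoC one) with (RtoC 1). ring.
      - intros t Ht. apply Hmin. apply Rle_trans with (1 := Cmod_triangle _ _).
        rewrite !Cmod_mult, Cmod_conj, !Cmod_R, (Rabs_pos_eq s) by lra.
        replace (s * Cmod q) with (r - Cmod zs) by (unfold s; field; lra).
        assert (Rabs t <= 1) by (apply Rabs_le; lra). nra. }
    fold q in K0. replace (q * (RtoC s * Cconj q))%C with (RtoC s * (q * Cconj q))%C in K0 by ring.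
    rewrite <- Cmod2_conj, <- RtoC_mult in K0. simpl in K0. 
    assert (0 < s * (Cmod q * (Cmod q * 1))); [|lra]. apply Rmult_lt_0_compat; [exact Hs|]. nra.
  - assert (Hz0 : zs <> 0%C) by (apply Cmod_gt_0; lra).
    assert (K0 : forall c, 0 <= Re c -> Re (Cconj d0 * l * (zs * c))%C <= 0).
    { intros c Hc. apply (nearest_point_direction L v zs l _ (fun t => zs * Cexp (RtoC t * c))%C HD).
      - replace (RtoC 0 * c)%C with (RtoC 0) by ring. rewrite Cexp_0. ring.
      - assert (D1 : rderiv (fun t => RtoC t * c)%C 0 (RtoC 1 * c + RtoC 0 * 0)%C).
        { apply (rderiv_mult (fun t => RtoC t) (fun _ => c)); [apply rderiv_RtoC, (is_derive_id (K := R_AbsRing))|apply rderiv_const]. }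
        pose proof (rderiv_comp Cexp (fun t => RtoC t * c)%C 0 _ _ (cderiv_Cexp _) D1) as D2.
        pose proof (rderiv_mult _ _ _ _ _ (rderiv_const zs 0) D2) as D3. cbv beta in D3.
        apply (rderiv_eq _ _ _ _ D3). replace (RtoC 0 * c)%C with (RtoC 0) by ring. rewrite Cexp_0. ring.
      - intros t Ht. apply Hmin. rewrite Cmod_mult, Cmod_Cexp.
        replace (Re (RtoC t * c)%C) with (t * Re c) by (unfold Re; simpl; ring).
        assert (exp (t * Re c) <= 1). { rewrite <- exp_0. apply exp_le_compat. nra. }
        pose proof (Cmod_ge_0 zs). nra. }
    set (q := (zs * l)%C) in *. assert (Hq : q <> 0%C) by (apply Cmult_neq_0; assumption).
    pose proof (Cconj_neq_0 _ Hq) as Hqc.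
    (* The directions 1, [Ci] and [- Ci] make [Cconj d0 * q] real and nonpositive, while [Hsup]
       makes its real part nonnegative; so it vanishes, against [d0 <> 0] and [q <> 0]. *)
    pose proof (K0 1%C ltac:(simpl; lra)) as K1. pose proof (K0 Ci ltac:(simpl; lra)) as K2.
    pose proof (K0 (- Ci)%C ltac:(simpl; lra)) as K3.
    replace (Cconj d0 * l * (zs * 1))%C with (Cconj d0 * q)%C in K1 by (unfold q; ring).
    replace (Cconj d0 * l * (zs * Ci))%C with (Cconj d0 * q * Ci)%C in K2 by (unfold q; ring).
    replace (Cconj d0 * l * (zs * - Ci))%C with (- (Cconj d0 * q * Ci))%C in K3 by (unfold q; ring).
    rewrite re_opp, re_mult_Ci in K3. rewrite re_mult_Ci in K2.
    specialize (Hsup zs Eq). fold l d0 q in Hsup.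
    assert (Hq2 : Cmod q ^ 2 <> 0) by (apply pow_nonzero, Rgt_not_eq, Cmod_gt_0, Hq).
    replace (d0 / q)%C with (Cconj (Cconj d0 * q) * RtoC (/ (Cmod q ^ 2)))%C in Hsup.
    2:{ rewrite RtoC_inv by exact Hq2. rewrite Cmod2_conj, Cmult_conj, Cconj_conj. field. auto. }
    rewrite re_scal_r, re_conj in Hsup.
    assert (0 < / (Cmod q ^ 2)) by (apply Rinv_0_lt_compat, pow_lt, Cmod_gt_0, Hq).
    assert (K4 : Re (Cconj d0 * q)%C = 0) by nra.
    assert (K5 : (Cconj d0 * q)%C = 0%C) by (apply C_ext; [exact K4|simpl Im at 2; lra]).
    revert K5. apply Cmult_neq_0; assumption.
Qed.

(** Replaces an inverse function theorem: a continuous solution of [L (w z) = g z] is differentiable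
    where [L] has a nonzero derivative. It serves both for subordinating functions and for the
    logarithm, with [L = Cexp]. *)
Lemma cderiv_lift (L g w : C -> C) (z l m : C) (d0 : R) : cderiv L (w z) l -> cderiv g z m -> l <> 0%C ->
  ccont w z -> 0 < d0 -> (forall z', Cmod (z' - z) < d0 -> L (w z') = g z') -> cderiv w z (m / l)%C.
Proof.
  intros HDL HDg HTz Hcont Hd0 Hlift. rewrite ccont_eps in Hcont.
  assert (HLw : L (w z) = g z).
  { apply Hlift. replace (z - z)%C with (RtoC 0) by ring. rewrite Cmod_0. exact Hd0. }
  apply cderiv_eps. intros eps He.
  pose proof (proj1 (Cmod_gt_0 l) HTz) as Hl. pose proof (Cmod_ge_0 m) as Hm.
  (* The a priori Lipschitz constant of [w]: since [e1 <= Cmod l / 2], half of [Cmod l * Cmod dw]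
     absorbs the error in [dw]. Inserting this bound again gives the derivative. *)
  set (Cc := 2 * (Cmod m + 1) / Cmod l).
  assert (HCc : 0 < Cc) by (apply Rdiv_lt_0_compat; lra).
  set (e1 := Rmin (Rmin (Cmod l / 2) 1) (eps * Cmod l / (Cc + 1))).
  assert (He1 : 0 < e1).
  { repeat apply Rmin_pos; try lra. apply Rdiv_lt_0_compat; [|lra]. apply Rmult_lt_0_compat; lra. }
  assert (He1a : e1 <= Cmod l / 2) by (eapply Rle_trans; apply Rmin_l).
  assert (He1b : e1 <= 1) by (eapply Rle_trans; [apply Rmin_l|apply Rmin_r]).
  assert (He1c : e1 <= eps * Cmod l / (Cc + 1)) by apply Rmin_r. clearbody e1.
  destruct (proj1 (cderiv_eps _ _ _) HDL e1 He1) as (d1 & Hd1 & K1).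
  destruct (proj1 (cderiv_eps _ _ _) HDg e1 He1) as (d2 & Hd2 & K2).
  destruct (Hcont d1 Hd1) as (d3 & Hd3 & K3).
  exists (Rmin (Rmin d2 d3) d0). split; [repeat apply Rmin_pos; lra|]. intros z' Hz'.
  assert (Hb2 : Cmod (z' - z) < d2) by (eapply Rlt_le_trans; [exact Hz'|]; eapply Rle_trans; apply Rmin_l).
  assert (Hb3 : Cmod (z' - z) < d3) by (eapply Rlt_le_trans; [exact Hz'|]; eapply Rle_trans; [apply Rmin_l|apply Rmin_r]).
  assert (Hb4 : Cmod (z' - z) < d0) by (eapply Rlt_le_trans; [exact Hz'|]; apply Rmin_r).
  pose proof (Hlift z' Hb4) as HLw'. specialize (K3 z' Hb3). specialize (K1 _ K3). specialize (K2 z' Hb2).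
  rewrite HLw, HLw' in K1. set (dw := (w z' - w z)%C) in *. set (dz := (z' - z)%C) in *.
  set (dg := (g z' - g z)%C) in *.
  assert (K4 : Cmod (dw * l - dz * m) <= e1 * Cmod dw + e1 * Cmod dz).
  { replace (dw * l - dz * m)%C with ((dg - dz * m) + - (dg - dw * l))%C by ring.
    apply Rle_trans with (1 := Cmod_triangle _ _). rewrite Cmod_opp. lra. }
  pose proof (Cmod_ge_0 dw) as Hdw. pose proof (Cmod_ge_0 dz) as Hdz.
  assert (K5 : Cmod dw <= Cc * Cmod dz).
  { assert (T : Cmod dw * Cmod l <= Cmod (dw * l - dz * m) + Cmod dz * Cmod m).
    { rewrite <- !Cmod_mult. pose proof (Cmod_triangle (dw * l - dz * m) (dz * m)) as T.
      replace (dw * l - dz * m + dz * m)%C with (dw * l)%C in T by ring. exact T. }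
    apply (Rmult_le_reg_r (Cmod l)); [exact Hl|].
    replace (Cc * Cmod dz * Cmod l) with (2 * (Cmod m + 1) * Cmod dz) by (unfold Cc; field; lra).
    assert (e1 * Cmod dw <= Cmod l / 2 * Cmod dw) by (apply Rmult_le_compat_r; assumption).
    assert (e1 * Cmod dz <= 1 * Cmod dz) by (apply Rmult_le_compat_r; assumption). nra. }
  replace (dw - dz * (m / l))%C with ((dw * l - dz * m) / l)%C by (field; exact HTz).
  rewrite Cmod_div by exact HTz. apply (Rmult_le_reg_r (Cmod l)); [exact Hl|].
  unfold Rdiv at 1. rewrite Rmult_assoc, Rinv_l, Rmult_1_r by lra.
  apply Rle_trans with (1 := K4).
  apply Rle_trans with (e1 * (Cc + 1) * Cmod dz); [nra|].
  apply (Rmult_le_compat_r (Cc + 1)) in He1c; [|lra].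
  replace (eps * Cmod l / (Cc + 1) * (Cc + 1)) with (eps * Cmod l) in He1c by (field; lra). nra.
Qed.

(** Only continuity has to be supplied to [cderiv_lift]. For [z'] near [z] the values [w z'] stay in
    a closed disk of radius below 1, and there injectivity and compactness keep [L u] away from
    [g z] as long as [u] stays away from [w z]. *)
Lemma holomorphic_lift (L g w : C -> C) : hol 1 L -> hol 1 g ->
  (forall z, Cmod z < 1 -> C_derive L z <> 0%C) ->
  (forall z1 z2, Cmod z1 < 1 -> Cmod z2 < 1 -> L z1 = L z2 -> z1 = z2) ->
  (forall z, Cmod z < 1 -> Cmod (w z) <= Cmod z /\ L (w z) = g z) -> hol 1 w.
Proof.
  intros HL Hg HT Hinj Hw z Hz. destruct (Hw z Hz) as [Hwz HLw].
  pose proof (hol_derive 1 L (w z) HL ltac:(lra)) as HDL. pose proof (hol_derive 1 g z Hg Hz) as HDg.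
  pose proof (HT (w z) ltac:(lra)) as HTz. set (l := C_derive L (w z)) in *. set (m := C_derive g z) in *.
  set (rho := (Cmod z + 1) / 2).
  assert (Hcont : forall eps, 0 < eps -> exists d, 0 < d /\ forall z', Cmod (z' - z) < d -> Cmod (w z' - w z) < eps).
  { intros eps He.
    destruct (disk_compact rho (fun u d => eps <= Cmod (u - w z) -> d <= Cmod (L u - g z))) as (d & Hd & HB).
    - intros u d d' K1 K2 K3. specialize (K1 K3). lra.
    - intros u Hu. assert (Hu1 : Cmod u < 1) by (unfold rho in Hu; lra).
      destruct (classic (u = w z)) as [->|Hne].
      + exists eps. split; [exact He|]. intros u' K1 K2. lra.
      + assert (HLu : (L u - g z)%C <> 0%C).
        { apply Csub_neq_0. intros E. apply Hne. apply Hinj; [exact Hu1|lra|]. rewrite E, HLw. reflexivity. }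
        apply Cmod_gt_0 in HLu. set (e := Cmod (L u - g z)) in *.
        destruct (proj1 (ccont_eps L u) (cdiff_cont L u (HL u Hu1)) (e / 2)) as (d & Hd & K1); [lra|].
        exists (Rmin d (e / 2)). split; [apply Rmin_pos; lra|]. intros u' K2 _.
        pose proof (Rmin_l d (e / 2)). pose proof (Rmin_r d (e / 2)). specialize (K1 u' ltac:(lra)).
        pose proof (Cmod_triangle (L u' - g z) (L u - L u')) as T.
        replace (L u' - g z + (L u - L u'))%C with (L u - g z)%C in T by ring. fold e in T.
        rewrite Cmod_sub_sym in K1. lra.
    - destruct (proj1 (ccont_eps g z) (cdiff_cont g z (Hg z Hz)) d Hd) as (d1 & Hd1 & K1).
      exists (Rmin d1 ((1 - Cmod z) / 2)). split; [apply Rmin_pos; lra|]. intros z' Hz'.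
      pose proof (Rmin_l d1 ((1 - Cmod z) / 2)). pose proof (Rmin_r d1 ((1 - Cmod z) / 2)).
      assert (Hz1 : Cmod z' <= rho).
      { replace z' with (z + (z' - z))%C by ring. apply Rle_trans with (1 := Cmod_triangle _ _). unfold rho. lra. }
      destruct (Hw z') as [Hw1 Hw2]; [unfold rho in Hz1; lra|].
      apply Rnot_le_lt. intros K2. specialize (HB (w z') ltac:(lra) K2). rewrite Hw2 in HB.
      specialize (K1 z' ltac:(lra)). lra. }
  exists (m / l)%C. apply (cderiv_lift L g w z l m (1 - Cmod z)); try assumption; [apply ccont_eps, Hcont|lra|].
  intros z' Hz'. apply Hw. replace z' with (z + (z' - z))%C by ring.
  apply Rle_lt_trans with (1 := Cmod_triangle _ _). lra.
Qed.

(** * The maps [L0] and subordination to their averages *)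

Lemma Cmod_bz (b : R) (z : C) : -1 <= b <= 1 -> Cmod z < 1 -> Cmod (RtoC b * z) < 1.
Proof.
  intros Hb Hz. rewrite Cmod_mult, Cmod_R. pose proof (Cmod_ge_0 z).
  assert (Rabs b <= 1) by (apply Rabs_le; lra). pose proof (Rabs_pos b). nra.
Qed.

Lemma one_plus_neq_0 (c : C) : Cmod c < 1 -> (1 + c)%C <> 0%C.
Proof.
  intros Hc E. assert (c = - (1))%C by (replace c with (1 + c - 1)%C by ring; rewrite E; ring).
  subst c. rewrite Cmod_opp, Cmod_1 in Hc. lra.
Qed.

Lemma L0_hol a b : -1 <= b <= 1 -> hol 1 (L0 a b).
Proof.
  intros Hb z Hz. unfold L0. ch. apply one_plus_neq_0, Cmod_bz; assumption.
Qed.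

Lemma L0_derive a b z : -1 <= b <= 1 -> Cmod z < 1 ->
  C_derive (L0 a b) z = (RtoC (a - b) / ((1 + RtoC b * z) * (1 + RtoC b * z)))%C.
Proof.
  intros Hb Hz. apply cderiv_unique. pose proof (one_plus_neq_0 _ (Cmod_bz b z Hb Hz)) as Hn.
  unfold L0. eapply cderiv_eq.
  - apply (cderiv_div (fun z => 1 + RtoC a * z)%C (fun z => 1 + RtoC b * z)%C); [| |exact Hn].
    + apply cderiv_plus; [apply cderiv_const|apply cderiv_linear].
    + apply cderiv_plus; [apply cderiv_const|apply cderiv_linear].
  - rewrite RtoC_minus. field. exact Hn.
Qed.

Definition L0_prime (a b : R) (z : C) : C := (RtoC (a - b) / ((1 + RtoC b * z) * (1 + RtoC b * z)))%C.

(** With [c = b * z] the quantity [logder] reduces to [(1 - c) / (1 + c)], which maps the open unit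
    disk into the right half plane. *)
Lemma L0_prime_convex_derivative a b : -1 <= b -> b < a -> a <= 1 -> convex_derivative (L0_prime a b).
Proof.
  intros H1 H2 H3. assert (Hb : -1 <= b <= 1) by lra. split.
  - intros z Hz. pose proof (one_plus_neq_0 _ (Cmod_bz b z Hb Hz)) as Hn. unfold L0_prime. ch.
    apply Cmult_neq_0; assumption.
  - intros z Hz. pose proof (Cmod_bz b z Hb Hz) as Hc. pose proof (one_plus_neq_0 _ Hc) as Hn.
    assert (Hab : RtoC (a - b) <> 0%C) by (apply RtoC_neq_0; lra).
    assert (E : C_derive (L0_prime a b) z = (- RtoC (a - b) * (2 * RtoC b) / ((1 + RtoC b * z) * (1 + RtoC b * z) * (1 + RtoC b * z)))%C).
    { apply cderiv_unique. unfold L0_prime. eapply cderiv_eq.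
      - assert (D : cderiv (fun z => 1 + RtoC b * z)%C z (0 + RtoC b)%C) by (apply cderiv_plus; [apply cderiv_const|apply cderiv_linear]).
        apply (cderiv_div (fun _ => RtoC (a - b)) (fun z => (1 + RtoC b * z) * (1 + RtoC b * z))%C);
          [apply cderiv_const|apply cderiv_mult; exact D|apply Cmult_neq_0; assumption].
      - cbv beta. field. exact Hn. }
    split.
    + unfold L0_prime. apply Cmult_neq_0; [exact Hab|]. apply Cmod_gt_0. rewrite Cmod_inv by (apply Cmult_neq_0; assumption).
      apply Rinv_0_lt_compat, Cmod_gt_0, Cmult_neq_0; assumption.
    + unfold logder. rewrite E. unfold L0_prime. set (c := (RtoC b * z)%C) in *.
      assert (E1 : (1 + z * (- RtoC (a - b) * (2 * RtoC b) / ((1 + c) * (1 + c) * (1 + c))) / (RtoC (a - b) / ((1 + c) * (1 + c))) = (1 - c) / (1 + c))%C).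
      { replace (z * (- RtoC (a - b) * (2 * RtoC b) / ((1 + c) * (1 + c) * (1 + c))))%C
          with (- RtoC (a - b) * (2 * c) / ((1 + c) * (1 + c) * (1 + c)))%C by (unfold c; field; exact Hn).
        field. auto. }
      rewrite E1. replace ((1 - c) / (1 + c))%C with ((1 - c) * Cconj (1 + c) * RtoC (/ Cmod (1 + c) ^ 2))%C.
      2:{ rewrite RtoC_inv by (apply pow_nonzero, Rgt_not_eq, Cmod_gt_0, Hn). rewrite Cmod2_conj.
          pose proof (Cconj_neq_0 _ Hn). field. auto. }
      rewrite re_scal_r. apply Rmult_lt_0_compat; [|apply Rinv_0_lt_compat, pow_lt, Cmod_gt_0, Hn].
      assert (Hc2 : Cmod c ^ 2 < 1) by (pose proof (Cmod_ge_0 c); nra).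
      rewrite Cmod2_alt in Hc2. destruct c as [x y]. simpl in *. unfold Re, Im in *. simpl in *. nra.
Qed.

(** This is the quotient [E / L0_prime] of [Lm_difference], with [u = v z] and [c = b * z]. After
    clearing the denominator its real part is a sum of three nonnegative products; for [u <> 1] the
    first is positive when [Cmod u < 1] and the second when [Cmod u = 1]. *)
Lemma subordination_kernel_nonneg (u c : C) : Cmod u <= 1 -> Cmod c < 1 ->
  0 <= Re ((1 - u) * (1 + c) / (1 + c * u))%C /\ (u <> 1%C -> 0 < Re ((1 - u) * (1 + c) / (1 + c * u))%C).
Proof.
  intros Hu Hc. pose proof (Cmod_ge_0 u) as Hu0. pose proof (Cmod_ge_0 c) as Hc0.
  assert (Hcu : Cmod (c * u) < 1) by (rewrite Cmod_mult; nra).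
  pose proof (one_plus_neq_0 _ Hcu) as Hn. pose proof (Cconj_neq_0 _ Hn) as Hnc.
  replace ((1 - u) * (1 + c) / (1 + c * u))%C with ((1 - u) * (1 + c) * Cconj (1 + c * u) * RtoC (/ Cmod (1 + c * u) ^ 2))%C.
  2:{ rewrite RtoC_inv by (apply pow_nonzero, Rgt_not_eq, Cmod_gt_0, Hn). rewrite Cmod2_conj. field. auto. }
  rewrite re_scal_r.
  assert (Hp : 0 < / Cmod (1 + c * u) ^ 2) by (apply Rinv_0_lt_compat, pow_lt, Cmod_gt_0, Hn).
  assert (E : Re ((1 - u) * (1 + c) * Cconj (1 + c * u))%C =
    (1 - Cmod u) * (1 - Cmod c) * (1 - Cmod u * Cmod c) + (Cmod u - Re u) * (1 - Cmod c ^ 2) + (1 - Cmod u ^ 2) * (Re c + Cmod c)).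
  { pose proof (Cmod2_alt u) as E1. pose proof (Cmod2_alt c) as E2.
    set (U := Cmod u) in *. set (K := Cmod c) in *.
    replace ((1 - U) * (1 - K) * (1 - U * K) + (U - Re u) * (1 - K ^ 2) + (1 - U ^ 2) * (Re c + K))
      with (1 - K ^ 2 * U ^ 2 - Re u * (1 - K ^ 2) + Re c * (1 - U ^ 2)) by ring.
    rewrite E1, E2. destruct u as [p q], c as [x y]. unfold Re, Im. simpl. ring. }
  pose proof (re_le_Cmod u) as R1. pose proof (re_le_Cmod c) as R2.
  apply Rabs_le_between in R1. apply Rabs_le_between in R2.
  assert (A1 : 0 <= (1 - Cmod u) * (1 - Cmod c) * (1 - Cmod u * Cmod c)).
  { apply Rmult_le_pos; [apply Rmult_le_pos; lra|]. nra. }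
  assert (A2 : 0 <= (Cmod u - Re u) * (1 - Cmod c ^ 2)) by (apply Rmult_le_pos; nra).
  assert (A3 : 0 <= (1 - Cmod u ^ 2) * (Re c + Cmod c)) by (apply Rmult_le_pos; nra).
  split.
  - apply Rmult_le_pos; [|lra]. rewrite E. lra.
  - intros Hne. apply Rmult_lt_0_compat; [|exact Hp]. rewrite E.
    destruct (Rle_lt_or_eq_dec _ _ Hu) as [Lt|Eq].
    + assert (0 < (1 - Cmod u) * (1 - Cmod c) * (1 - Cmod u * Cmod c)); [|lra].
      apply Rmult_lt_0_compat; [apply Rmult_lt_0_compat; lra|]. nra.
    + assert (0 < (Cmod u - Re u) * (1 - Cmod c ^ 2)); [|lra].
      apply Rmult_lt_0_compat; [|nra]. rewrite Eq.
      assert (Re u <> 1); [|lra]. intros E1. apply Hne. apply C_ext; [exact E1|].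
      pose proof (Cmod2_alt u) as E2. rewrite Eq, E1 in E2. simpl (Im 1). nra.
Qed.

Section Subordination.
Variables (a b beta : R) (m : nat).
Hypothesis Hb1 : -1 <= b.
Hypothesis Hab : b < a.
Hypothesis Ha1 : a <= 1.
Hypothesis Hbeta : 0 < beta.

Let Lm := ravg_iter beta 0 m (L0 a b).
Let Tm := ravg_iter beta 1 m (L0_prime a b).

Lemma Lm_hol : hol 1 Lm.
Proof. apply ravg_iter_hol; [exact Hbeta|]. apply L0_hol. lra. Qed.

Lemma Lm_derive z : Cmod z < 1 -> C_derive Lm z = Tm z.
Proof.
  intros Hz. unfold Lm, Tm. rewrite ravg_iter_C_derive; [|exact Hbeta|apply L0_hol; lra|exact Hz].
  apply ravg_iter_ext; [exact Hbeta|]. intros u Hu. apply L0_derive; lra.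
Qed.

Lemma Tm_convex_derivative : convex_derivative Tm.
Proof. apply ravg_iter_convex_derivative; [exact Hbeta|]. apply L0_prime_convex_derivative; assumption. Qed.

(* [L0 z - L0 (z v) = z E z] with [Re (E / L0') >= 0]; both properties survive the averaging. *)
Lemma Lm_difference (v p : C -> C) : hol 1 v -> (forall z, Cmod z < 1 -> Cmod (v z) <= 1) ->
  (forall z, Cmod z < 1 -> p z = L0 a b (z * v z)%C) ->
  forall z, Cmod z < 1 -> z <> 0%C ->
    0 <= Re ((Lm z - ravg_iter beta 0 m p z) / (z * C_derive Lm z))%C /\
    ((forall z, Cmod z < 1 -> v z <> 1%C) -> 0 < Re ((Lm z - ravg_iter beta 0 m p z) / (z * C_derive Lm z))%C).
Proof.
  intros Hv Hv1 Hp z Hz Hz0.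
  assert (Hbz : forall u, Cmod u < 1 -> (1 + RtoC b * u)%C <> 0%C) by (intros u Hu; apply one_plus_neq_0, Cmod_bz; lra).
  assert (Hzv : forall u, Cmod u < 1 -> Cmod (u * v u) < 1).
  { intros u Hu. specialize (Hv1 u Hu). rewrite Cmod_mult. pose proof (Cmod_ge_0 u). pose proof (Cmod_ge_0 (v u)). nra. }
  pose (E := fun u => (RtoC (a - b) * (1 - v u) / ((1 + RtoC b * u) * (1 + RtoC b * (u * v u))))%C).
  assert (HE : hol 1 E).
  { intros u Hu. specialize (Hv u Hu). unfold E. ch. apply Cmult_neq_0; auto. }
  assert (Hdiff : forall u, Cmod u < 1 -> p u = (L0 a b u - u * E u)%C).
  { intros u Hu. rewrite Hp by exact Hu. unfold L0, E. pose proof (Hbz u Hu). pose proof (Hbz _ (Hzv u Hu)).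
    rewrite RtoC_minus. field. auto. }
  assert (Hratio : forall u, Cmod u < 1 -> (E u / L0_prime a b u = (1 - v u) * (1 + RtoC b * u) / (1 + RtoC b * u * v u))%C).
  { intros u Hu. unfold E, L0_prime. pose proof (Hbz u Hu). pose proof (Hbz _ (Hzv u Hu)) as Hn2.
    replace (RtoC b * (u * v u))%C with (RtoC b * u * v u)%C in * by ring.
    assert (RtoC (a - b) <> 0%C) by (apply RtoC_neq_0; lra). field. auto. }
  rewrite (ravg_iter_difference beta m (L0 a b) p E z Hbeta (L0_hol a b ltac:(lra)) HE Hdiff Hz).
  rewrite Lm_derive by exact Hz. fold Lm.
  destruct (Tm_convex_derivative) as [_ HTn]. destruct (HTn z Hz) as [HT _].
  replace ((Lm z - (Lm z - z * ravg_iter beta 1 m E z)) / (z * Tm z))%C with (ravg_iter beta 1 m E z / Tm z)%C by (field; auto).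
  split.
  - apply ravg_iter_ratio_nonneg; try assumption; [apply L0_prime_convex_derivative; assumption|]. intros u Hu. rewrite Hratio by exact Hu.
    apply subordination_kernel_nonneg; [apply Hv1, Hu|apply Cmod_bz; lra].
  - intros Hne. apply ravg_iter_ratio_pos; try assumption; [apply L0_prime_convex_derivative; assumption|]. intros u Hu. rewrite Hratio by exact Hu.
    apply subordination_kernel_nonneg; [apply Hv1, Hu|apply Cmod_bz; lra|apply Hne, Hu].
Qed.

(** The strict case of [Lm_difference] for the constant [v = z2 / z1]: the averaged function then
    takes the value [Lm z2] at [z1], so equal values would make a quotient with positive real part
    vanish. *)
Lemma Lm_injective_aux z1 z2 : Cmod z1 < 1 -> Cmod z2 <= Cmod z1 -> Lm z1 = Lm z2 -> z1 = z2.
Proof.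
  intros H1 H2 E. destruct (classic (z1 = 0%C)) as [->|Hz].
  - rewrite Cmod_0 in H2. pose proof (Cmod_ge_0 z2). symmetry. apply Cmod_eq_0. lra.
  - apply NNPP. intros Hne. set (u := (z2 / z1)%C).
    pose proof (proj1 (Cmod_gt_0 z1) Hz) as Hm.
    assert (Hu : Cmod u <= 1).
    { unfold u. rewrite Cmod_div by exact Hz. apply (Rmult_le_reg_r (Cmod z1)); [exact Hm|].
      unfold Rdiv. rewrite Rmult_assoc, Rinv_l by lra. lra. }
    assert (Eu : (u * z1)%C = z2) by (unfold u; field; exact Hz).
    destruct (Lm_difference (fun _ => u) (fun z => L0 a b (u * z)%C)) with (z := z1) as [_ K0]; try assumption.
    + intros z _. apply cdiff_const.
    + intros z _. exact Hu.
    + intros z _. f_equal. ring.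
    + assert (K1 : 0 < Re ((Lm z1 - ravg_iter beta 0 m (fun z => L0 a b (u * z)%C) z1) / (z1 * C_derive Lm z1))%C).
      { apply K0. intros _ _ E1. apply Hne. rewrite <- Eu, E1. ring. }
      rewrite (ravg_iter_dilate beta 0 m (L0 a b) u z1 Hbeta), Eu in K1. fold Lm in K1. rewrite E in K1.
      replace ((Lm z2 - Lm z2) / (z1 * C_derive Lm z1))%C with (RtoC 0) in K1; [simpl in K1; lra|].
      unfold Cdiv. ring.
Qed.

Lemma Lm_injective z1 z2 : Cmod z1 < 1 -> Cmod z2 < 1 -> Lm z1 = Lm z2 -> z1 = z2.
Proof.
  intros H1 H2 E. destruct (Rle_lt_dec (Cmod z2) (Cmod z1)) as [L|L].
  - apply Lm_injective_aux; assumption.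
  - symmetry. apply Lm_injective_aux; [exact H2|lra|symmetry; exact E].
Qed.

(** The averaged value at [z] must be found among the values of [Lm] on the disk of radius [Cmod z].
    For [value_in_closed_disk], each boundary point [y] is handled by the rotation
    [u -> (z / y) * u]: it preserves the hypotheses on [v] and [p] and moves the fixed value from
    [z] to [y]. Injectivity of [Lm] then makes the chosen preimages holomorphic. *)
Lemma averaged_subordination (v p : C -> C) : hol 1 v -> (forall z, Cmod z < 1 -> Cmod (v z) <= 1) ->
  (forall z, Cmod z < 1 -> p z = L0 a b (z * v z)%C) -> hol 1 p ->
  exists w, hol 1 w /\ forall z, Cmod z < 1 -> Cmod (w z) <= Cmod z /\ Lm (w z) = ravg_iter beta 0 m p z.
Proof.
  intros Hv Hv1 Hp Hph.
  assert (HT : forall z, Cmod z < 1 -> C_derive Lm z <> 0%C).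
  { intros z Hz. rewrite Lm_derive by exact Hz. apply Tm_convex_derivative, Hz. }
  assert (Hex : forall z, Cmod z < 1 -> exists y, Cmod y <= Cmod z /\ Lm y = ravg_iter beta 0 m p z).
  { intros z Hz. destruct (classic (z = 0%C)) as [->|Hz0].
    - exists 0%C. split; [lra|]. unfold Lm.
      pose proof (ravg_iter_dilate beta 0 m p 0 0 Hbeta) as E1. pose proof (ravg_iter_dilate beta 0 m (L0 a b) 0 0 Hbeta) as E2.
      replace (0 * 0)%C with (RtoC 0) in E1, E2 by ring. rewrite <- E1, <- E2.
      apply ravg_iter_ext; [exact Hbeta|]. intros u _. replace (0 * u)%C with (RtoC 0) by ring.
      rewrite Hp by (rewrite Cmod_0; lra). f_equal. ring.
    - pose proof (proj1 (Cmod_gt_0 z) Hz0) as Hm.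
      apply (value_in_closed_disk Lm (ravg_iter beta 0 m p z) (Cmod z)); [lra|apply Lm_hol|exact HT|].
      intros y Hy. assert (Hy0 : y <> 0%C) by (apply Cmod_gt_0; lra).
      set (x := (z / y)%C). assert (Ex : (x * y)%C = z) by (unfold x; field; exact Hy0).
      assert (Hx : Cmod x = 1). { unfold x. rewrite Cmod_div, Hy by exact Hy0. field. lra. }
      assert (Hxu : forall u, Cmod (x * u) = Cmod u) by (intros u; rewrite Cmod_mult, Hx; ring).
      destruct (Lm_difference (fun u => x * v (x * u))%C (fun u => p (x * u)%C)) with (z := y) as [K0 _]; try assumption.
      + intros u Hu. assert (Hc : cdiff v (x * u)%C) by (apply Hv; rewrite Hxu; exact Hu).
        apply (cdiff_mult (fun _ => x) (fun u => v (x * u)%C)); [ch|].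
        apply (cdiff_comp v (fun u => x * u)%C); [exact Hc|ch].
      + intros u Hu. rewrite Hxu. apply Hv1. rewrite Hxu. exact Hu.
      + intros u Hu. rewrite Hp by (rewrite Hxu; exact Hu). f_equal. ring.
      + lra.
      + rewrite (ravg_iter_dilate beta 0 m p x y Hbeta), Ex in K0. exact K0. }
  assert (Hex2 : forall z, exists y, Cmod z < 1 -> Cmod y <= Cmod z /\ Lm y = ravg_iter beta 0 m p z).
  { intros z. destruct (classic (Cmod z < 1)) as [L|L].
    - destruct (Hex z L) as [y Hy]. exists y. intros _. exact Hy.
    - exists 0%C. tauto. }
  exists (fun z => proj1_sig (constructive_indefinite_description _ (Hex2 z))).
  assert (Hw : forall z, Cmod z < 1 -> let w := proj1_sig (constructive_indefinite_description _ (Hex2 z)) in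
    Cmod w <= Cmod z /\ Lm w = ravg_iter beta 0 m p z).
  { intros z Hz. exact (proj2_sig (constructive_indefinite_description _ (Hex2 z)) Hz). }
  split; [|exact Hw].
  apply (holomorphic_lift Lm (ravg_iter beta 0 m p)); [apply Lm_hol|apply ravg_iter_hol; assumption|exact HT|exact Lm_injective|exact Hw].
Qed.
End Subordination.

(** * Littlewood's inequality and convex majorization *)

Lemma continuity_2d_swap (f : R -> R -> R) (x y : R) :
  continuity_2d_pt f x y -> continuity_2d_pt (fun u v => f v u) y x.
Proof.
  intros H eps. destruct (H eps) as [d Hd]. exists d. intros u v Hu Hv. apply Hd; assumption.
Qed.

Lemma cts_eps_R (f : R -> R) (x : R) :
  (forall eps : R, 0 < eps -> exists d, 0 < d /\ forall y, Rabs (y - x) < d -> Rabs (f y - f x) < eps) -> ctsR f x.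
Proof.
  intros H P HP. apply locally_R in HP. destruct HP as (e & He & HP).
  destruct (H e He) as (d & Hd & K0). apply locally_R. exists d. split; [exact Hd|].
  intros y Hy. apply HP, K0, Hy.
Qed.

Lemma continuity_2d_cts (f : R -> R -> R) : (forall x y, continuity_2d_pt f x y) -> forall x y, ctsR (fun y => f x y) y.
Proof.
  intros Hf x y. apply cts_eps_R. intros eps He.
  destruct (Hf x y (mkposreal _ He)) as [d Hd]. exists d. split; [apply cond_pos|].
  intros v Hv. apply Hd; [rewrite Rminus_eq_0, Rabs_R0; apply cond_pos|exact Hv].
Qed.

Lemma RInt_param_cts (f : R -> R -> R) (c d : R) : c <= d -> (forall x y, continuity_2d_pt f x y) ->
  forall x, ctsR (fun x => RInt (fun y => f x y) c d) x.
Proof.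
  intros Hcd Hf x. apply cts_eps_R. intros eps He.
  assert (He2 : 0 < eps / (d - c + 1)) by (apply Rdiv_lt_0_compat; lra).
  destruct (uniform_continuity_2d_1d' f c d x (fun t _ => Hf x t) (mkposreal _ He2)) as [del Hdel].
  exists del. split; [apply cond_pos|]. intros v Hv.
  assert (Hex : forall u, ex_RInt (fun y => f u y) c d).
  { intros u. apply ex_RInt_cont; [exact Hcd|]. intros t _. apply continuity_2d_cts, Hf. }
  rewrite <- (RInt_minus (V := R_CompleteNormedModule)) by apply Hex.
  apply Rle_lt_trans with ((d - c) * (eps / (d - c + 1))).
  - apply abs_RInt_le_const; [exact Hcd|apply (ex_RInt_minus (V := R_CompleteNormedModule)); apply Hex|].
    intros t Ht. apply Rlt_le. apply Rabs_lt_between in Hv. unfold minus, plus, opp; simpl.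
    pose proof (cond_pos del). apply (Hdel t x t v); try lra.
    rewrite Rminus_eq_0, Rabs_R0. apply cond_pos.
  - replace eps with ((d - c + 1) * (eps / (d - c + 1))) at 2 by (field; lra).
    apply Rmult_lt_compat_r; lra.
Qed.

(* Both sides have the same derivative in the upper limit [d]. *)
Lemma fubini (f : R -> R -> R) (a b c d : R) : a <= b -> c < d -> (forall x y, continuity_2d_pt f x y) ->
  RInt (fun x => RInt (fun y => f x y) c d) a b = RInt (fun y => RInt (fun x => f x y) a b) c d.
Proof.
  intros Hab Hcd Hf.
  pose (F1 := fun Y => RInt (fun x => RInt (fun y => f x y) c Y) a b).
  pose (F2 := fun Y => RInt (fun y => RInt (fun x => f x y) a b) c Y).
  assert (Hf' : forall x y, continuity_2d_pt (fun u v => f v u) x y) by (intros; apply continuity_2d_swap, Hf).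
  assert (Hex : forall x u v, ex_RInt (fun y => f x y) u v).
  { intros x u v. apply (ex_RInt_continuous (V := R_CompleteNormedModule)). intros t _. apply continuity_2d_cts, Hf. }
  assert (Din : forall x Y, is_derive (fun Y => RInt (fun y => f x y) c Y) Y (f x Y)).
  { intros x Y. apply (is_derive_RInt (V := R_NormedModule) (fun y => f x y) _ c).
    - apply filter_forall. intros y. apply (RInt_correct (V := R_CompleteNormedModule)), Hex.
    - apply continuity_2d_cts, Hf. }
  assert (HcX : forall x Y, c <= Y -> ctsR (fun x => RInt (fun y => f x y) c Y) x).
  { intros x Y HY. apply RInt_param_cts; assumption. }
  assert (D2 : forall Y, is_derive F2 Y (RInt (fun x => f x Y) a b)).
  { intros Y. apply (is_derive_RInt (V := R_NormedModule) (fun y => RInt (fun x => f x y) a b) _ c).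
    - apply filter_forall. intros y. apply (RInt_correct (V := R_CompleteNormedModule)).
      apply (ex_RInt_continuous (V := R_CompleteNormedModule)). intros t _.
      apply (RInt_param_cts (fun u v => f v u) a b Hab Hf').
    - apply (RInt_param_cts (fun u v => f v u) a b Hab Hf'). }
  assert (HcX2 : forall x Y, ctsR (fun x => RInt (fun y => f x y) c Y) x).
  { intros x Y. destruct (Rle_lt_dec c Y) as [L|L]; [apply HcX, L|].
    apply (continuous_ext (fun x => opp (RInt (fun y => f x y) Y c))).
    - intros t. apply (opp_RInt_swap (V := R_CompleteNormedModule)). apply Hex.
    - apply cont_Ropp. apply RInt_param_cts; [lra|exact Hf]. }
  assert (D1 : forall Y, is_derive F1 Y (RInt (fun x => f x Y) a b)).
  { intros Y.
    rewrite (RInt_ext (fun x => f x Y) (fun t => Derive (fun u => RInt (fun y => f t y) c u) Y)).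
    2:{ intros t _. symmetry. apply is_derive_unique, Din. }
    apply (is_derive_RInt_param (fun Y x => RInt (fun y => f x y) c Y)).
    - apply filter_forall. intros y t _. eexists. apply Din.
    - intros t _. apply (continuity_2d_pt_ext (fun u v => f v u)).
      + intros u v. symmetry. apply is_derive_unique, Din.
      + apply Hf'.
    - apply filter_forall. intros y. apply (ex_RInt_continuous (V := R_CompleteNormedModule)). intros t _. apply HcX2. }
  assert (E : F1 d - F2 d = F1 c - F2 c).
  { symmetry. apply (eq_is_derive (fun Y => F1 Y - F2 Y) c d); [|exact Hcd]. intros t _.
    replace (@zero R_NormedModule) with (minus (RInt (fun x => f x t) a b) (RInt (fun x => f x t) a b)) by (unfold minus, plus, opp, zero; simpl; ring).
    apply (is_derive_minus (K := R_AbsRing) (V := R_NormedModule)); [apply D1|apply D2]. }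
  assert (E1 : F1 c = 0).
  { unfold F1. rewrite (RInt_ext _ (fun _ => 0)).
    - rewrite (RInt_const (V := R_CompleteNormedModule)). unfold scal; simpl; unfold mult; simpl. ring.
    - intros x _. apply (RInt_point (V := R_CompleteNormedModule)). }
  assert (E2 : F2 c = 0) by apply (RInt_point (V := R_CompleteNormedModule)).
  rewrite E1, E2 in E. change (F1 d = F2 d). lra.
Qed.

(** * Hinge functions and Littlewood's theorem *)

Definition hinge (c x : R) : R := Rmax (x - c) 0.

Lemma hinge_ge c x : x - c <= hinge c x.
Proof. apply Rmax_l. Qed.
Lemma hinge_ge_0 c x : 0 <= hinge c x.
Proof. apply Rmax_r. Qed.
Lemma hinge_pos c x : c <= x -> hinge c x = x - c.
Proof. intros. apply Rmax_left. lra. Qed.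
Lemma hinge_neg c x : x <= c -> hinge c x = 0.
Proof. intros. apply Rmax_right. lra. Qed.

Lemma hinge_lip c x y : hinge c x <= hinge c y + Rabs (x - y).
Proof.
  pose proof (hinge_ge c y). pose proof (hinge_ge_0 c y). pose proof (Rle_abs (x - y)). pose proof (Rabs_pos (x - y)).
  apply Rmax_lub; lra.
Qed.

Lemma cont_hinge {T : UniformSpace} c (f : T -> R) x : ctsR f x -> ctsR (fun t => hinge c (f t)) x.
Proof.
  intros Hf. apply (continuous_comp f (hinge c)); [exact Hf|]. apply cts_eps_R. intros eps He.
  exists eps. split; [exact He|]. intros y Hy.
  pose proof (hinge_lip c y (f x)). pose proof (hinge_lip c (f x) y). rewrite (Rabs_minus_sym (f x) y) in H0.
  apply Rabs_lt_between'. lra.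
Qed.

Lemma cts_all_ex_RInt (f : R -> R) (a b : R) : (forall t, ctsR f t) -> ex_RInt f a b.
Proof. intros H. apply (ex_RInt_continuous (V := R_CompleteNormedModule)). intros; apply H. Qed.

Lemma poisson_Re_quotient (r : R) (z u : C) : Cmod z < r -> Cmod u = r ->
  poisson r z u = Re ((u + z) / (u - z))%C.
Proof.
  intros Hz Hu.
  assert (Huz : (u - z)%C <> 0%C) by (apply Csub_neq_0, Cmod_lt_neq; lra).
  assert (Hm : Cmod (u - z) ^ 2 <> 0) by (apply pow_nonzero, Rgt_not_eq, Cmod_gt_0, Huz).
  replace ((u + z) / (u - z))%C with ((u + z) * Cconj (u - z) * RtoC (/ (Cmod (u - z) ^ 2)))%C.
  - rewrite re_scal_r. unfold poisson, Rdiv. f_equal. rewrite <- Hu, !Cmod2_alt. destruct u, z; simpl; ring.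
  - rewrite RtoC_inv by exact Hm. rewrite Cmod2_conj. pose proof (Cconj_neq_0 _ Huz). field. auto.
Qed.

Lemma cont_fst2 (f : R -> C) (x : R * R) : (forall t, ctsC f t) ->
  continuous (U := C_UniformSpace) (fun p : prod_UniformSpace R_UniformSpace R_UniformSpace => f (fst p)) x.
Proof.
  intros Hf. destruct x as [x y]. apply (continuous_comp (fun p : prod_UniformSpace R_UniformSpace R_UniformSpace => fst p) f).
  - apply continuous_fst.
  - apply Hf.
Qed.

Lemma cont_snd2 (f : R -> C) (x : R * R) : (forall t, ctsC f t) ->
  continuous (U := C_UniformSpace) (fun p : prod_UniformSpace R_UniformSpace R_UniformSpace => f (snd p)) x.
Proof.
  intros Hf. destruct x as [x y]. apply (continuous_comp (fun p : prod_UniformSpace R_UniformSpace R_UniformSpace => snd p) f).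
  - apply continuous_snd.
  - apply Hf.
Qed.

(** The factor [lam < 1] puts [y s] strictly inside the circle, where the Poisson formula holds.
    Jensen's inequality for the hinge bounds the left side pointwise by a Poisson integral ([J]).
    After exchanging the integrals, the kernel is integrated over [s]: as the real part of
    [(u + lam w) / (u - lam w)], holomorphic in the variable of [w] with value 1 at 0, it
    contributes [2 * PI]. *)
Lemma littlewood_strict (F w : C -> C) (r lam c : R) : hol 1 F -> hol 1 w ->
  (forall z, Cmod z < 1 -> Cmod (w z) <= Cmod z) -> 0 < r < 1 -> 0 < lam < 1 ->
  RInt (fun t => hinge c (Re (F (RtoC lam * w (circle_point r t))%C))) (- PI) PI <=
  RInt (fun t => hinge c (Re (F (circle_point r t)))) (- PI) PI.
Proof.
  intros HF Hw Hw1 Hr Hlam. pose proof PI_RGT_0.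
  assert (Hcp : forall t, Cmod (circle_point r t) = r) by (intros; apply Cmod_circle_point; lra).
  pose (y := fun t => (RtoC lam * w (circle_point r t))%C).
  assert (Hy : forall t, Cmod (y t) < r).
  { intros t. unfold y. rewrite Cmod_mult, Cmod_R, Rabs_pos_eq by lra.
    specialize (Hw1 (circle_point r t)). rewrite Hcp in Hw1. specialize (Hw1 ltac:(lra)).
    pose proof (Cmod_ge_0 (w (circle_point r t))). nra. }
  assert (Cw : forall t, ctsC (fun t => w (circle_point r t)) t) by (apply (hol_circ_cts w r 1); lra || assumption).
  assert (CF : forall t, ctsC (fun t => F (circle_point r t)) t) by (apply (hol_circ_cts F r 1); lra || assumption).
  assert (Cy : forall t, ctsC y t) by (intros t; specialize (Cw t); unfold y; ct).
  assert (CS : forall t, ctsR (fun t => hinge c (Re (F (circle_point r t)))) t).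
  { intros t. apply cont_hinge, cont_Re, CF. }
  set (S0 := fun t => hinge c (Re (F (circle_point r t)))) in *.
  pose (f := fun s t => poisson r (y s) (circle_point r t) * S0 t).
  assert (Hf : forall s t, continuity_2d_pt f s t).
  { intros s t. apply continuity_2d_pt_filterlim.
    change (continuous (U := R_UniformSpace) (fun p : prod_UniformSpace R_UniformSpace R_UniformSpace => f (fst p) (snd p)) (s, t)).
    unfold f. apply cont_Rmult.
    - pose proof (cont_fst2 y (s, t) Cy) as Y1. pose proof (cont_snd2 (circle_point r) (s, t) (cont_circle r)) as Y2.
      unfold poisson. simpl pow. ct.
      assert (0 < Cmod (circle_point r t - y s)) as Hpp; [|simpl; nra].
      apply Cmod_gt_0, Csub_neq_0, Cmod_lt_neq. rewrite Hcp. apply Hy.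
    - apply (continuous_comp (fun p : prod_UniformSpace R_UniformSpace R_UniformSpace => snd p) S0); [apply continuous_snd|apply CS]. }
  assert (J : forall s, 2 * PI * hinge c (Re (F (y s))) <= RInt (fun t => f s t) (- PI) PI).
  { intros s. assert (CP := fun t => poisson_cts r (y s) t (Hy s)).
    assert (Ex1 : ex_RInt (fun t => f s t) (- PI) PI) by (apply cts_all_ex_RInt; intros t; apply continuity_2d_cts, Hf).
    assert (Hpos : forall t, 0 < poisson r (y s) (circle_point r t)) by (intros t; apply poisson_pos; [apply Hy|apply Hcp]).
    assert (CFR : forall t, ctsR (fun t => Re (F (circle_point r t))) t) by (intros; apply cont_Re, CF).
    destruct (Rle_lt_dec c (Re (F (y s)))) as [L|L].
    - rewrite hinge_pos by exact L.
      pose proof (poisson_formula F (y s) r 1 (Hy s) ltac:(lra) HF) as PF.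
      pose proof (poisson_1 r (y s) (Hy s)) as P1.
      assert (E : 2 * PI * (Re (F (y s)) - c) = RInt (fun t => minus (poisson r (y s) (circle_point r t) * Re (F (circle_point r t)))
                     (scal c (poisson r (y s) (circle_point r t)))) (- PI) PI).
      { rewrite (RInt_minus (V := R_CompleteNormedModule)).
        - rewrite (RInt_scal (V := R_CompleteNormedModule)) by (apply cts_all_ex_RInt; exact CP).
          rewrite PF, P1. unfold minus, plus, opp, scal; simpl; unfold mult; simpl. ring.
        - apply cts_all_ex_RInt. intros t. specialize (CP t). specialize (CFR t). ct.
        - apply (ex_RInt_scal (V := R_CompleteNormedModule)), cts_all_ex_RInt, CP. }
      rewrite E. apply RInt_le; [lra| |exact Ex1|].
      + apply (ex_RInt_minus (V := R_CompleteNormedModule)).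
        * apply cts_all_ex_RInt. intros t. specialize (CP t). specialize (CFR t). ct.
        * apply (ex_RInt_scal (V := R_CompleteNormedModule)), cts_all_ex_RInt, CP.
      + intros t _. unfold minus, plus, opp, scal, f; simpl; unfold mult; simpl. specialize (Hpos t).
        pose proof (hinge_ge c (Re (F (circle_point r t)))) as Hh. change (Re (F (circle_point r t)) - c <= S0 t) in Hh.
        nra.
    - rewrite hinge_neg by lra. rewrite Rmult_0_r. apply RInt_ge_0; [lra|exact Ex1|].
      intros t _. apply Rmult_le_pos; [apply Rlt_le, Hpos|apply hinge_ge_0]. }
  assert (K1 : forall t, RInt (fun s => poisson r (y s) (circle_point r t)) (- PI) PI = 2 * PI).
  { intros t. set (u := circle_point r t).
    (* For [Cmod z < rr] the modulus of [lam * w z] is below [r = Cmod u], so the quotient has no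
       pole; [lam < 1] makes [rr] exceed [r]. *)
    set (rr := Rmin 1 (r / lam)).
    assert (Hrl : r < r / lam). { apply (Rmult_lt_reg_r lam); [lra|]. unfold Rdiv. rewrite Rmult_assoc, Rinv_l by lra. nra. }
    assert (Hrr : r < rr) by (apply Rmin_glb_lt; lra).
    assert (Hne : forall z, Cmod z < rr -> (u - RtoC lam * w z)%C <> 0%C).
    { intros z Hz. apply Csub_neq_0, Cmod_lt_neq. unfold u. rewrite Hcp, Cmod_mult, Cmod_R, Rabs_pos_eq by lra.
      assert (rr <= 1) by apply Rmin_l. assert (rr <= r / lam) by apply Rmin_r.
      specialize (Hw1 z ltac:(lra)). assert (Cmod z * lam < r).
      { assert (Hz2 : Cmod z < r / lam) by lra. apply (Rmult_lt_compat_r lam) in Hz2; [|lra].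
        unfold Rdiv in Hz2. rewrite Rmult_assoc, Rinv_l in Hz2 by lra. lra. }
      nra. }
    assert (Hh : hol rr (fun z => (u + RtoC lam * w z) / (u - RtoC lam * w z))%C).
    { intros z Hz. pose proof (Hne z Hz). assert (Hz1 : Cmod z < 1) by (apply Rlt_le_trans with (1 := Hz); apply Rmin_l).
      specialize (Hw z Hz1). apply (cdiff_div (fun z => u + RtoC lam * w z)%C (fun z => u - RtoC lam * w z)%C); ch. }
    pose proof (mean_value _ r rr ltac:(lra) Hrr Hh) as E. apply (f_equal Re) in E. unfold circ, Cint in E. simpl Re at 1 in E.
    rewrite (RInt_ext _ (fun s => Re ((u + RtoC lam * w (circle_point r s)) / (u - RtoC lam * w (circle_point r s)))%C)).
    - etransitivity; [exact E|].
      assert (Hw0 : w 0%C = 0%C).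
      { specialize (Hw1 0%C). rewrite Cmod_0 in Hw1. specialize (Hw1 ltac:(lra)). apply Cmod_eq_0.
        pose proof (Cmod_ge_0 (w 0%C)). lra. }
      rewrite Hw0. replace ((u + RtoC lam * 0) / (u - RtoC lam * 0))%C with (RtoC 1).
      + simpl. ring.
      + replace (RtoC lam * 0)%C with (RtoC 0) by ring. replace (u - 0)%C with u by ring. field.
        apply circle_point_neq_0. lra.
    - intros s _. apply poisson_Re_quotient; [apply Hy|apply Hcp]. }
  assert (K2 : RInt (fun s => RInt (fun t => f s t) (- PI) PI) (- PI) PI = 2 * PI * RInt S0 (- PI) PI).
  { rewrite fubini; [|lra|lra|exact Hf].
    rewrite (RInt_ext _ (fun t => scal (2 * PI) (S0 t))).
    - rewrite (RInt_scal (V := R_CompleteNormedModule)) by (apply cts_all_ex_RInt, CS). reflexivity.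
    - intros t _. unfold f. rewrite (RInt_ext _ (fun s => scal (S0 t) (poisson r (y s) (circle_point r t)))).
      + rewrite (RInt_scal (V := R_CompleteNormedModule)).
        * rewrite K1. unfold scal; simpl; unfold mult; simpl. ring.
        * apply cts_all_ex_RInt. intros s. pose proof (Cy s). unfold poisson. simpl pow. ct.
          assert (0 < Cmod (circle_point r t - y s)) as Hpp; [|simpl; nra].
          apply Cmod_gt_0, Csub_neq_0, Cmod_lt_neq. rewrite Hcp. apply Hy.
      + intros s _. unfold scal; simpl; unfold mult; simpl. ring. }
  assert (CL : forall t, ctsR (fun t => hinge c (Re (F (y t)))) t).
  { intros t. apply cont_hinge, cont_Re. apply (cont_hol 1 F y); [exact HF|apply Cy|]. specialize (Hy t). lra. }
  assert (K3 : 2 * PI * RInt (fun s => hinge c (Re (F (y s)))) (- PI) PI <= 2 * PI * RInt S0 (- PI) PI).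
  { rewrite <- K2. change (2 * PI * RInt (fun s => hinge c (Re (F (y s)))) (- PI) PI) with
      (scal (2 * PI) (RInt (fun s => hinge c (Re (F (y s)))) (- PI) PI)).
    rewrite <- (RInt_scal (V := R_CompleteNormedModule)) by (apply cts_all_ex_RInt, CL).
    apply RInt_le; [lra| | |].
    - apply (ex_RInt_scal (V := R_CompleteNormedModule)), cts_all_ex_RInt, CL.
    - apply cts_all_ex_RInt. apply RInt_param_cts; [lra|exact Hf].
    - intros s _. apply J. }
  apply Rmult_le_reg_l with (2 * PI); [lra|exact K3].
Qed.

(** The limit [lam = 1 - e -> 1]: [F] is Lipschitz on the closed disk of radius [r] and hinges do
    not increase distances, so the integrals change by at most [2 * PI * K0 * e], less than the
    assumed excess. *)
Lemma littlewood (F w : C -> C) (r c : R) : hol 1 F -> hol 1 w ->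
  (forall z, Cmod z < 1 -> Cmod (w z) <= Cmod z) -> 0 < r < 1 ->
  RInt (fun t => hinge c (Re (F (w (circle_point r t))))) (- PI) PI <=
  RInt (fun t => hinge c (Re (F (circle_point r t)))) (- PI) PI.
Proof.
  intros HF Hw Hw1 Hr. pose proof PI_RGT_0.
  destruct (hol_taylor 1 r F ltac:(lra) ltac:(lra) HF) as (K0 & HK & T).
  assert (Hcp : forall t, Cmod (circle_point r t) = r) by (intros; apply Cmod_circle_point; lra).
  assert (Hwr : forall t, Cmod (w (circle_point r t)) <= r).
  { intros t. rewrite <- (Hcp t) at 2. apply Hw1. rewrite Hcp. lra. }
  assert (Cw : forall t, ctsC (fun t => w (circle_point r t)) t) by (apply (hol_circ_cts w r 1); lra || assumption).
  apply Rnot_lt_le. intros L.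
  set (I1 := RInt (fun t => hinge c (Re (F (w (circle_point r t))))) (- PI) PI) in *.
  set (I2 := RInt (fun t => hinge c (Re (F (circle_point r t)))) (- PI) PI) in *.
  set (e := Rmin (/ 2) ((I1 - I2) / (4 * PI * (K0 + 1)))).
  assert (Hq : 0 < (I1 - I2) / (4 * PI * (K0 + 1))).
  { apply Rdiv_lt_0_compat; [lra|]. apply Rmult_lt_0_compat; lra. }
  assert (He : 0 < e) by (apply Rmin_pos; lra). assert (He1 : e <= / 2) by apply Rmin_l.
  assert (He2 : e <= (I1 - I2) / (4 * PI * (K0 + 1))) by apply Rmin_r. clearbody e.
  pose proof (littlewood_strict F w r (1 - e) c HF Hw Hw1 Hr ltac:(lra)) as LS. fold I2 in LS.
  assert (Hlw : forall t, Cmod (RtoC (1 - e) * w (circle_point r t)) <= r).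
  { intros t. rewrite Cmod_mult, Cmod_R, Rabs_pos_eq by lra. specialize (Hwr t).
    pose proof (Cmod_ge_0 (w (circle_point r t))). nra. }
  assert (C1 : forall t, ctsR (fun t => hinge c (Re (F (w (circle_point r t))))) t).
  { intros t. apply cont_hinge, cont_Re. apply (cont_hol 1 F (fun t => w (circle_point r t))); [exact HF|apply Cw|]. specialize (Hwr t). lra. }
  assert (C2 : forall t, ctsR (fun t => hinge c (Re (F (RtoC (1 - e) * w (circle_point r t))%C))) t).
  { intros t. apply cont_hinge, cont_Re. specialize (Cw t).
    apply (cont_hol 1 F (fun t => RtoC (1 - e) * w (circle_point r t))%C); [exact HF|ct|]. specialize (Hlw t). lra. }
  assert (B : I1 <= RInt (fun t => plus (hinge c (Re (F (RtoC (1 - e) * w (circle_point r t))%C))) (K0 * e)) (- PI) PI).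
  { apply RInt_le; [lra|apply cts_all_ex_RInt, C1| |].
    - apply (ex_RInt_plus (V := R_CompleteNormedModule)); [apply cts_all_ex_RInt, C2|apply ex_RInt_const].
    - intros t _. unfold plus; simpl.
      apply Rle_trans with (1 := hinge_lip c _ (Re (F (RtoC (1 - e) * w (circle_point r t))%C))).
      apply Rplus_le_compat_l.
      destruct (T (RtoC (1 - e) * w (circle_point r t))%C (w (circle_point r t)) (Hlw t) (Hwr t)) as (_ & _ & T3).
      replace (w (circle_point r t) - RtoC (1 - e) * w (circle_point r t))%C with (RtoC e * w (circle_point r t))%C in T3
        by (rewrite RtoC_minus; ring).
      rewrite Cmod_mult, Cmod_R, Rabs_pos_eq in T3 by lra.
      set (X := F (w (circle_point r t))) in *. set (Y := F (RtoC (1 - e) * w (circle_point r t))%C) in *.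
      replace (Re X - Re Y) with (Re (X - Y)%C) by (simpl; unfold Re; ring).
      apply Rle_trans with (1 := re_le_Cmod _). apply Rle_trans with (1 := T3).
      specialize (Hwr t). pose proof (Cmod_ge_0 (w (circle_point r t))). apply Rmult_le_compat_l; [exact HK|]. nra. }
  rewrite (RInt_plus (V := R_CompleteNormedModule)) in B; [|apply cts_all_ex_RInt, C2|apply ex_RInt_const].
  rewrite (RInt_const (V := R_CompleteNormedModule)) in B. unfold plus, scal in B; simpl in B; unfold mult in B; simpl in B.
  apply (Rmult_le_compat_r (4 * PI * (K0 + 1))) in He2; [|apply Rmult_le_pos; lra].
  replace ((I1 - I2) / (4 * PI * (K0 + 1)) * (4 * PI * (K0 + 1))) with (I1 - I2) in He2 by (field; lra).
  assert (0 <= PI * K0 * e) by (apply Rmult_le_pos; [apply Rmult_le_pos|]; lra). assert (0 < PI * e) by (apply Rmult_lt_0_compat; lra). nra.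
Qed.

Definition even_decreasing (U : R -> R) : Prop :=
  (forall t, U (- t) = U t) /\ forall s t, 0 <= s -> s <= t -> t <= PI -> U t <= U s.

Lemma RInt_hinge_plus (u1 u2 : R -> R) (c1 c2 : R) : (forall t, ctsR u1 t) -> (forall t, ctsR u2 t) ->
  RInt (fun t => hinge c1 (u1 t) + hinge c2 (u2 t)) (- PI) PI =
  RInt (fun t => hinge c1 (u1 t)) (- PI) PI + RInt (fun t => hinge c2 (u2 t)) (- PI) PI.
Proof.
  intros H1 H2. apply (RInt_plus (V := R_CompleteNormedModule)); apply cts_all_ex_RInt; intros; apply cont_hinge; auto.
Qed.

(* Split [c = c1 + c2] at an angle where [U1 + U2 = c]: then [U1 > c1] and [U2 > c2] on the same arc. *)
Lemma hinge_sum (u1 u2 U1 U2 : R -> R) :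
  (forall t, ctsR u1 t) -> (forall t, ctsR u2 t) -> (forall t, ctsR U1 t) -> (forall t, ctsR U2 t) ->
  even_decreasing U1 -> even_decreasing U2 ->
  (forall c, RInt (fun t => hinge c (u1 t)) (- PI) PI <= RInt (fun t => hinge c (U1 t)) (- PI) PI) ->
  (forall c, RInt (fun t => hinge c (u2 t)) (- PI) PI <= RInt (fun t => hinge c (U2 t)) (- PI) PI) ->
  forall c, RInt (fun t => hinge c (u1 t + u2 t)) (- PI) PI <= RInt (fun t => hinge c (U1 t + U2 t)) (- PI) PI.
Proof.
  intros Cu1 Cu2 CU1 CU2 [Ev1 De1] [Ev2 De2] H1 H2 c. pose proof PI_RGT_0.
  assert (Hsplit : exists c1 c2, c1 + c2 = c /\ forall t, 0 <= t <= PI ->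
     (c1 <= U1 t /\ c2 <= U2 t) \/ (U1 t <= c1 /\ U2 t <= c2)).
  (* If [c] lies outside the range of [U1 + U2] there need be no such angle: above the maximum the
     values at 0 serve for the split, below the minimum those at [PI]. *)
  { destruct (Rle_lt_dec (U1 0 + U2 0) c) as [L|L].
    - exists (U1 0), (c - U1 0). split; [ring|]. intros t Ht. right.
      pose proof (De1 0 t ltac:(lra) ltac:(lra) ltac:(lra)). pose proof (De2 0 t ltac:(lra) ltac:(lra) ltac:(lra)). lra.
    - destruct (Rle_lt_dec c (U1 PI + U2 PI)) as [L2|L2].
      + exists (U1 PI), (c - U1 PI). split; [ring|]. intros t Ht. left.
        pose proof (De1 t PI ltac:(lra) ltac:(lra) ltac:(lra)). pose proof (De2 t PI ltac:(lra) ltac:(lra) ltac:(lra)). lra.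
      + destruct (IVT_gen (fun t => U1 t + U2 t) 0 PI c) as [t0 [Ht0 E]].
        * intros t. apply continuity_pt_filterlim. apply cont_Rplus; auto.
        * rewrite Rmin_right, Rmax_left; lra.
        * rewrite Rmin_left, Rmax_right in Ht0 by lra. exists (U1 t0), (U2 t0). split; [exact E|]. intros t Ht.
          destruct (Rle_lt_dec t t0) as [L3|L3]; [left|right]; split; [apply De1|apply De2|apply De1|apply De2]; lra. }
  destruct Hsplit as (c1 & c2 & Ec & Hs).
  (* [hinge (c1 + c2) (x + y) <= hinge c1 x + hinge c2 y], with equality when both arguments are on
     the same side of their thresholds. By the split this is always so for [U1] and [U2], and the
     loss occurs only on the smaller side. *)
  apply Rle_trans with (RInt (fun t => hinge c1 (u1 t) + hinge c2 (u2 t)) (- PI) PI).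
  - apply RInt_le; [lra| | |].
    + apply cts_all_ex_RInt. intros t. apply cont_hinge, cont_Rplus; auto.
    + apply cts_all_ex_RInt. intros t. apply cont_Rplus; apply cont_hinge; auto.
    + intros t _. pose proof (hinge_ge c1 (u1 t)). pose proof (hinge_ge c2 (u2 t)).
      pose proof (hinge_ge_0 c1 (u1 t)). pose proof (hinge_ge_0 c2 (u2 t)). apply Rmax_lub; lra.
  - rewrite RInt_hinge_plus by assumption.
    apply Rle_trans with (1 := Rplus_le_compat _ _ _ _ (H1 c1) (H2 c2)).
    rewrite <- RInt_hinge_plus by assumption. right. apply RInt_ext. rewrite Rmin_left, Rmax_right by lra.
    intros t Ht. assert (E : exists s, 0 <= s <= PI /\ U1 t = U1 s /\ U2 t = U2 s).
    { destruct (Rle_lt_dec 0 t) as [L|L].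
      - exists t. split; [lra|]. split; reflexivity.
      - exists (- t). split; [lra|]. rewrite Ev1, Ev2. split; reflexivity. }
    destruct E as (s & Hs1 & E1 & E2). rewrite E1, E2. rewrite <- Ec.
    destruct (Hs s Hs1) as [[A1 A2]|[A1 A2]].
    + rewrite !hinge_pos by lra. match goal with |- @eq _ ?x ?y => change (@eq R x y) end. ring.
    + rewrite !hinge_neg by lra. match goal with |- @eq _ ?x ?y => change (@eq R x y) end. ring.
Qed.

(** * Convex functions as limits of sums of hinges *)

Lemma convex_slopes (Phi : R -> R) : convex_fun Phi -> forall p q s, p < q -> q < s ->
  (Phi q - Phi p) * (s - q) <= (Phi s - Phi q) * (q - p).
Proof.
  intros H p q s Hpq Hqs. specialize (H p s ((s - q) / (s - p))).
  assert (Ht : 0 <= (s - q) / (s - p) <= 1).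
  { split; [apply Rdiv_le_0_compat; lra|]. apply (Rmult_le_reg_r (s - p)); [lra|]. unfold Rdiv. rewrite Rmult_assoc, Rinv_l; lra. }
  specialize (H Ht). replace ((s - q) / (s - p) * p + (1 - (s - q) / (s - p)) * s) with q in H by (field; lra).
  apply (Rmult_le_compat_r (s - p)) in H; [|lra].
  replace (((s - q) / (s - p) * Phi p + (1 - (s - q) / (s - p)) * Phi s) * (s - p)) with ((s - q) * Phi p + (q - p) * Phi s) in H by (field; lra).
  lra.
Qed.

(** Slopes increase, so the last secant dominates. This one-sided Lipschitz bound on the half-line
    below [b] yields both the continuity of [Phi] and the interpolation error. *)
Lemma convex_increment (Phi : R -> R) : convex_fun Phi -> forall x y b, x <= y -> y <= b ->
  Phi y - Phi x <= (Phi (b + 1) - Phi b) * (y - x).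
Proof.
  intros H x y b Hxy Hyb. destruct (Rle_lt_or_eq_dec _ _ Hxy) as [L|L]; [|subst; lra].
  pose proof (convex_slopes Phi H x y (b + 1) L ltac:(lra)) as S1.
  assert (S2 : Phi (b + 1) - Phi y <= (Phi (b + 1) - Phi b) * (b + 1 - y)).
  { destruct (Rle_lt_or_eq_dec _ _ Hyb) as [L2|L2]; [|subst; lra].
    pose proof (convex_slopes Phi H y b (b + 1) L2 ltac:(lra)) as S2. nra. }
  assert (S3 : (Phi (b + 1) - Phi y) * (y - x) <= (Phi (b + 1) - Phi b) * (b + 1 - y) * (y - x)) by (apply Rmult_le_compat_r; lra).
  apply (Rmult_le_reg_r (b + 1 - y)); [lra|]. lra.
Qed.

Lemma convex_continuous (Phi : R -> R) : convex_fun Phi -> nondecreasing Phi -> forall x, ctsR Phi x.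
Proof.
  intros H Hm x. apply cts_eps_R. intros eps He. set (k := Phi (x + 1 + 1) - Phi (x + 1)).
  assert (Hk : 0 <= k) by (pose proof (Hm (x + 1) (x + 1 + 1) ltac:(lra)); unfold k; lra).
  exists (Rmin 1 (eps / (k + 1))). split; [apply Rmin_pos; [lra|apply Rdiv_lt_0_compat; lra]|].
  intros y Hy. pose proof (Rmin_l 1 (eps / (k + 1))). pose proof (Rmin_r 1 (eps / (k + 1))) as Hr2.
  assert (Hy2 : Rabs (y - x) * (k + 1) < eps).
  { apply (Rmult_lt_reg_r (/ (k + 1))); [apply Rinv_0_lt_compat; lra|]. rewrite Rmult_assoc, Rinv_r by lra. unfold Rdiv in Hr2. lra. }
  pose proof (Rabs_pos (y - x)).
  assert (Hy1 : Rabs (y - x) < 1) by lra. apply Rabs_lt_between in Hy1.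
  destruct (Rle_lt_dec x y) as [L|L].
  - pose proof (convex_increment Phi H x y (x + 1) L ltac:(lra)) as I. fold k in I. pose proof (Hm x y L).
    rewrite (Rabs_pos_eq (y - x)) in * by lra. rewrite Rabs_pos_eq by lra. nra.
  - pose proof (convex_increment Phi H y x (x + 1) ltac:(lra) ltac:(lra)) as I. fold k in I. pose proof (Hm y x ltac:(lra)).
    assert (Ea : Rabs (y - x) = x - y) by (rewrite Rabs_minus_sym; apply Rabs_pos_eq; lra).
    rewrite Ea in *. rewrite Rabs_minus_sym, Rabs_pos_eq by lra. nra.
Qed.

(* Piecewise linear interpolation of [Phi] at the nodes [a + k d], written with hinges. *)
Fixpoint hinge_interp (Phi : R -> R) (a d : R) (k : nat) (x : R) : R :=
  match k with
  | O => Phi a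
  | S j => hinge_interp Phi a d j x +
      (Phi (a + INR j * d + d) - Phi (a + INR j * d) -
        match j with O => 0 | S i => Phi (a + INR i * d + d) - Phi (a + INR i * d) end) / d *
      hinge (a + INR j * d) x
  end.

(** To the right of the last node all hinges are active, and their slope increments telescope to the
    slope of the last cell. *)
Lemma hinge_interp_right (Phi : R -> R) (a d : R) (k : nat) (x : R) : 0 < d -> a + INR k * d <= x ->
  hinge_interp Phi a d (S k) x =
  Phi (a + INR k * d) + (Phi (a + INR k * d + d) - Phi (a + INR k * d)) / d * (x - (a + INR k * d)).
Proof.
  intros Hd. induction k as [|k IH]; intros Hx.
  - simpl in *. rewrite Rmult_0_l, Rplus_0_r in *. rewrite hinge_pos by lra. field. lra.
  - change (hinge_interp Phi a d (S (S k)) x) with (hinge_interp Phi a d (S k) x +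
      (Phi (a + INR (S k) * d + d) - Phi (a + INR (S k) * d) - (Phi (a + INR k * d + d) - Phi (a + INR k * d))) / d *
      hinge (a + INR (S k) * d) x).
    rewrite hinge_pos by exact Hx. rewrite S_INR in *.
    rewrite IH by nra. replace (a + INR k * d + d) with (a + (INR k + 1) * d) by ring. field. lra.
Qed.

(** Within a cell both the interpolant and the monotone [Phi] lie between the two node values, which
    differ by at most [e]; hinges at nodes to the right of [x] vanish. *)
Lemma hinge_interp_close (Phi : R -> R) (a d e : R) (k : nat) (x : R) : 0 < d -> nondecreasing Phi ->
  (forall j, (j <= k)%nat -> Phi (a + INR j * d + d) - Phi (a + INR j * d) <= e) ->
  a <= x -> x <= a + INR k * d + d ->
  Rabs (hinge_interp Phi a d (S k) x - Phi x) <= e.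
Proof.
  intros Hd Hm. induction k as [|k IH]; intros He Hax Hx.
  - rewrite hinge_interp_right; [|exact Hd|simpl; lra]. specialize (He O (le_n _)). simpl in *.
    rewrite Rmult_0_l, Rplus_0_r in *.
    pose proof (Hm a x Hax). pose proof (Hm x (a + d) Hx).
    assert (Hs : 0 <= (x - a) / d <= 1).
    { split; [apply Rdiv_le_0_compat; lra|]. apply (Rmult_le_reg_r d); [lra|]. unfold Rdiv. rewrite Rmult_assoc, Rinv_l; lra. }
    replace ((Phi (a + d) - Phi a) / d * (x - a)) with ((Phi (a + d) - Phi a) * ((x - a) / d)) by (field; lra).
    apply Rabs_le. nra.
  - destruct (Rle_lt_dec (a + INR (S k) * d) x) as [L|L].
    + rewrite hinge_interp_right by assumption. specialize (He (S k) (le_n _)).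
      set (p := a + INR (S k) * d) in *. pose proof (Hm p x L). pose proof (Hm x (p + d) Hx).
      assert (Hs : 0 <= (x - p) / d <= 1).
      { split; [apply Rdiv_le_0_compat; lra|]. apply (Rmult_le_reg_r d); [lra|]. unfold Rdiv. rewrite Rmult_assoc, Rinv_l; lra. }
      replace ((Phi (p + d) - Phi p) / d * (x - p)) with ((Phi (p + d) - Phi p) * ((x - p) / d)) by (field; lra).
      apply Rabs_le. nra.
    + change (hinge_interp Phi a d (S (S k)) x) with (hinge_interp Phi a d (S k) x +
      (Phi (a + INR (S k) * d + d) - Phi (a + INR (S k) * d) - (Phi (a + INR k * d + d) - Phi (a + INR k * d))) / d *
      hinge (a + INR (S k) * d) x).
      rewrite hinge_neg by lra. rewrite Rmult_0_r, Rplus_0_r. apply IH.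
      * intros j Hj. apply He. lia.
      * exact Hax.
      * rewrite S_INR in L. lra.
Qed.

Lemma cont_hinge_interp (Phi : R -> R) (a d : R) (k : nat) (f : R -> R) t : ctsR f t -> ctsR (fun t => hinge_interp Phi a d k (f t)) t.
Proof.
  intros Hf. induction k as [|k IH]; simpl; [apply continuous_const|].
  apply cont_Rplus; [exact IH|]. apply cont_Rmult; [apply continuous_const|apply cont_hinge, Hf].
Qed.

(** The coefficients of the hinges are increments of slopes: nonnegative by convexity, and the first
    one by monotonicity. So the hypothesis on single hinges adds up. *)
Lemma hinge_interp_RInt (Phi : R -> R) (a d : R) (k : nat) (u V : R -> R) : 0 < d ->
  convex_fun Phi -> nondecreasing Phi -> (forall t, ctsR u t) -> (forall t, ctsR V t) ->
  (forall c, RInt (fun t => hinge c (u t)) (- PI) PI <= RInt (fun t => hinge c (V t)) (- PI) PI) ->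
  RInt (fun t => hinge_interp Phi a d k (u t)) (- PI) PI <= RInt (fun t => hinge_interp Phi a d k (V t)) (- PI) PI.
Proof.
  intros Hd Hc Hm Cu CV H. induction k as [|k IH].
  - simpl. lra.
  - simpl. set (s := (_ - _ - _) / d).
    assert (Hs : 0 <= s).
    { unfold s. apply Rdiv_le_0_compat; [|exact Hd]. destruct k as [|k].
      - simpl. pose proof (Hm (a + 0 * d) (a + 0 * d + d) ltac:(lra)). lra.
      - rewrite S_INR. pose proof (convex_slopes Phi Hc (a + INR k * d) (a + (INR k + 1) * d) (a + (INR k + 1) * d + d) ltac:(lra) ltac:(lra)) as S1.
        replace (a + INR k * d + d) with (a + (INR k + 1) * d) by ring.
        replace (a + (INR k + 1) * d + d - (a + (INR k + 1) * d)) with d in S1 by ring.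
        replace (a + (INR k + 1) * d - (a + INR k * d)) with d in S1 by ring.
        apply Rmult_le_reg_r in S1; [|exact Hd]. lra. }
    clearbody s.
    assert (E : forall f, (forall t, ctsR f t) -> RInt (fun t => hinge_interp Phi a d k (f t) + s * hinge (a + INR k * d) (f t)) (- PI) PI =
      RInt (fun t => hinge_interp Phi a d k (f t)) (- PI) PI + s * RInt (fun t => hinge (a + INR k * d) (f t)) (- PI) PI).
    { intros f Cf.
      assert (Eh : ex_RInt (fun t => hinge (a + INR k * d) (f t)) (- PI) PI) by (apply cts_all_ex_RInt; intros t; apply cont_hinge, Cf).
      transitivity (plus (RInt (fun t => hinge_interp Phi a d k (f t)) (- PI) PI) (scal s (RInt (fun t => hinge (a + INR k * d) (f t)) (- PI) PI)));
        [|reflexivity].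
      rewrite <- (RInt_scal (V := R_CompleteNormedModule)) by exact Eh.
      apply (RInt_plus (V := R_CompleteNormedModule)).
      - apply cts_all_ex_RInt. intros t. apply cont_hinge_interp, Cf.
      - apply (ex_RInt_scal (V := R_CompleteNormedModule)), Eh. }
    rewrite !E by assumption. specialize (H (a + INR k * d)). nra.
Qed.

Lemma convex_majorization (Phi u V : R -> R) :
  convex_fun Phi -> nondecreasing Phi -> (forall t, ctsR u t) -> (forall t, ctsR V t) ->
  (forall c, RInt (fun t => hinge c (u t)) (- PI) PI <= RInt (fun t => hinge c (V t)) (- PI) PI) ->
  RInt (fun t => Phi (u t)) (- PI) PI <= RInt (fun t => Phi (V t)) (- PI) PI.
Proof.
  intros Hc Hm Cu CV H. pose proof PI_RGT_0.
  assert (HB : forall f, (forall t, ctsR f t) -> exists M, forall t, - PI <= t <= PI -> Rabs (f t) <= M).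
  { intros f Cf. destruct (continuity_ab_maj (fun t => Rabs (f t)) (- PI) PI ltac:(lra)) as (m & Hmx & _).
    - intros t _. apply (continuity_pt_comp f Rabs); [|apply Rcontinuity_abs]. apply continuity_pt_filterlim, Cf.
    - exists (Rabs (f m)). exact Hmx. }
  destruct (HB u Cu) as [M1 HM1]. destruct (HB V CV) as [M2 HM2].
  set (b := Rmax (Rmax M1 M2) 1). assert (Hb1 : 1 <= b) by apply Rmax_r.
  assert (Hbu : forall t, - PI <= t <= PI -> - b <= u t <= b).
  { intros t Ht. apply Rabs_le_between. apply Rle_trans with (1 := HM1 t Ht). apply Rle_trans with (Rmax M1 M2); apply Rmax_l. }
  assert (HbV : forall t, - PI <= t <= PI -> - b <= V t <= b).
  { intros t Ht. apply Rabs_le_between. apply Rle_trans with (1 := HM2 t Ht). apply Rle_trans with (Rmax M1 M2); [apply Rmax_r|apply Rmax_l]. }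
  clearbody b. set (k := Phi (b + 1) - Phi b).
  assert (Hk : 0 <= k) by (pose proof (Hm b (b + 1) ltac:(lra)); unfold k; lra).
  assert (CPhi := convex_continuous Phi Hc Hm).
  assert (Cont : forall f : R -> R, (forall t, ctsR f t) -> forall t, ctsR (fun t => Phi (f t)) t).
  { intros f Cf t. apply (continuous_comp f Phi); [apply Cf|apply CPhi]. }
  apply Rnot_lt_le. intros L.
  set (I1 := RInt (fun t => Phi (u t)) (- PI) PI) in *. set (I2 := RInt (fun t => Phi (V t)) (- PI) PI) in *.
  (* The two interpolation errors add up to [4 * PI * k * d], which for [d = 2 * b / INR (S n)] is
     [8 * PI * k * b / INR (S n)]; this choice of [n] makes it smaller than [I1 - I2]. *)
  destruct (nfloor_ex (8 * PI * (k + 1) * b / (I1 - I2))) as [n Hn].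
  { apply Rdiv_le_0_compat; [|lra]. apply Rmult_le_pos; [apply Rmult_le_pos|]; lra. }
  set (d := 2 * b / INR (S n)).
  assert (HSn : 0 < INR (S n)) by (apply lt_0_INR; lia).
  assert (Hd : 0 < d) by (apply Rdiv_lt_0_compat; lra).
  assert (Ed : - b + INR n * d + d = b) by (unfold d; rewrite S_INR in *; field; lra).
  assert (Hclose : forall x, - b <= x <= b -> Rabs (hinge_interp Phi (- b) d (S n) x - Phi x) <= k * d).
  { intros x Hx. apply hinge_interp_close; try lra; [exact Hm|]. intros j Hj.
    replace (k * d) with (k * ((- b + INR j * d + d) - (- b + INR j * d))) by ring.
    apply convex_increment; [exact Hc|lra|]. rewrite <- Ed. apply le_INR in Hj. nra. }
  assert (B1 : I1 <= RInt (fun t => plus (hinge_interp Phi (- b) d (S n) (u t)) (k * d)) (- PI) PI).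
  { apply RInt_le; [lra|apply cts_all_ex_RInt, Cont, Cu| |].
    - apply (ex_RInt_plus (V := R_CompleteNormedModule)); [|apply ex_RInt_const].
      apply cts_all_ex_RInt. intros t. apply cont_hinge_interp, Cu.
    - intros t Ht. specialize (Hclose (u t) (Hbu t ltac:(lra))). apply Rabs_le_between in Hclose. change (Phi (u t) <= hinge_interp Phi (- b) d (S n) (u t) + k * d). lra. }
  assert (B2 : RInt (fun t => hinge_interp Phi (- b) d (S n) (V t)) (- PI) PI <= RInt (fun t => plus (Phi (V t)) (k * d)) (- PI) PI).
  { apply RInt_le; [lra| | |].
    - apply cts_all_ex_RInt. intros t. apply cont_hinge_interp, CV.
    - apply (ex_RInt_plus (V := R_CompleteNormedModule)); [apply cts_all_ex_RInt, Cont, CV|apply ex_RInt_const].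
    - intros t Ht. specialize (Hclose (V t) (HbV t ltac:(lra))). apply Rabs_le_between in Hclose.
      change (hinge_interp Phi (- b) d (S n) (V t) <= Phi (V t) + k * d). lra. }
  pose proof (hinge_interp_RInt Phi (- b) d (S n) u V Hd Hc Hm Cu CV H) as B3.
  rewrite (RInt_plus (V := R_CompleteNormedModule)) in B1; [| |apply ex_RInt_const].
  2:{ apply cts_all_ex_RInt. intros t. apply cont_hinge_interp, Cu. }
  rewrite (RInt_plus (V := R_CompleteNormedModule)) in B2; [|apply cts_all_ex_RInt, Cont, CV|apply ex_RInt_const].
  rewrite (RInt_const (V := R_CompleteNormedModule)) in B1, B2.
  change (I1 <= RInt (fun t => hinge_interp Phi (- b) d (S n) (u t)) (- PI) PI + (PI - - PI) * (k * d)) in B1.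
  change (RInt (fun t => hinge_interp Phi (- b) d (S n) (V t)) (- PI) PI <= I2 + (PI - - PI) * (k * d)) in B2.
  assert (F : I1 - I2 <= 4 * PI * (k * d)) by lra.
  assert (F2 : 4 * PI * (k * d) * INR (S n) = 8 * PI * k * b) by (unfold d; field; lra).
  destruct Hn as [_ Hn]. rewrite <- S_INR in Hn.
  apply (Rmult_lt_compat_r (I1 - I2)) in Hn; [|lra].
  unfold Rdiv in Hn. rewrite Rmult_assoc, Rinv_l, Rmult_1_r in Hn by lra.
  apply (Rmult_le_compat_r (INR (S n))) in F; [|lra]. rewrite F2 in F.
  assert (0 < PI * b) by (apply Rmult_lt_0_compat; lra). nra.
Qed.

(** * The square root of f(z)/z *)

(* [k >= 1] comes from the lemma of Schwarz for [w (z0 * z)]. *)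
Lemma jack (w : C -> C) (z0 : C) : hol 1 w -> w 0%C = 0%C -> Cmod z0 < 1 -> z0 <> 0%C -> Cmod (w z0) = 1 ->
  (forall z, Cmod z <= Cmod z0 -> Cmod (w z) <= 1) ->
  exists k, 1 <= k /\ (z0 * C_derive w z0)%C = (RtoC k * w z0)%C.
Proof.
  intros Hw H0 Hz0 Hne E1 Hmax. pose proof (hol_derive 1 w z0 Hw Hz0) as HD. set (l := C_derive w z0) in *.
  destruct (contact_modulus w z0 l HD) as (k & Hk & Ek).
  { intros z Hz. rewrite E1. apply Hmax, Hz. }
  assert (Ew : (w z0 * Cconj (w z0) = 1)%C) by (rewrite <- Cmod2_conj, E1; f_equal; ring).
  exists k. split.
  - destruct (schwarz (fun z => w (z0 * z)%C)) as (v & Hv & Ev & Bv).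
    + intros z Hz. apply (cdiff_comp w (fun z => z0 * z)%C); [|ch]. apply Hw. rewrite Cmod_mult.
      pose proof (Cmod_ge_0 z). pose proof (Cmod_ge_0 z0). nra.
    + replace (z0 * 0)%C with (RtoC 0) by ring. exact H0.
    + intros z Hz. apply Hmax. rewrite Cmod_mult. pose proof (Cmod_ge_0 z0). nra.
    + assert (Hb : forall t, 0 < t <= 1 -> Cmod (w (RtoC t * z0)%C) <= t).
      { intros t Ht. destruct (Rle_lt_or_eq_dec _ _ (proj2 Ht)) as [L|L].
        - replace (RtoC t * z0)%C with (z0 * RtoC t)%C by ring. rewrite Ev by (rewrite Cmod_R, Rabs_pos_eq; lra).
          rewrite Cmod_mult, Cmod_R, Rabs_pos_eq by lra. specialize (Bv (RtoC t)).
          rewrite Cmod_R, Rabs_pos_eq in Bv by lra. specialize (Bv L). pose proof (Cmod_ge_0 (v (RtoC t))). nra.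
        - subst t. replace (RtoC 1 * z0)%C with z0 by ring. lra. }
      assert (D1 : rderiv (fun t => RtoC t * z0)%C 1 z0).
      { eapply rderiv_eq.
        - apply (rderiv_mult (fun t => RtoC t) (fun _ => z0)); [apply rderiv_RtoC, (is_derive_id (K := R_AbsRing))|apply rderiv_const].
        - change (RtoC one) with (RtoC 1). ring. }
      assert (D2 : rderiv (fun t => w (RtoC t * z0)%C) 1 (l * z0)%C).
      { apply (rderiv_comp w (fun t => RtoC t * z0)%C); [|exact D1]. replace (RtoC 1 * z0)%C with z0 by ring. exact HD. }
      destruct D2 as [D2 D3].
      pose proof (is_derive_plus (K := R_AbsRing) (V := R_NormedModule) _ _ _ _ _
        (is_derive_Rmult _ _ _ _ _ D2 D2) (is_derive_Rmult _ _ _ _ _ D3 D3)) as D4.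
      pose proof (is_derive_Rmult _ _ _ _ _ (is_derive_id (K := R_AbsRing) 1) (is_derive_id (K := R_AbsRing) 1)) as D5.
      pose proof (is_derive_minus (K := R_AbsRing) (V := R_NormedModule) _ _ _ _ _ D5 D4) as D6.
      (* The function [t ^ 2 - Cmod (w (t * z0)) ^ 2] is nonnegative to the left of 1 and vanishes
         at 1, so its derivative [2 - 2 * k] there is at most 0. *)
      apply derive_left_min in D6.
      * replace (RtoC 1 * z0)%C with z0 in D6 by ring.
        apply (f_equal Re) in Ek. change (Re (RtoC k)) with k in Ek.
        unfold minus, plus, opp, one in D6; simpl in D6. unfold Re, Im in *. simpl in *. lra.
      * intros t Ht. specialize (Hb t ltac:(lra)). replace (RtoC 1 * z0)%C with z0 by ring.
        assert (B2 : Cmod (w (RtoC t * z0)%C) ^ 2 <= t ^ 2) by (apply pow_incr; split; [apply Cmod_ge_0|exact Hb]).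
        pose proof (Cmod2_alt (w z0)) as F1. rewrite E1 in F1. rewrite Cmod2_alt in B2.
        unfold minus, plus, opp; simpl. unfold Re, Im in *. simpl in B2, F1. lra.
  - rewrite <- Ek. replace (z0 * l * Cconj (w z0) * w z0)%C with (z0 * l * (w z0 * Cconj (w z0)))%C by ring.
    rewrite Ew. ring.
Qed.

(** A continuous angle that starts at 0 and keeps a positive cosine cannot cross a right angle. The
    reparametrisation [(1 - cos s) / 2] maps the line onto the unit interval and gives the
    everywhere continuous function that [IVT_gen] asks for. *)
Lemma cos_pos_interval (phi : R -> R) : (forall t, 0 <= t <= 1 -> ctsR phi t) -> phi 0 = 0 ->
  (forall t, 0 <= t <= 1 -> 0 < cos (phi t)) -> - (PI / 2) < phi 1 < PI / 2.
Proof.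
  intros Hc H0 Hpos. pose proof PI_RGT_0.
  assert (Hs : forall s, 0 <= (1 - cos s) / 2 <= 1) by (intros s; pose proof (COS_bound s); lra).
  assert (K0 : forall psi : R -> R, (forall t, 0 <= t <= 1 -> ctsR psi t) -> psi 0 = 0 ->
     (forall t, 0 <= t <= 1 -> 0 < cos (psi t)) -> psi 1 < PI / 2).
  { intros psi Pc P0 Pp. apply Rnot_le_lt. intros L.
    assert (E0 : psi ((1 - cos 0) / 2) = 0) by (rewrite cos_0; replace ((1 - 1) / 2) with 0 by field; exact P0).
    assert (E1 : psi ((1 - cos PI) / 2) = psi 1) by (rewrite cos_PI; f_equal; field).
    destruct (IVT_gen (fun s => psi ((1 - cos s) / 2)) 0 PI (PI / 2)) as (s & _ & E).
    - intros s. apply continuity_pt_filterlim. apply (continuous_comp (fun s => (1 - cos s) / 2) psi).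
      + pose proof (continuous_id (U := R_UniformSpace) s). ct. lra.
      + apply Pc, Hs.
    - cbv beta. rewrite E0, E1, Rmin_left, Rmax_right; lra.
    - specialize (Pp _ (Hs s)). rewrite E, cos_PI2 in Pp. lra. }
  split.
  - assert (- phi 1 < PI / 2); [|lra]. apply (K0 (fun t => - phi t)).
    + intros t Ht. apply cont_Ropp, Hc, Ht.
    + rewrite H0. ring.
    + intros t Ht. rewrite cos_neg. apply Hpos, Ht.
  - apply K0; assumption.
Qed.

(** The left side is [cos (2 a f) cos f - k cos ((2 a - 1) f)]. Since [0 < a <= 1], the last cosine
    is positive, so [k] may be lowered to 1, leaving [- sin f * sin (2 a f)]; the two sines have the
    same sign because [2 a f] stays between [- PI] and [PI]. *)
Lemma contact_trig (a k f : R) : 0 < a <= 1 -> 1 <= k -> - (PI / 2) < f < PI / 2 ->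
  (1 - k) * cos (2 * a * f) * cos f - k * sin f * sin (2 * a * f) <= 0.
Proof.
  intros Ha Hk Hf. pose proof PI_RGT_0.
  assert (Hd : 0 < cos (2 * a * f - f)).
  { apply cos_gt_0; nra. }
  rewrite cos_minus in Hd.
  assert (Hs : 0 <= sin f * sin (2 * a * f)).
  { destruct (Rle_lt_dec 0 f) as [L|L].
    - apply Rmult_le_pos; apply sin_ge_0; nra.
    - replace (sin f * sin (2 * a * f)) with (sin (- f) * sin (- (2 * a * f))) by (rewrite !sin_neg; ring).
      apply Rmult_le_pos; apply sin_ge_0; nra. }
  nra.
Qed.

(* With [w = 1 - exp (- h / 2)] the claim is [|w z| <= |z|]; at a first contact [|w| = 1] Jack's lemma
   gives [1 + z h' = 1 + 2 k w / (1 - w)] with [k >= 1], and then the real part is not positive. *)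
Lemma half_plane_root (alpha : R) (h : C -> C) : 0 < alpha <= 1 -> hol 1 h -> h 0%C = 0%C ->
  (forall z, Cmod z < 1 -> 0 < Re (Cexp (RtoC alpha * h z) * (1 + z * C_derive h z))%C) ->
  exists w, hol 1 w /\ (forall z, Cmod z < 1 -> Cmod (w z) <= Cmod z) /\
    forall z, Cmod z < 1 -> (1 - w z)%C = Cexp (- (/ 2 * h z))%C.
Proof.
  intros Ha Hh Hh0 HRe. set (w := fun z => (1 - Cexp (- (/ 2 * h z)))%C).
  assert (Hw : hol 1 w).
  { intros z Hz. specialize (Hh z Hz). unfold w. ch. }
  assert (Hw0 : w 0%C = 0%C).
  { unfold w. rewrite Hh0. replace (- (/ 2 * 0))%C with (RtoC 0) by ring. rewrite Cexp_0. ring. }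
  assert (Hlt : forall z, Cmod z < 1 -> Cmod (w z) < 1).
  { intros z1 Hz1. apply Rnot_le_lt. intros L.
    destruct (first_contact (fun z => 1 - Cmod (w z)) z1) as (z0 & Hz0 & E0 & Hin & Hmin).
    - intros z Hz. apply cont_Rminus; [apply continuous_const|]. apply cont_Cmod, cdiff_cont, Hw, Hz.
    - rewrite Hw0, Cmod_0. lra.
    - exact Hz1.
    - lra.
    - assert (Hne : z0 <> 0%C). { intros ->. rewrite Hw0, Cmod_0 in E0. lra. }
      assert (E1 : Cmod (w z0) = 1) by lra.
      destruct (jack w z0 Hw Hw0 Hz0 Hne E1) as (k & Hk & Ek).
      { intros z Hz. specialize (Hmin z Hz). lra. }
      assert (Dw : C_derive w z0 = (/ 2 * C_derive h z0 * (1 - w z0))%C).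
      { apply cderiv_unique. unfold w. eapply cderiv_eq.
        - apply cderiv_minus; [apply cderiv_const|].
          apply (cderiv_comp Cexp (fun z => - (/ 2 * h z))%C); [apply cderiv_Cexp|].
          apply cderiv_opp. apply (cderiv_mult (fun _ => / 2)%C h); [apply cderiv_const|apply (hol_derive 1); assumption].
        - cbv beta. ring. }
      set (g := (/ 2 * h z0)%C).
      assert (Eg : (1 - w z0)%C = Cexp (- g)) by (unfold w, g; ring).
      assert (Hn : (1 - w z0)%C <> 0%C) by (rewrite Eg; apply Cexp_neq_0).
      assert (Ezh : (1 + z0 * C_derive h z0 = RtoC (1 - 2 * k) + RtoC (2 * k) * Cexp g)%C).
      { rewrite Dw in Ek.
        assert (Ez : (z0 * C_derive h z0 = 2 * RtoC k * w z0 / (1 - w z0))%C).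
        { replace (z0 * C_derive h z0)%C with (2 * (z0 * (/ 2 * C_derive h z0 * (1 - w z0))) / (1 - w z0))%C by (field; exact Hn).
          rewrite Ek. field. exact Hn. }
        rewrite Ez. replace (Cexp g) with (/ (1 - w z0))%C by (rewrite Eg, Cexp_opp; field; apply Cexp_neq_0).
        rewrite RtoC_minus, RtoC_mult. field. exact Hn. }
      specialize (HRe z0 Hz0). rewrite Ezh in HRe.
      replace (RtoC alpha * h z0)%C with (RtoC (2 * alpha) * g)%C in HRe by (unfold g; rewrite RtoC_mult; field).
      (* Hence [Cmod (w z) <= 1] forces the cosine of [Im (h z / 2)] to be positive. Along the
         segment from 0 to [z0] this keeps the continuous branch of that angle between [- PI / 2]
         and [PI / 2], as [contact_trig] requires. *)
      assert (Hpol : forall z, 1 - Cmod (w z) ^ 2 = exp (- Re (/ 2 * h z)%C) * (2 * cos (Im (/ 2 * h z)%C) - exp (- Re (/ 2 * h z)%C))).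
      { intros z. unfold w. set (q := (/ 2 * h z)%C). destruct q as [x y]. rewrite Cmod2_alt. unfold Cexp. simpl.
        rewrite cos_neg, sin_neg. pose proof (sin2_cos2 y) as SC. unfold Rsqr in SC.
        set (X := exp (- x)). unfold Re, Im; simpl. apply Rminus_diag_uniq.
        match goal with |- ?l = 0 => replace l with (X * X * (1 - (sin y * sin y + cos y * cos y))) by ring end.
        rewrite SC. ring. }
      set (phi := fun t => Im (/ 2 * h (RtoC t * z0))%C).
      assert (Hphi : - (PI / 2) < phi 1 < PI / 2).
      { apply cos_pos_interval.
        - intros t Ht. unfold phi. assert (Ch : ctsC (fun t => h (RtoC t * z0)%C) t).
          { apply (cont_hol 1 h); [exact Hh| |].
            - pose proof (continuous_id (U := R_UniformSpace) t). apply cont_Cmult; [apply cont_RtoC; assumption|apply continuous_const].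
            - rewrite Cmod_mult, Cmod_R, Rabs_pos_eq by lra. pose proof (Cmod_ge_0 z0). nra. }
          apply (cont_Im (fun t => / 2 * h (RtoC t * z0))%C). apply cont_Cmult; [apply continuous_const|exact Ch].
        - unfold phi. replace (RtoC 0 * z0)%C with (RtoC 0) by ring. rewrite Hh0. replace (/ 2 * 0)%C with (RtoC 0) by ring. reflexivity.
        - intros t Ht. specialize (Hpol (RtoC t * z0)%C). fold (phi t) in Hpol.
          set (X := exp (- Re (/ 2 * h (RtoC t * z0))%C)) in *. assert (HX : 0 < X) by apply exp_pos.
          assert (Hwt : Cmod (w (RtoC t * z0)%C) <= 1).
          { specialize (Hmin (RtoC t * z0)%C). rewrite Cmod_mult, Cmod_R, Rabs_pos_eq in Hmin by lra.
            pose proof (Cmod_ge_0 z0). specialize (Hmin ltac:(nra)). lra. }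
          pose proof (Cmod_ge_0 (w (RtoC t * z0)%C)). assert (0 <= X * (2 * cos (phi t) - X)) by nra. nra. }
      unfold phi in Hphi. replace (RtoC 1 * z0)%C with z0 in Hphi by ring. fold g in Hphi.
      specialize (Hpol z0). fold g in Hpol. rewrite E1 in Hpol.
      destruct g as [x y]. simpl Re in Hpol. simpl Im in Hpol, Hphi.
      set (X := exp (- x)) in *. assert (HX : 0 < X) by apply exp_pos.
      (* The contact condition [Cmod (w z0) = 1] in coordinates. It eliminates [x]: multiplied by
         the positive number [cos y / A], the real part in [HRe] becomes the expression of
         [contact_trig]. *)
      assert (EX : X = 2 * cos y) by nra.
      assert (Eex : exp x * X = 1) by (unfold X; rewrite <- exp_plus, Rplus_opp_r, exp_0; reflexivity).
      pose proof (contact_trig alpha k y Ha Hk Hphi) as CT.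
      replace (RtoC (2 * alpha) * (x, y))%C with ((2 * alpha * x, 2 * alpha * y) : C) in HRe by (apply C_ext; simpl; ring).
      unfold Cexp in HRe. simpl in HRe.
      set (A := exp (2 * alpha * x)) in *. assert (HA : 0 < A) by apply exp_pos.
      set (c2 := cos (2 * alpha * y)) in *. set (s2 := sin (2 * alpha * y)) in *.
      set (Y := exp x) in *.
      assert (E2 : Y * cos y * 2 = 1) by (rewrite <- Eex, EX; ring).
      assert (HRe2 : 0 < c2 * (1 - k) - s2 * (2 * k * Y * sin y)).
      { apply (Rmult_lt_reg_l A); [exact HA|]. rewrite Rmult_0_r. unfold Re in HRe. simpl in HRe.
        replace (A * (c2 * (1 - k) - s2 * (2 * k * Y * sin y))) with
          (A * c2 * (1 - 2 * k + k * (Y * cos y * 2)) - A * s2 * (2 * k * (Y * sin y))) by (rewrite E2; ring). lra. }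
      assert (Hcy : 0 < cos y) by lra.
      apply (Rmult_lt_compat_r (cos y)) in HRe2; [|exact Hcy].
      replace ((c2 * (1 - k) - s2 * (2 * k * Y * sin y)) * cos y) with
        ((1 - k) * c2 * cos y - k * sin y * s2 * (Y * cos y * 2)) in HRe2 by ring.
      rewrite E2 in HRe2. lra. }
  exists w. split; [exact Hw|]. split; [|intros z _; unfold w; ring].
  destruct (schwarz w Hw Hw0) as (v & Hv & Ev & Bv).
  - intros z Hz. apply Rlt_le, Hlt, Hz.
  - intros z Hz. rewrite Ev, Cmod_mult by exact Hz. specialize (Bv z Hz). pose proof (Cmod_ge_0 z). nra.
Qed.

(** * The class T *)

Lemma acos_lt (x e : R) : -1 <= x <= 1 -> 0 <= e <= PI -> cos e < x -> acos x < e.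
Proof.
  intros Hx He H. apply Rnot_le_lt. intros L. pose proof (acos_bound x) as B.
  assert (cos (acos x) <= cos e) by (apply cos_decr_1; lra). rewrite cos_acos in H0 by exact Hx. lra.
Qed.

Lemma cos_of_arg_bound (z : C) : z <> 0%C -> -1 <= Re z / Cmod z <= 1.
Proof.
  intros Hz. pose proof (proj1 (Cmod_gt_0 z) Hz). pose proof (re_le_Cmod z) as Hre. apply Rabs_le_between in Hre.
  split; apply (Rmult_le_reg_r (Cmod z)); try lra; unfold Rdiv; rewrite Rmult_assoc, Rinv_l by lra; lra.
Qed.

Lemma cos_of_arg_strict (z : C) : Im z <> 0 -> -1 < Re z / Cmod z < 1.
Proof.
  intros Hz. assert (Hz0 : z <> 0%C) by (intros ->; apply Hz; reflexivity).
  pose proof (proj1 (Cmod_gt_0 z) Hz0). pose proof (Cmod2_alt z) as E.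
  assert (0 < Im z ^ 2) by (apply pow2_gt_0; exact Hz).
  assert (Re z < Cmod z /\ - Cmod z < Re z) by (split; nra).
  split; apply (Rmult_lt_reg_r (Cmod z)); try lra; unfold Rdiv; rewrite Rmult_assoc, Rinv_l by lra; lra.
Qed.

Lemma cont_id_C (z : C) : ccont (fun w => w) z.
Proof. apply cdiff_cont, cdiff_id. Qed.

Lemma ucont_cos_of_arg (z : C) : z <> 0%C -> ucont (fun w => Re w / Cmod w) z.
Proof.
  intros Hz. pose proof (cont_id_C z). apply cont_Rdiv.
  - apply (cont_Re (fun w => w)). assumption.
  - apply (cont_Cmod (fun w => w)). assumption.
  - apply Rgt_not_eq, Cmod_gt_0, Hz.
Qed.

(** Off the real axis [Carg] is locally one of the branches [acos] and [- acos], smooth there. On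
    the positive axis the branches meet at the value 0, where [acos] is not differentiable;
    monotonicity of the cosine, through [acos_lt], bounds both branches at once. *)
Lemma Carg_cont (z : C) : (Im z <> 0 \/ 0 < Re z) -> ucont Carg z.
Proof.
  intros Hz. assert (Hz0 : z <> 0%C) by (intros ->; simpl in Hz; lra).
  assert (Hacos : Im z <> 0 -> ucont (fun w => acos (Re w / Cmod w)) z).
  { intros Hi. apply (cont_comp_R acos); [apply ucont_cos_of_arg, Hz0|].
    apply derivable_continuous_pt. apply derivable_pt_acos. apply cos_of_arg_strict, Hi. }
  assert (HIm : ucont Im z) by (apply (cont_Im (fun w => w)), cont_id_C).
  destruct (Rtotal_order (Im z) 0) as [L|[L|L]].
  - apply (continuous_ext_loc _ (fun w => - acos (Re w / Cmod w))).
    + apply locally_Cmod. destruct (ucont_eps Im z HIm (- Im z) ltac:(lra)) as (d & Hd & K0).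
      exists d. split; [exact Hd|]. intros w Hw. specialize (K0 w Hw). apply Rabs_lt_between in K0.
      unfold Carg. destruct (Rlt_dec (Im w) 0); [reflexivity|lra].
    + apply cont_Ropp, Hacos. lra.
  - destruct Hz as [Hz|Hz]; [contradiction|].
    assert (Ez : Re z / Cmod z = 1).
    { pose proof (Cmod2_alt z) as E. rewrite L in E. pose proof (Cmod_ge_0 z).
      assert (Cmod z = Re z) by nra. rewrite H0. field. lra. }
    assert (Cz : Carg z = 0).
    { unfold Carg. destruct (Rlt_dec (Im z) 0); [lra|]. rewrite Ez. apply acos_1. }
    intros P HP. apply locally_R in HP. destruct HP as (e & He & HP). rewrite Cz in HP.
    set (e' := Rmin e (PI / 2)). pose proof PI_RGT_0.
    assert (He' : 0 < e') by (apply Rmin_pos; lra). assert (e' <= PI / 2) by apply Rmin_r. assert (e' <= e) by apply Rmin_l.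
    assert (Hce : cos e' < 1). { rewrite <- cos_0. apply cos_decreasing_1; lra. }
    destruct (ucont_eps _ z (ucont_cos_of_arg z Hz0) (1 - cos e') ltac:(lra)) as (d & Hd & K0).
    apply locally_Cmod. exists (Rmin d (Cmod z)). split; [apply Rmin_pos; [lra|apply Cmod_gt_0, Hz0]|].
    intros w Hw. pose proof (Rmin_l d (Cmod z)). pose proof (Rmin_r d (Cmod z)).
    assert (Hw0 : w <> 0%C). { intros ->. rewrite Cmod_sub_sym in Hw. replace (z - 0)%C with z in Hw by ring. lra. }
    specialize (K0 w ltac:(lra)). rewrite Ez in K0. apply Rabs_lt_between in K0.
    pose proof (acos_lt (Re w / Cmod w) e' (cos_of_arg_bound w Hw0) ltac:(lra) ltac:(lra)).
    pose proof (acos_bound (Re w / Cmod w)). apply HP. rewrite Rminus_0_r.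
    unfold Carg. apply Rabs_lt_between. destruct (Rlt_dec (Im w) 0); lra.
  - apply (continuous_ext_loc _ (fun w => acos (Re w / Cmod w))).
    + apply locally_Cmod. destruct (ucont_eps Im z HIm (Im z) ltac:(lra)) as (d & Hd & K0).
      exists d. split; [exact Hd|]. intros w Hw. specialize (K0 w Hw). apply Rabs_lt_between in K0.
      unfold Carg. destruct (Rlt_dec (Im w) 0); [lra|reflexivity].
    + apply Hacos. lra.
Qed.

(** [Clog] is a continuous right inverse of [Cexp], whose derivative at [Clog z] is [z] itself; so
    [cderiv_lift] applies. *)
Lemma Clog_cderiv (z : C) : (Im z <> 0 \/ 0 < Re z) -> cderiv Clog z (1 / z)%C.
Proof.
  intros Hz. assert (Hz0 : z <> 0%C) by (intros ->; simpl in Hz; lra).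
  apply (cderiv_lift Cexp (fun w => w) Clog z z 1 (Cmod z)).
  - pose proof (cderiv_Cexp (Clog z)) as D. rewrite (Cexp_Clog z Hz0) in D. exact D.
  - apply cderiv_id.
  - exact Hz0.
  - apply cont_C. split; simpl.
    + apply cont_ln; [apply (cont_Cmod (fun w => w)), cont_id_C|apply Cmod_gt_0, Hz0].
    + apply Carg_cont, Hz.
  - apply Cmod_gt_0, Hz0.
  - intros w Hw. apply Cexp_Clog. intros ->. rewrite Cmod_sub_sym in Hw. replace (z - 0)%C with z in Hw by ring. lra.
Qed.

Lemma Cpower_cderiv (z : C) (s : R) : Im z <> 0 -> cderiv (fun w => Cpower w s) z (RtoC s / z * Cpower z s)%C.
Proof.
  intros Hz. assert (Hz0 : z <> 0%C) by (intros ->; apply Hz; reflexivity).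
  unfold Cpower. eapply cderiv_eq.
  - apply (cderiv_comp Cexp (fun w => RtoC s * Clog w)%C); [apply cderiv_Cexp|].
    apply (cderiv_mult (fun _ => RtoC s) Clog); [apply cderiv_const|apply Clog_cderiv; tauto].
  - field. exact Hz0.
Qed.

Lemma Cmod_Cpower (z : C) (s : R) : Cmod (Cpower z s) = exp (s * ln (Cmod z)).
Proof. unfold Cpower. rewrite Cmod_Cexp. f_equal. unfold Clog, Re. simpl. ring. Qed.

(** Iterates of [1 + beta * z d/dz]. For [beta = / alpha] this is what remains of the Salagean
    operator after division by [alpha ^ k * z ^ alpha], and [ravg beta 0] is its left inverse. *)
Fixpoint euler_it (beta : R) (k : nat) (F : C -> C) : C -> C :=
  match k with
  | O => F
  | S j => fun z => (euler_it beta j F z + RtoC beta * (z * C_derive (euler_it beta j F) z))%C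
  end.

Lemma euler_it_hol beta k F : hol 1 F -> hol 1 (euler_it beta k F).
Proof.
  intros HF. induction k as [|k IH]; simpl; [exact HF|]. intros z Hz.
  pose proof (IH z Hz). pose proof (hol_C_derive 1 _ IH z Hz). ch.
Qed.

Lemma ravg_euler beta g z : 0 < beta -> hol 1 g -> Cmod z < 1 ->
  ravg beta 0 (fun u => g u + RtoC beta * (u * C_derive g u))%C z = g z.
Proof.
  intros Hb Hg Hz. pose proof (hol_C_derive 1 g Hg) as Hg'.
  assert (Hug : hol 1 (fun u => u * C_derive g u)%C) by (intros u Hu; specialize (Hg' u Hu); ch).
  rewrite ravg_plus; [|exact Hb|exact Hg| |exact Hz].
  2:{ intros u Hu. specialize (Hug u Hu). apply (cdiff_mult (fun _ => RtoC beta) (fun u => u * C_derive g u)%C); ch. }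
  rewrite ravg_scal by assumption. rewrite ravg_mult_id by assumption.
  rewrite (ravg_ode beta 0 g z Hb Hg Hz). rewrite ravg_C_derive by assumption. simpl INR.
  rewrite Rmult_0_r, Rplus_0_r. ring.
Qed.

Lemma ravg_iter_euler beta F i j z : 0 < beta -> hol 1 F -> Cmod z < 1 ->
  ravg_iter beta 0 j (euler_it beta (j + i) F) z = euler_it beta i F z.
Proof.
  intros Hb HF. revert i z. induction j as [|j IH]; intros i z Hz; [reflexivity|].
  simpl ravg_iter. rewrite (ravg_ext beta 0 _ (euler_it beta (S i) F)).
  - apply ravg_euler; [exact Hb|apply euler_it_hol, HF|exact Hz].
  - exact Hb.
  - intros u Hu. pose proof (IH (S i) u ltac:(lra)) as E. replace (j + S i)%nat with (S j + i)%nat in E by lia. exact E.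
Qed.

Lemma off_axis_open (z : C) : Cmod z < 1 -> Im z <> 0 ->
  exists d, 0 < d /\ forall w, Cmod (w - z) < d -> Cmod w < 1 /\ Im w <> 0.
Proof.
  intros Hz Hi. exists (Rmin (1 - Cmod z) (Rabs (Im z))). split.
  - apply Rmin_pos; [lra|]. apply Rabs_pos_lt, Hi.
  - intros w Hw. pose proof (Rmin_l (1 - Cmod z) (Rabs (Im z))). pose proof (Rmin_r (1 - Cmod z) (Rabs (Im z))).
    split.
    + replace w with (z + (w - z))%C by ring. apply Rle_lt_trans with (1 := Cmod_triangle _ _). lra.
    + intros E. pose proof (im_le_Cmod (w - z)) as I. replace (Im (w - z)%C) with (- Im z) in I by (simpl; unfold Im in *; lra).
      rewrite Rabs_Ropp in I. lra.
Qed.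

(** Restricted to nonreal points, an open set on which the induction hypothesis can be
    differentiated. Real points, including those on the slit, are recovered by continuity in
    [eq_off_axis]. *)
Lemma salagean_power (alpha : R) (F : C -> C) (k : nat) (z : C) : 0 < alpha -> hol 1 F -> Cmod z < 1 -> Im z <> 0 ->
  salagean k (fun u => Cpower u alpha * F u)%C z = (RtoC (alpha ^ k) * Cpower z alpha * euler_it (/ alpha) k F z)%C.
Proof.
  intros Ha HF. revert z. induction k as [|k IH]; intros z Hz Hi.
  - simpl. ring.
  - simpl salagean. destruct (off_axis_open z Hz Hi) as (d & Hd & Ho).
    assert (Hz0 : z <> 0%C) by (intros ->; apply Hi; reflexivity).
    assert (Ha0 : RtoC alpha <> 0%C) by (apply RtoC_neq_0; lra).
    set (Pk := euler_it (/ alpha) k F). assert (HP : hol 1 Pk) by (apply euler_it_hol, HF).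
    assert (D : cderiv (salagean k (fun u => Cpower u alpha * F u)%C) z
       (RtoC (alpha ^ k) * (RtoC alpha / z * Cpower z alpha) * Pk z + RtoC (alpha ^ k) * Cpower z alpha * C_derive Pk z)%C).
    { apply (cderiv_ext_loc (fun u => RtoC (alpha ^ k) * Cpower u alpha * Pk u)%C _ z _ d Hd).
      - intros w Hw. symmetry. apply IH; apply Ho, Hw.
      - apply (cderiv_mult (fun u => RtoC (alpha ^ k) * Cpower u alpha)%C Pk).
        + eapply cderiv_eq.
          * apply (cderiv_mult (fun _ => RtoC (alpha ^ k)) (fun u => Cpower u alpha)); [apply cderiv_const|apply Cpower_cderiv, Hi].
          * ring.
        + apply (hol_derive 1); assumption. }
    rewrite (cderiv_unique _ _ _ D). simpl euler_it. fold Pk. simpl pow. rewrite RtoC_mult, RtoC_inv by lra.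
    field. auto.
Qed.

Lemma eq_off_axis (f g : C -> C) : hol 1 f -> hol 1 g -> (forall z, Cmod z < 1 -> Im z <> 0 -> f z = g z) ->
  forall z, Cmod z < 1 -> f z = g z.
Proof.
  intros Hf Hg E z Hz. destruct (Req_dec (Im z) 0) as [Hi|Hi]; [|apply E; assumption].
  apply NNPP. intros Hn. apply Csub_neq_0 in Hn. apply Cmod_gt_0 in Hn. set (m := Cmod (f z - g z)) in *.
  assert (Hc : ccont (fun w => f w - g w)%C z).
  { apply cont_Cminus; apply cdiff_cont; [apply Hf|apply Hg]; exact Hz. }
  destruct (proj1 (ccont_eps (fun w => f w - g w)%C z) Hc m Hn) as (d & Hd & K0).
  set (e := Rmin d (1 - Cmod z) / 2). assert (He0 : 0 < Rmin d (1 - Cmod z)) by (apply Rmin_pos; lra).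
  pose proof (Rmin_l d (1 - Cmod z)). pose proof (Rmin_r d (1 - Cmod z)).
  assert (Ew : Cmod (RtoC e * Ci) = e) by (rewrite Cmod_mult, Cmod_R, Cmod_Ci, Rabs_pos_eq by (unfold e; lra); ring).
  specialize (K0 (z + RtoC e * Ci)%C). replace (z + RtoC e * Ci - z)%C with (RtoC e * Ci)%C in K0 by ring.
  rewrite Ew in K0. specialize (K0 ltac:(unfold e; lra)). cbv beta in K0.
  rewrite (E (z + RtoC e * Ci)%C) in K0.
  - replace (g (z + RtoC e * Ci)%C - g (z + RtoC e * Ci)%C - (f z - g z))%C with (- (f z - g z))%C in K0 by ring.
    rewrite Cmod_opp in K0. fold m in K0. lra.
  - apply Rle_lt_trans with (1 := Cmod_triangle _ _). rewrite Ew. unfold e. lra.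
  - simpl. unfold Im in Hi. rewrite Hi. unfold e. lra.
Qed.

(** Of the [n] Euler operators applied to [F], the averages undo [n - 1]. The remaining one is
    computed: [F + (z / alpha) * F'] with [F = exp (alpha h)] is [exp (alpha h) * (1 + z h')]. *)
Lemma class_T_structure (n : nat) (alpha a b : R) (f : C -> C) : 0 < alpha -> (1 <= n)%nat -> class_T n alpha a b f ->
  exists h p, hol 1 h /\ h 0%C = 0%C /\ janowski a b p /\
    (forall z, Cmod z < 1 -> (Cexp (RtoC alpha * h z) * (1 + z * C_derive h z))%C = ravg_iter (/ alpha) 0 (n - 1) p z) /\
    (forall z, Cmod z < 1 -> C_derive f z = (Cexp (h z) * (1 + z * C_derive h z))%C).
Proof.
  intros Ha Hn (HA & _ & F & (h & Hh & Hh0 & HfF) & p & Hp & Hsal).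
  assert (Hb : 0 < / alpha) by (apply Rinv_0_lt_compat, Ha).
  assert (Ha0 : RtoC alpha <> 0%C) by (apply RtoC_neq_0; lra).
  assert (Hhol : hol 1 h) by exact Hh. assert (Hphol : hol 1 p) by apply Hp.
  assert (HFd : forall z, Cmod z < 1 -> cderiv F z (Cexp (RtoC alpha * h z) * (RtoC alpha * C_derive h z))%C).
  { intros z Hz. apply (cderiv_ext_loc (fun w => Cexp (RtoC alpha * h w)) _ z _ (1 - Cmod z)); [lra| |].
    - intros w Hw. symmetry. apply HfF. replace w with (z + (w - z))%C by ring.
      apply Rle_lt_trans with (1 := Cmod_triangle _ _). lra.
    - eapply cderiv_eq.
      + apply (cderiv_comp Cexp (fun w => RtoC alpha * h w)%C); [apply cderiv_Cexp|].
        apply (cderiv_mult (fun _ => RtoC alpha) h); [apply cderiv_const|apply (hol_derive 1); assumption].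
      + ring. }
  assert (HF : hol 1 F) by (intros z Hz; eexists; apply HFd, Hz).
  assert (HPn : forall z, Cmod z < 1 -> euler_it (/ alpha) n F z = p z).
  { apply eq_off_axis; [apply euler_it_hol, HF|exact Hphol|]. intros z Hz Hi.
    assert (Hslit : slit_disk z) by (split; [exact Hz|tauto]).
    rewrite <- (Hsal z Hslit), salagean_power by assumption.
    assert (RtoC (alpha ^ n) <> 0%C) by (apply RtoC_neq_0, pow_nonzero; lra).
    assert (Cpower z alpha <> 0%C) by apply Cexp_neq_0. field. auto. }
  exists h, p. split; [exact Hhol|]. split; [exact Hh0|]. split; [exact Hp|]. split.
  - intros z Hz. rewrite <- (ravg_iter_ext (/ alpha) 0 (n - 1) (euler_it (/ alpha) ((n - 1) + 1) F)); [|exact Hb|].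
    + rewrite ravg_iter_euler by assumption. simpl. destruct (HfF z Hz) as [_ EF]. rewrite EF, (cderiv_unique _ _ _ (HFd z Hz)).
      rewrite RtoC_inv by lra. field. exact Ha0.
    + intros u Hu. replace (n - 1 + 1)%nat with n by lia. apply HPn. lra.
  - intros z Hz. apply cderiv_unique.
    apply (cderiv_ext_loc (fun w => w * Cexp (h w))%C _ z _ (1 - Cmod z)); [lra| |].
    + intros w Hw. symmetry. apply HfF. replace w with (z + (w - z))%C by ring.
      apply Rle_lt_trans with (1 := Cmod_triangle _ _). lra.
    + eapply cderiv_eq.
      * apply cderiv_mult; [apply cderiv_id|]. apply (cderiv_comp Cexp h); [apply cderiv_Cexp|apply (hol_derive 1); assumption].
      * cbv beta. ring.
Qed.

(** * Angular monotonicity *)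

(* The numerator of the derivative of [L0_pair] in [x]; with [c = a - b] it is [c] times
   [s (1 - b^2 s^2) Dt^2 + t (1 - b^2 t^2) Ds^2 - c b W] for the explicit [W >= 0] below. *)
Lemma pair_polynomial_nonneg (a b s t x : R) : -1 <= b -> b < a -> a <= 1 -> 0 <= t -> t <= s -> s <= 1 -> -1 <= x <= 1 ->
  0 <= ((a + b) * s * (1 + (a + b) * t * x + a * b * t ^ 2) + (1 + (a + b) * s * x + a * b * s ^ 2) * ((a + b) * t)
        - 2 * (a - b) ^ 2 * s * t * x)
       * ((1 + 2 * b * s * x + b ^ 2 * s ^ 2) * (1 + 2 * b * t * x + b ^ 2 * t ^ 2))
     - ((1 + (a + b) * s * x + a * b * s ^ 2) * (1 + (a + b) * t * x + a * b * t ^ 2) + (a - b) ^ 2 * s * t * (1 - x ^ 2))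
       * (2 * b * s * (1 + 2 * b * t * x + b ^ 2 * t ^ 2) + (1 + 2 * b * s * x + b ^ 2 * s ^ 2) * (2 * b * t)).
Proof.
  intros Hb Hab Ha Ht Hts Hs Hx.
  set (c := a - b). assert (Ea : a = b + c) by (unfold c; ring). assert (Hc : 0 < c <= 1 - b) by (unfold c; lra).
  clearbody c. subst a. replace (b + c - b) with c by ring.
  set (Ds := 1 + 2 * b * s * x + b ^ 2 * s ^ 2). set (Dt := 1 + 2 * b * t * x + b ^ 2 * t ^ 2).
  set (W := t ^ 2 * (s + t) * Ds ^ 2 + t * (s - t) * (1 - b ^ 2 * s ^ 2) * (t * Ds + s * Dt)).
  match goal with |- 0 <= ?e => replace e with
    (c * (s * (1 - b ^ 2 * s ^ 2) * Dt ^ 2 + t * (1 - b ^ 2 * t ^ 2) * Ds ^ 2 - c * b * W)) by (unfold W, Ds, Dt; ring) end.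
  apply Rmult_le_pos; [lra|].
  assert (HDs : 0 <= Ds).
  { unfold Ds. replace (1 + 2 * b * s * x + b ^ 2 * s ^ 2) with ((1 + b * s * x) ^ 2 + (b * s) ^ 2 * (1 - x ^ 2)) by ring.
    assert (0 <= (b * s) ^ 2 * (1 - x ^ 2)) by (apply Rmult_le_pos; [apply pow2_ge_0|nra]). pose proof (pow2_ge_0 (1 + b * s * x)). lra. }
  assert (HDt : 0 <= Dt).
  { unfold Dt. replace (1 + 2 * b * t * x + b ^ 2 * t ^ 2) with ((1 + b * t * x) ^ 2 + (b * t) ^ 2 * (1 - x ^ 2)) by ring.
    assert (0 <= (b * t) ^ 2 * (1 - x ^ 2)) by (apply Rmult_le_pos; [apply pow2_ge_0|nra]). pose proof (pow2_ge_0 (1 + b * t * x)). lra. }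
  assert (Hdiff : s * Dt - t * Ds = (s - t) * (1 - b ^ 2 * s * t)) by (unfold Ds, Dt; ring).
  clearbody Ds Dt.
  assert (Hb2 : b ^ 2 <= 1) by nra. assert (0 <= b ^ 2) by apply pow2_ge_0.
  assert (Hs2 : 0 <= s ^ 2 <= 1) by nra. assert (Ht2 : 0 <= t ^ 2 <= 1) by nra.
  assert (H1 : 0 <= 1 - b ^ 2 * s ^ 2) by nra. assert (H2 : 0 <= 1 - b ^ 2 * t ^ 2) by nra.
  assert (HDs2 : 0 <= Ds ^ 2) by apply pow2_ge_0. assert (HDt2 : 0 <= Dt ^ 2) by apply pow2_ge_0.
  (* For [b <= 0] all three terms have the right sign. For [b > 0] the bound [c <= 1 - b] gives
     [c * b <= b - b ^ 2], and the two parts of [W] are charged separately to the two positive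
     terms, in [A1] and [A2]. *)
  destruct (Rle_lt_dec b 0) as [Lb|Lb].
  - assert (HW : 0 <= W).
    { unfold W. apply Rplus_le_le_0_compat.
      - apply Rmult_le_pos; [|exact HDs2]. apply Rmult_le_pos; lra.
      - apply Rmult_le_pos; [apply Rmult_le_pos; [apply Rmult_le_pos; lra|exact H1]|].
        apply Rplus_le_le_0_compat; apply Rmult_le_pos; lra. }
    assert (0 <= s * (1 - b ^ 2 * s ^ 2) * Dt ^ 2) by (apply Rmult_le_pos; [apply Rmult_le_pos; lra|exact HDt2]).
    assert (0 <= t * (1 - b ^ 2 * t ^ 2) * Ds ^ 2) by (apply Rmult_le_pos; [apply Rmult_le_pos; lra|exact HDs2]).
    assert (0 <= c * (- b) * W) by (apply Rmult_le_pos; [apply Rmult_le_pos; lra|exact HW]). lra.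
  - set (e := c * b). assert (He : 0 <= e <= b - b ^ 2) by (unfold e; split; nra). clearbody e.
    assert (Hst : 0 <= s * t <= 1) by nra.
    assert (A1 : 0 <= 1 - b ^ 2 * t ^ 2 - e * t * (s + t)).
    { assert (Hq : 0 <= t * (s + t) <= 1 * (1 + t)) by (split; nra).
      assert (e * t * (s + t) <= (b - b ^ 2) * (t * s + t ^ 2)) by nra.
      assert ((b - b ^ 2) * (t * s + t ^ 2) + b ^ 2 * t ^ 2 <= 1); [|lra].
      assert (0 <= b - b ^ 2) by nra. assert (t * s <= 1) by nra.
      replace ((b - b ^ 2) * (t * s + t ^ 2) + b ^ 2 * t ^ 2) with ((b - b ^ 2) * (t * s) + b * t ^ 2) by ring. nra. }
    assert (A2 : 0 <= s * Dt ^ 2 - e * (t * (s - t)) * (t * Ds + s * Dt)).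
    { assert (B1 : 0 <= 1 - b ^ 2 * s * t) by nra.
      assert (B2 : t * Ds <= s * Dt) by nra.
      assert (B3 : (s - t) * (1 - b ^ 2 * s * t) <= s * Dt) by nra.
      assert (B4 : 2 * e * (s * t) <= 1 - b ^ 2 * s * t) by nra.
      assert (B5 : s * (2 * e * (t * (s - t))) <= s * Dt).
      { apply Rle_trans with (2 := B3). replace (s * (2 * e * (t * (s - t)))) with ((s - t) * (2 * e * (s * t))) by ring.
        apply Rmult_le_compat_l; lra. }
      assert (B6 : 0 <= e * (t * (s - t))) by (apply Rmult_le_pos; [lra|apply Rmult_le_pos; lra]).
      assert (B7 : e * (t * (s - t)) * (t * Ds + s * Dt) <= e * (t * (s - t)) * (2 * (s * Dt))) by (apply Rmult_le_compat_l; lra).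
      assert (B8 : Dt * (s * (2 * e * (t * (s - t)))) <= Dt * (s * Dt)) by (apply Rmult_le_compat_l; lra).
      nra. }
    replace (s * (1 - b ^ 2 * s ^ 2) * Dt ^ 2 + t * (1 - b ^ 2 * t ^ 2) * Ds ^ 2 - e * W) with
      ((1 - b ^ 2 * s ^ 2) * (s * Dt ^ 2 - e * (t * (s - t)) * (t * Ds + s * Dt)) + t * Ds ^ 2 * (1 - b ^ 2 * t ^ 2 - e * t * (s + t)))
      by (unfold W; ring).
    apply Rplus_le_le_0_compat; apply Rmult_le_pos; try assumption. apply Rmult_le_pos; assumption.
Qed.

Lemma L0_pair_denominator (b s x : R) : -1 <= b <= 1 -> 0 <= s < 1 -> -1 <= x <= 1 -> 0 < 1 + 2 * b * s * x + b ^ 2 * s ^ 2.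
Proof.
  intros Hb Hs Hx. assert (Hbs : -1 < b * s < 1) by (split; nra). set (e := b * s) in *.
  replace (1 + 2 * b * s * x + b ^ 2 * s ^ 2) with (1 + 2 * (e * x) + e ^ 2) by (unfold e; ring).
  destruct (Rle_lt_dec 0 e) as [L|L].
  - assert (- e <= e * x) by nra. assert (0 < (1 - e) ^ 2) by (apply pow_lt; lra). nra.
  - assert (e <= e * x) by nra. assert (0 < (1 + e) ^ 2) by (apply pow_lt; lra). nra.
Qed.

(** The real part of [L0 (s e^(ip))] times the conjugate of [L0 (t e^(ip))], as a function of
    [x = cos p]. *)
Definition L0_pair (a b s t x : R) : R :=
  ((1 + (a + b) * s * x + a * b * s ^ 2) * (1 + (a + b) * t * x + a * b * t ^ 2) + (a - b) ^ 2 * s * t * (1 - x ^ 2))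
  / ((1 + 2 * b * s * x + b ^ 2 * s ^ 2) * (1 + 2 * b * t * x + b ^ 2 * t ^ 2)).

Lemma L0_pair_monotone (a b s t x1 x2 : R) : -1 <= b -> b < a -> a <= 1 -> 0 <= s < 1 -> 0 <= t < 1 ->
  -1 <= x1 -> x1 <= x2 -> x2 <= 1 -> L0_pair a b s t x1 <= L0_pair a b s t x2.
Proof.
  intros Hb Hab Ha. revert s t.
  assert (K0 : forall s t, 0 <= t -> t <= s -> s < 1 -> -1 <= x1 -> x1 <= x2 -> x2 <= 1 -> L0_pair a b s t x1 <= L0_pair a b s t x2).
  { intros s t Ht Hts Hs H1 H12 H2.
    pose (df := fun x => (((a + b) * s * (1 + (a + b) * t * x + a * b * t ^ 2) + (1 + (a + b) * s * x + a * b * s ^ 2) * ((a + b) * t)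
        - 2 * (a - b) ^ 2 * s * t * x)
       * ((1 + 2 * b * s * x + b ^ 2 * s ^ 2) * (1 + 2 * b * t * x + b ^ 2 * t ^ 2))
     - ((1 + (a + b) * s * x + a * b * s ^ 2) * (1 + (a + b) * t * x + a * b * t ^ 2) + (a - b) ^ 2 * s * t * (1 - x ^ 2))
       * (2 * b * s * (1 + 2 * b * t * x + b ^ 2 * t ^ 2) + (1 + 2 * b * s * x + b ^ 2 * s ^ 2) * (2 * b * t)))
       / ((1 + 2 * b * s * x + b ^ 2 * s ^ 2) * (1 + 2 * b * t * x + b ^ 2 * t ^ 2)) ^ 2).
    assert (D : forall x, x1 <= x <= x2 -> is_derive (L0_pair a b s t) x (df x)).
    { intros x Hx. pose proof (L0_pair_denominator b s x ltac:(lra) ltac:(lra) ltac:(lra)) as P1.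
      pose proof (L0_pair_denominator b t x ltac:(lra) ltac:(lra) ltac:(lra)) as P2.
      unfold L0_pair, df. auto_derive.
      - apply Rgt_not_eq. simpl in P1, P2. apply Rmult_lt_0_compat; lra.
      - field. split; lra. }
    destruct (MVT_gen (L0_pair a b s t) x1 x2 df) as (x & Hx & E).
    - intros x Hx. rewrite Rmin_left, Rmax_right in Hx by lra. apply D. lra.
    - intros x Hx. rewrite Rmin_left, Rmax_right in Hx by lra. apply continuity_pt_filterlim.
      apply (ex_derive_continuous (K := R_AbsRing) (V := R_NormedModule)). eexists. apply D. lra.
    - rewrite Rmin_left, Rmax_right in Hx by lra. assert (0 <= df x * (x2 - x1)); [|lra].
      apply Rmult_le_pos; [|lra]. unfold df. apply Rmult_le_pos.
      + apply pair_polynomial_nonneg; lra.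
      + apply Rlt_le, Rinv_0_lt_compat, pow_lt, Rmult_lt_0_compat; apply L0_pair_denominator; lra. }
  intros s t Hs Ht H1 H12 H2. destruct (Rle_lt_dec t s) as [L|L]; [apply K0; lra|].
  assert (E : forall x, L0_pair a b s t x = L0_pair a b t s x) by (intros x; unfold L0_pair; f_equal; ring).
  rewrite !E. apply K0; lra.
Qed.

(** A form of angular monotonicity that survives averaging: the expression is additive in [g] and in
    [h], and averaging one of them only integrates over smaller radii at the same angle. Equal
    functions and equal radii give the squared modulus. *)
Definition pair_decreasing (g h : C -> C) : Prop :=
  forall s t p q, 0 <= s < 1 -> 0 <= t < 1 -> 0 <= p -> p <= q -> q <= PI ->
    Re (g (circle_point s q) * Cconj (h (circle_point t q)))%C <= Re (g (circle_point s p) * Cconj (h (circle_point t p)))%C.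

Lemma L0_pair_eq (a b s t p : R) : -1 <= b <= 1 -> 0 <= s < 1 -> 0 <= t < 1 ->
  Re (L0 a b (circle_point s p) * Cconj (L0 a b (circle_point t p)))%C = L0_pair a b s t (cos p).
Proof.
  intros Hb Hs Ht. pose proof (COS_bound p) as Cb.
  pose proof (L0_pair_denominator b s (cos p) Hb Hs Cb) as P1. pose proof (L0_pair_denominator b t (cos p) Hb Ht Cb) as P2.
  assert (E : forall u, 0 <= u < 1 -> L0 a b (circle_point u p) =
    ((1 + (a + b) * u * cos p + a * b * u ^ 2) / (1 + 2 * b * u * cos p + b ^ 2 * u ^ 2),
     (a - b) * u * sin p / (1 + 2 * b * u * cos p + b ^ 2 * u ^ 2)) :> C).
  { intros u Hu. pose proof (L0_pair_denominator b u (cos p) Hb Hu Cb) as P3.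
    assert (Hz : Cmod (circle_point u p) < 1) by (rewrite Cmod_circle_point; lra).
    pose proof (Cmod_bz b _ Hb Hz) as Hbz. pose proof (one_plus_neq_0 _ Hbz) as Hn.
    set (X := ((1 + (a + b) * u * cos p + a * b * u ^ 2) / (1 + 2 * b * u * cos p + b ^ 2 * u ^ 2),
     (a - b) * u * sin p / (1 + 2 * b * u * cos p + b ^ 2 * u ^ 2)) : C).
    unfold L0. assert (EX : (1 + RtoC a * circle_point u p = X * (1 + RtoC b * circle_point u p))%C).
    { rewrite circle_point_eq. unfold X.
      assert (SC : sin p * sin p = 1 - cos p * cos p) by (pose proof (sin2_cos2 p) as SC; unfold Rsqr in SC; lra).
      set (D := 1 + 2 * b * u * cos p + b ^ 2 * u ^ 2) in *. set (N := 1 + (a + b) * u * cos p + a * b * u ^ 2).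
      apply C_ext; simpl; apply (Rmult_eq_reg_r D); try lra.
      - match goal with |- _ = ?r * D => replace (r * D) with (N * (1 + b * u * cos p) - (a - b) * b * u * u * (sin p * sin p)) by (field; lra) end.
        rewrite SC. unfold N, D. ring.
      - match goal with |- _ = ?r * D => replace (r * D) with (N * (b * u * sin p) + (a - b) * u * sin p * (1 + b * u * cos p)) by (field; lra) end.
        unfold N, D. ring. }
    rewrite EX. field. exact Hn. }
  rewrite (E s Hs), (E t Ht). unfold L0_pair, Re. simpl fst.
  assert (SC : sin p * sin p = 1 - cos p ^ 2) by (pose proof (sin2_cos2 p) as SC; unfold Rsqr in SC; simpl; lra).
  rewrite <- SC. simpl. field. simpl in P1, P2. lra.
Qed.

Lemma L0_pair_decreasing (a b : R) : -1 <= b -> b < a -> a <= 1 -> pair_decreasing (L0 a b) (L0 a b).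
Proof.
  intros Hb Hab Ha s t p q Hs Ht Hp Hpq Hq. rewrite !L0_pair_eq by lra.
  apply L0_pair_monotone; try assumption; [apply COS_bound| |apply COS_bound].
  apply cos_decr_1; lra.
Qed.

Lemma pair_decreasing_sym g h : pair_decreasing g h -> pair_decreasing h g.
Proof.
  intros H s t p q Hs Ht Hp Hpq Hq. specialize (H t s p q Ht Hs Hp Hpq Hq).
  revert H. unfold Re. simpl. intros H. lra.
Qed.

Lemma ravg_0_Re_conj beta g c z : 0 < beta -> hol 1 g -> Cmod z < 1 ->
  Re (ravg beta 0 g z * c)%C = RInt (fun u => Re (g (RtoC (pw beta u) * z) * c)%C) 0 1 /\
  ex_RInt (fun u => Re (g (RtoC (pw beta u) * z) * c)%C) 0 1.
Proof.
  intros Hb Hg Hz. pose proof (ravg_cts beta 0 g z Hb Hg Hz) as C1.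
  assert (C2 : cts_on (fun u => c * (RtoC (pw beta u ^ 0) * g (RtoC (pw beta u) * z)))%C 0 1).
  { intros t Ht. apply cont_Cmult; [apply continuous_const|apply C1, Ht]. }
  assert (Ee : forall u, Re (c * (RtoC (pw beta u ^ 0) * g (RtoC (pw beta u) * z)))%C = Re (g (RtoC (pw beta u) * z) * c)%C).
  { intros u. f_equal. simpl pow. ring. }
  split.
  - rewrite Cmult_comm. unfold ravg. rewrite <- Cint_scal by (lra || exact C1). unfold Cint. simpl Re at 1.
    apply RInt_ext. intros u _. apply Ee.
  - apply (ex_RInt_ext (fun u => Re (c * (RtoC (pw beta u ^ 0) * g (RtoC (pw beta u) * z)))%C)).
    + intros u _. apply Ee.
    + apply (ex_RInt_Re _ 0 1 ltac:(lra) C2).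
Qed.

Lemma scale_circle_point (u s p : R) : (RtoC u * circle_point s p)%C = circle_point (u * s) p.
Proof. unfold circle_point. rewrite RtoC_mult. ring. Qed.

Lemma ravg_pair_decreasing beta g h : 0 < beta -> hol 1 g -> pair_decreasing g h -> pair_decreasing (ravg beta 0 g) h.
Proof.
  intros Hb Hg H s t p q Hs Ht Hp Hpq Hq.
  assert (Hc : forall x, Cmod (circle_point s x) < 1) by (intros x; rewrite Cmod_circle_point; lra).
  destruct (ravg_0_Re_conj beta g (Cconj (h (circle_point t q))) (circle_point s q) Hb Hg (Hc q)) as [E1 X1].
  destruct (ravg_0_Re_conj beta g (Cconj (h (circle_point t p))) (circle_point s p) Hb Hg (Hc p)) as [E2 X2].
  rewrite E1, E2. apply RInt_le; [lra|exact X1|exact X2|].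
  intros u Hu. rewrite !scale_circle_point. apply H; try assumption.
  pose proof (pw_ge_0 beta u). pose proof (pw_le_1 beta u Hb ltac:(lra)). nra.
Qed.

(** The two factors are averaged one after the other, with symmetry of the relation in between. *)
Lemma ravg_iter_pair_decreasing beta m g : 0 < beta -> hol 1 g -> pair_decreasing g g ->
  pair_decreasing (ravg_iter beta 0 m g) (ravg_iter beta 0 m g).
Proof.
  intros Hb Hg H. induction m as [|m IH]; simpl; [exact H|].
  assert (Hm : hol 1 (ravg_iter beta 0 m g)) by (apply ravg_iter_hol; assumption).
  apply ravg_pair_decreasing; try assumption. apply pair_decreasing_sym. apply ravg_pair_decreasing; assumption.
Qed.

Lemma Cmod_Lm_decreasing beta m a b r p q : 0 < beta -> -1 <= b -> b < a -> a <= 1 -> 0 <= r < 1 ->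
  0 <= p -> p <= q -> q <= PI ->
  Cmod (ravg_iter beta 0 m (L0 a b) (circle_point r q)) <= Cmod (ravg_iter beta 0 m (L0 a b) (circle_point r p)).
Proof.
  intros Hbe Hb Hab Ha Hr Hp Hpq Hq.
  pose proof (ravg_iter_pair_decreasing beta m (L0 a b) Hbe (L0_hol a b ltac:(lra)) (L0_pair_decreasing a b Hb Hab Ha) r r p q Hr Hr Hp Hpq Hq) as H.
  rewrite <- !Cmod2_conj in H. simpl in H.
  pose proof (Cmod_ge_0 (ravg_iter beta 0 m (L0 a b) (circle_point r q))). pose proof (Cmod_ge_0 (ravg_iter beta 0 m (L0 a b) (circle_point r p))).
  nra.
Qed.

Lemma ravg_iter_conj beta m a b z : 0 < beta -> -1 <= b <= 1 -> Cmod z < 1 ->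
  ravg_iter beta 0 m (L0 a b) (Cconj z) = Cconj (ravg_iter beta 0 m (L0 a b) z).
Proof.
  intros Hbe Hb. revert z. induction m as [|m IH]; intros z Hz; simpl.
  - unfold L0. pose proof (one_plus_neq_0 _ (Cmod_bz b z Hb Hz)).
    rewrite Cdiv_conj, !Cplus_conj, !Cmult_conj by assumption.
    assert (E : forall x : R, Cconj (RtoC x) = RtoC x) by (intros x; apply C_ext; simpl; ring).
    rewrite !E. reflexivity.
  - unfold ravg. rewrite <- Cint_conj; [|lra|].
    + apply Cint_ext; [lra|]. intros t Ht. rewrite Cmult_conj, <- IH.
      * assert (E : forall x : R, Cconj (RtoC x) = RtoC x) by (intros x; apply C_ext; simpl; ring).
        rewrite Cmult_conj, !E. reflexivity.
      * apply Rle_lt_trans with (2 := Hz). apply pw_disk; lra.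
    + apply ravg_cts; [exact Hbe|apply ravg_iter_hol; [exact Hbe|apply L0_hol; exact Hb]|exact Hz].
Qed.

(** * The integral inequality *)

Lemma Lfun_ravg_iter (alpha a b : R) (m : nat) (z : C) : 0 < alpha -> -1 <= b <= 1 -> Cmod z < 1 ->
  Lfun alpha a b m z = ravg_iter (/ alpha) 0 m (L0 a b) z.
Proof.
  intros Ha Hb. assert (Hbe : 0 < / alpha) by (apply Rinv_0_lt_compat, Ha).
  revert z. induction m as [|m IH]; intros z Hz; [reflexivity|].
  assert (HL : hol 1 (Lfun alpha a b m)).
  { intros u Hu. apply (cdiff_ext_loc (ravg_iter (/ alpha) 0 m (L0 a b)) _ u (1 - Cmod u)); [lra| |].
    - intros v Hv. symmetry. apply IH. replace v with (u + (v - u))%C by ring.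
      apply Rle_lt_trans with (1 := Cmod_triangle _ _). lra.
    - apply (ravg_iter_hol _ 0 m (L0 a b) Hbe (L0_hol a b Hb)). exact Hu. }
  change (Lfun alpha a b (S m) z) with (RtoC alpha * RInt_gen (V := C_R_CompleteNormedModule)
     (fun s : R => (RtoC (Rpower s (alpha - 1)) * Lfun alpha a b m (RtoC s * z))%C) (at_right 0) (at_point 1))%C.
  rewrite RInt_gen_ravg by assumption. simpl. apply ravg_ext; [exact Hbe|]. intros u Hu. apply IH. lra.
Qed.

Lemma L0_Re_pos (a b : R) (z : C) : -1 <= b -> b < a -> a <= 1 -> Cmod z < 1 -> 0 < Re (L0 a b z).
Proof.
  intros Hb Hab Ha Hz. pose proof (one_plus_neq_0 _ (Cmod_bz b z ltac:(lra) Hz)) as Hn.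
  unfold L0. replace ((1 + RtoC a * z) / (1 + RtoC b * z))%C with
    ((1 + RtoC a * z) * Cconj (1 + RtoC b * z) * RtoC (/ Cmod (1 + RtoC b * z) ^ 2))%C.
  2:{ rewrite RtoC_inv by (apply pow_nonzero, Rgt_not_eq, Cmod_gt_0, Hn). rewrite Cmod2_conj.
      pose proof (Cconj_neq_0 _ Hn). field. auto. }
  rewrite re_scal_r. apply Rmult_lt_0_compat; [|apply Rinv_0_lt_compat, pow_lt, Cmod_gt_0, Hn].
  assert (Hz2 : Cmod z ^ 2 < 1) by (pose proof (Cmod_ge_0 z); nra). rewrite Cmod2_alt in Hz2.
  destruct z as [x y]. unfold Re, Im in *. simpl in *.
  assert (Hx : -1 < x < 1) by (split; nra).
  replace ((1 + (a * x - 0 * y)) * (1 + (b * x - 0 * y)) - (0 + (a * y + 0 * x)) * - (0 + (b * y + 0 * x)))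
    with ((1 + a * x) * (1 + b * x) + a * b * (y * y)) by ring.
  set (q := y * y). assert (Hq : 0 <= q < 1 - x * x) by (unfold q; split; nra).
  assert (Hax : 0 <= 1 + a * x) by nra. assert (Hbx : 0 <= 1 + b * x) by nra.
  (* The expression is affine in [q], so only the ends of the range of [q] matter. *)
  assert (E0 : 0 <= (1 + a * x) * (1 + b * x)) by (apply Rmult_le_pos; assumption).
  assert (E1 : 0 <= (1 + a * x) * (1 + b * x) + a * b * (1 - x * x)).
  { replace ((1 + a * x) * (1 + b * x) + a * b * (1 - x * x)) with (1 + a * b + (a + b) * x) by ring.
    assert (- (1 + a * b) <= a + b <= 1 + a * b) by (split; nra). nra. }
  destruct (Rle_lt_dec 0 (a * b)) as [L|L].
  - destruct (Req_dec (a * b) 0) as [E2|E2].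
    + rewrite E2. assert (a = 0 \/ b = 0) by (apply Rmult_integral; exact E2).
      destruct H as [->| ->]; nra.
    + assert (0 < 1 + a * x) by nra. assert (0 < 1 + b * x) by nra.
      assert (0 < (1 + a * x) * (1 + b * x)) by (apply Rmult_lt_0_compat; assumption). nra.
  - nra.
Qed.

Lemma koebe_derive (z : C) : Cmod z < 1 ->
  C_derive koebe z = ((1 + z) / ((1 - z) * (1 - z) * (1 - z)))%C.
Proof.
  intros Hz. assert (Hn : (1 - z)%C <> 0%C) by (apply Csub_neq_0, Cmod_lt_neq; rewrite Cmod_1; exact Hz).
  apply cderiv_unique.
  apply (cderiv_ext (fun z => z / ((1 - z) * (1 - z)))%C).
  { intros w. unfold koebe. f_equal. f_equal. simpl. ring. }
  assert (D : cderiv (fun z => 1 - z)%C z (0 - 1)%C) by (apply cderiv_minus; [apply cderiv_const|apply cderiv_id]).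
  eapply cderiv_eq.
  - apply (cderiv_div (fun z => z) (fun z => (1 - z) * (1 - z))%C); [apply cderiv_id|apply cderiv_mult; exact D|].
    apply Cmult_neq_0; exact Hn.
  - cbv beta. field. exact Hn.
Qed.

Lemma ln_Cmod_rhs (L z : C) (s : R) : L <> 0%C -> Cmod z < 1 ->
  ln (Cmod (L * Cpower (C_derive koebe z) s / Cpower (half_plane_map z) s)%C) =
  ln (Cmod L) + - (2 * s) * ln (Cmod (1 - z)).
Proof.
  intros HL Hz. assert (Hn : (1 - z)%C <> 0%C) by (apply Csub_neq_0, Cmod_lt_neq; rewrite Cmod_1; exact Hz).
  assert (Hp : (1 + z)%C <> 0%C) by (apply one_plus_neq_0, Hz).
  pose proof (proj1 (Cmod_gt_0 _) Hn) as Pn. pose proof (proj1 (Cmod_gt_0 _) Hp) as Pp. pose proof (proj1 (Cmod_gt_0 _) HL) as PL.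
  rewrite Cmod_div by apply Cexp_neq_0. rewrite Cmod_mult, !Cmod_Cpower, koebe_derive by exact Hz.
  unfold half_plane_map. rewrite !Cmod_div by (try exact Hn; repeat apply Cmult_neq_0; exact Hn). rewrite !Cmod_mult.
  unfold Rdiv. rewrite ln_mult; [|apply Rmult_lt_0_compat; [exact PL|apply exp_pos]|apply Rinv_0_lt_compat, exp_pos].
  rewrite ln_Rinv by apply exp_pos. rewrite (ln_mult (Cmod L)) by (exact PL || apply exp_pos). rewrite !ln_exp.
  assert (P3 : 0 < Cmod (1 - z) * Cmod (1 - z) * Cmod (1 - z)) by (repeat apply Rmult_lt_0_compat; exact Pn).
  rewrite !(ln_mult (Cmod (1 + z))) by (try apply Rinv_0_lt_compat; assumption).
  rewrite !ln_Rinv by assumption. rewrite !ln_mult by (try apply Rmult_lt_0_compat; assumption). ring.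
Qed.

Lemma Cmod_one_minus_circle (r t : R) : Cmod (1 - circle_point r t) ^ 2 = 1 - 2 * r * cos t + r ^ 2.
Proof.
  rewrite Cmod2_alt, circle_point_eq. simpl. pose proof (sin2_cos2 t) as SC. unfold Rsqr in SC.
  replace (r * (r * 1)) with (r * r * (sin t * sin t + cos t * cos t)) by (rewrite SC; ring). ring.
Qed.

Lemma koebe_even_decreasing (r s : R) : 0 < r < 1 -> 0 <= s ->
  even_decreasing (fun t => - (2 * s) * ln (Cmod (1 - circle_point r t))).
Proof.
  intros Hr Hs.
  assert (Hpos : forall t, 0 < Cmod (1 - circle_point r t)).
  { intros t. apply Cmod_gt_0, Csub_neq_0, Cmod_lt_neq. rewrite Cmod_1, Cmod_circle_point; lra. }
  assert (Hmon : forall p q, cos q <= cos p -> Cmod (1 - circle_point r p) <= Cmod (1 - circle_point r q)).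
  { intros p q H. pose proof (Cmod_one_minus_circle r p). pose proof (Cmod_one_minus_circle r q).
    pose proof (Hpos p). pose proof (Hpos q). nra. }
  split.
  - intros t. do 2 f_equal. apply Rle_antisym; apply Hmon; rewrite cos_neg; lra.
  - intros p q Hp Hpq Hq. assert (ln (Cmod (1 - circle_point r p)) <= ln (Cmod (1 - circle_point r q))).
    { apply ln_le; [apply Hpos|]. apply Hmon. apply cos_decr_1; lra. }
    nra.
Qed.

Theorem theorem1 (a b alpha : R) (n : nat) (Phi : R -> R)
    (hb : -1 <= b) (hab : b < a) (ha : a <= 1)
    (halpha : 0 < alpha <= 1) (hn : (1 <= n)%nat)
    (hPhi : convex_fun Phi) (hPhi_mono : nondecreasing Phi)
    (f : C -> C) (hf : class_T n alpha a b f)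
    (r : R) (hr : 0 < r < 1) :
  RInt (fun theta : R => Phi (ln (Cmod (C_derive f (circle_point r theta)))))
    (- PI) PI
  <=
  RInt (fun theta : R =>
          Phi (ln (Cmod
            (Lfun alpha a b (n - 1) (circle_point r theta)
               * Cpower (C_derive koebe (circle_point r theta)) (1 - alpha)
               / Cpower (half_plane_map (circle_point r theta)) (1 - alpha))%C)))
    (- PI) PI.
Proof.
  assert (Hbeta : 0 < / alpha) by (apply Rinv_0_lt_compat; lra).
  destruct (class_T_structure n alpha a b f ltac:(lra) hn hf) as (h & p & Hh & Hh0 & Hp & HP1 & Hf').
  destruct Hp as (Hph & Hp0 & om & Hom & Hom0 & Hom1 & Hpom).
  destruct (schwarz om Hom Hom0 (fun z Hz => Rlt_le _ _ (Hom1 z Hz))) as (v & Hv & Ev & Bv).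
  assert (HL0p : forall u, Cmod u < 1 -> 0 < Re (L0 a b u)) by (intros u Hu; apply L0_Re_pos; assumption).
  assert (Hb : -1 <= b <= 1) by lra.
  set (m := (n - 1)%nat) in *. set (Lm := ravg_iter (/ alpha) 0 m (L0 a b)).
  destruct (averaged_subordination a b (/ alpha) m hb hab ha Hbeta v p Hv Bv) as (w1 & Hw1 & Bw1).
  { intros z Hz. rewrite Hpom, Ev by exact Hz. reflexivity. }
  { exact Hph. }
  assert (HLm : hol 1 Lm) by (apply ravg_iter_hol; [exact Hbeta|apply L0_hol, Hb]).
  assert (HLmp : forall z, Cmod z < 1 -> 0 < Re (Lm z)) by (apply ravg_iter_Re_pos; [exact Hbeta|apply L0_hol, Hb|exact HL0p]).
  assert (HP1w : forall z, Cmod z < 1 -> (Cexp (RtoC alpha * h z) * (1 + z * C_derive h z))%C = Lm (w1 z)).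
  { intros z Hz. rewrite HP1 by exact Hz. symmetry. apply Bw1, Hz. }
  destruct (half_plane_root alpha h halpha Hh Hh0) as (w2 & Hw2 & Bw2 & Ew2).
  { intros z Hz. rewrite HP1w by exact Hz. apply HLmp. destruct (Bw1 z Hz). lra. }
  (* [Re F1] and [Re F2] are the logarithms of the two factors of the majorant. The principal
     logarithm is holomorphic here because [Lm z] and [1 - z] have positive real part. *)
  set (F1 := fun z => Clog (Lm z)). set (F2 := fun z => (RtoC (- (2 * (1 - alpha))) * Clog (1 - z))%C).
  assert (HF1 : hol 1 F1).
  { intros z Hz. apply (cdiff_comp Clog Lm); [|apply HLm, Hz]. eexists. apply Clog_cderiv. right. apply HLmp, Hz. }
  assert (H1z : forall z, Cmod z < 1 -> 0 < Re (1 - z)%C).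
  { intros z Hz. pose proof (re_le_Cmod z) as R1. apply Rabs_le_between in R1. simpl. unfold Re in *. lra. }
  assert (HF2 : hol 1 F2).
  { intros z Hz. apply (cdiff_mult (fun _ => RtoC (- (2 * (1 - alpha)))) (fun z => Clog (1 - z))); [ch|].
    apply (cdiff_comp Clog (fun z => 1 - z)%C); [|ch]. eexists. apply Clog_cderiv. right. apply H1z, Hz. }
  assert (RF1 : forall z, Re (F1 z) = ln (Cmod (Lm z))) by reflexivity.
  assert (RF2 : forall z, Re (F2 z) = - (2 * (1 - alpha)) * ln (Cmod (1 - z))).
  { intros z. unfold F2. rewrite re_scal_l. reflexivity. }
  assert (Hcp : forall t, Cmod (circle_point r t) = r) by (intros; apply Cmod_circle_point; lra).
  assert (Hcp1 : forall t, Cmod (circle_point r t) < 1) by (intros; rewrite Hcp; lra).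
  set (u1 := fun t => Re (F1 (w1 (circle_point r t)))). set (u2 := fun t => Re (F2 (w2 (circle_point r t)))).
  set (U1 := fun t => Re (F1 (circle_point r t))). set (U2 := fun t => Re (F2 (circle_point r t))).
  assert (Cw1 : forall t, ctsC (fun t => w1 (circle_point r t)) t) by (apply (hol_circ_cts w1 r 1); lra || assumption).
  assert (Cw2 : forall t, ctsC (fun t => w2 (circle_point r t)) t) by (apply (hol_circ_cts w2 r 1); lra || assumption).
  assert (Bw1' : forall z, Cmod z < 1 -> Cmod (w1 z) <= Cmod z) by (intros z Hz; apply Bw1, Hz).
  assert (Cu1 : forall t, ctsR u1 t).
  { intros t. apply cont_Re. apply (cont_hol 1 F1 (fun t => w1 (circle_point r t))); [exact HF1|apply Cw1|].
    specialize (Bw1' _ (Hcp1 t)). specialize (Hcp1 t). lra. }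
  assert (Cu2 : forall t, ctsR u2 t).
  { intros t. apply cont_Re. apply (cont_hol 1 F2 (fun t => w2 (circle_point r t))); [exact HF2|apply Cw2|].
    specialize (Bw2 _ (Hcp1 t)). specialize (Hcp1 t). lra. }
  assert (CU1 : forall t, ctsR U1 t) by (intros t; apply cont_Re, (hol_circ_cts F1 r 1); lra || assumption).
  assert (CU2 : forall t, ctsR U2 t) by (intros t; apply cont_Re, (hol_circ_cts F2 r 1); lra || assumption).
  assert (ED1 : even_decreasing U1).
  { split.
    - intros t. unfold U1. rewrite !RF1. f_equal.
      replace (circle_point r (- t)) with (Cconj (circle_point r t)).
      + unfold Lm. rewrite ravg_iter_conj by (assumption || apply Hcp1). apply Cmod_conj.
      + rewrite !circle_point_eq, cos_neg, sin_neg. apply C_ext; simpl; ring.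
    - intros s t Hs Hst Ht. unfold U1. rewrite !RF1. apply ln_le.
      + apply Cmod_gt_0, Re_pos_neq_0, HLmp, Hcp1.
      + apply Cmod_Lm_decreasing; lra || assumption. }
  assert (ED2 : even_decreasing U2).
  { destruct (koebe_even_decreasing r (1 - alpha) hr ltac:(lra)) as [E1 E2]. split.
    - intros t. unfold U2. rewrite !RF2. apply E1.
    - intros s t Hs Hst Ht. unfold U2. rewrite !RF2. apply E2; assumption. }
  (* Here [u1] is [alpha * Re h + ln |1 + z h'|], by [HP1w], and [u2] is [(1 - alpha) * Re h],
     because [1 - w2 z] equals [exp (- h / 2)]. *)
  assert (EL : forall t, ln (Cmod (C_derive f (circle_point r t))) = u1 t + u2 t).
  { intros t. set (z := circle_point r t). assert (Hz : Cmod z < 1) by apply Hcp1.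
    unfold u1, u2. fold z. rewrite RF1, RF2, Hf', <- HP1w, Ew2, Cmod_Cexp, ln_exp by exact Hz.
    assert (Hnz : (1 + z * C_derive h z)%C <> 0%C).
    { intros E. specialize (HLmp (w1 z)). rewrite <- HP1w, E in HLmp by exact Hz.
      replace (Cexp (RtoC alpha * h z) * 0)%C with (RtoC 0) in HLmp by ring. simpl in HLmp.
      specialize (Bw1' z Hz). specialize (HLmp ltac:(lra)). lra. }
    apply Cmod_gt_0 in Hnz. rewrite !Cmod_mult, !Cmod_Cexp, !ln_mult, !ln_exp by (exact Hnz || apply exp_pos).
    rewrite re_opp, re_scal_l. replace (/ 2 * h z)%C with (RtoC (/ 2) * h z)%C by (rewrite RtoC_inv by lra; reflexivity).
    rewrite re_scal_l. field. }
  assert (ER : forall t, ln (Cmod (Lfun alpha a b m (circle_point r t) * Cpower (C_derive koebe (circle_point r t)) (1 - alpha)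
               / Cpower (half_plane_map (circle_point r t)) (1 - alpha))%C) = U1 t + U2 t).
  { intros t. unfold U1, U2. rewrite RF1, RF2, Lfun_ravg_iter by (lra || apply Hcp1). fold Lm.
    apply ln_Cmod_rhs; [apply Re_pos_neq_0, HLmp, Hcp1|apply Hcp1]. }
  rewrite (RInt_ext _ (fun t => Phi (u1 t + u2 t))) by (intros t _; rewrite EL; reflexivity).
  rewrite (RInt_ext (fun t => Phi (ln (Cmod (_ / _)%C))) (fun t => Phi (U1 t + U2 t))) by (intros t _; rewrite ER; reflexivity).
  apply convex_majorization; [exact hPhi|exact hPhi_mono| | |].
  - intros t. apply cont_Rplus; [apply Cu1|apply Cu2].
  - intros t. apply cont_Rplus; [apply CU1|apply CU2].
  - apply hinge_sum; try assumption; intros c.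
    + apply (littlewood F1 w1); assumption.
    + apply (littlewood F2 w2); assumption.
Qed.
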